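(* Let $f$ be a nonconstant entire function and $b$ a nonzero complex number such that $f$ and $f'$ share the value $b$ allowing ramification. Then the derivative $f'$ has no nonzero Picard value, i.e. $f'$ takes every nonzero complex value. In particular, $b$ is not a Picard value of $f'$; consequently $b$ is not a totally ramified value of $f$, and a fortiori $b$ is not a Picard value of $f$. Moreover, if $f$ is transcendental, then $f$ takes the value $b$ infinitely often.
   Context: Definition. For an entire function $f$ and a nonzero complex number $b$, $f$ and $f'$ share the value $b$ allowing ramification if for all $z\in\mathbb{C}$: $f(z)=b$ implies $f'(z)\in\{b,0\}$, and $f'(z)=b$ implies $f(z)=b$. A Picard value of an entire function $g$ is a value $c\in\mathbb{C}$ with $g(z)\neq c$ for all $z\in\mathbb{C}$. A value $c\in\mathbb{C}$ is a totally ramified value of the entire function $f$ if every $c$-point of $f$ is multiple, i.e. $f(z)=c$ implies $f'(z)=0$ (this includes vacuously the case that $c$ is a Picard value of $f$). An entire function is transcendental if it is not a polynomial. *)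

(* Defs.v *)
From Stdlib Require Import Reals List.
From Coquelicot Require Import Coquelicot.

Local Open Scope C_scope.

(* Complex differentiability everywhere: the scalar field of [ex_derive] is
   [C_AbsRing] here, so this is not real differentiability of a map R^2 -> R^2.
   For such f, the total function [C_derive f] is the derivative of f
   ([C_derive_correct]). *)
Definition entire (f : C -> C) : Prop :=
  forall z : C, @ex_derive C_AbsRing C_NormedModule f z.

Definition nonconstant (f : C -> C) : Prop :=
  ~ exists c : C, forall z : C, f z = c.

Definition is_polynomial (f : C -> C) : Prop :=
  exists (n : nat) (a : nat -> C),
    forall z : C, f z = sum_n (fun k => a k * Cpow z k) n.

Definition transcendental (f : C -> C) : Prop := ~ is_polynomial f.

Definition share_allowing_ramification (f : C -> C) (b : C) : Prop :=
  forall z : C,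
    (f z = b -> C_derive f z = b \/ C_derive f z = 0) /\
    (C_derive f z = b -> f z = b).

Definition Picard_value (g : C -> C) (c : C) : Prop :=
  forall z : C, g z <> c.

Definition totally_ramified_value (f : C -> C) (c : C) : Prop :=
  forall z : C, f z = c -> C_derive f z = 0.

(* The set of c-points of g is infinite: no finite list exhausts it. *)
Definition takes_infinitely_often (g : C -> C) (c : C) : Prop :=
  forall l : list C, exists z : C, g z = c /\ ~ In z l.

(* Main.v *)
Require Import Defs.
From Stdlib Require Import Reals List Lra Lia.
From Stdlib Require Import Classical ClassicalEpsilon FunctionalExtensionality.
From Coquelicot Require Import Coquelicot.

(** Put h = f - b. Then h = 0 implies h' = b or h' = 0, and h' = b implies
    h = 0, so everything is about one entire function h.

    The heart is a normality criterion ([spherical_derivative_bounded]): if,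
    outside some disc, h' is bounded on the zeros of h and omits a value c <> 0,
    then |h'| <= Lam (1 + |h|^2) everywhere. Suppose not. The quantity
    e = sqrt (max 0 (|h'| - A)) / |h| is then unbounded, and it is multiplied by
    rho when h is replaced by h (z0 + rho z) / rho. Zalcman's point picking
    ([point_selection]) therefore yields functions g_n of this form with
    |g_n'| <= A + 4 |g_n|^2 on the disc of radius n and |g_n'| >= A + |g_n|^2 at 0,
    and they inherit the hypotheses on zeros and on c. A bounded spherical
    derivative forces exponential growth ([spherical_growth], after Clunie and
    Hayman), and a zero-free function of exponential growth is nearly
    beta exp (a z) ([log_derivative_nearly_constant]); this applies to g_n' - c.
    So on a subsequence g_n and g_n' tend to G and G', where
    G' = c + beta exp (a z). Such a G has a simple zero with G' as
    large as desired ([affine_exp_simple_zero]; for a = 0 the size of A serves),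
    it persists in g_n ([newton_zero]), and the bound on h' at the zeros of h
    is violated.

    The same growth bound then shows that h is of exponential type. If h' omits
    c <> 0 everywhere, then h' - c = beta exp (a z). For a <> 0 some zero of h has
    |h'| > |b|; for a = 0 the function h is affine of slope b, and h' = b forces
    h = 0: both are absurd, so h' takes every nonzero value. The statements on
    Picard and totally ramified values follow from a point where f' = b.

    If h has finitely many zeros, then h' = b only at those zeros, so the
    criterion applies with c = b, and dividing out the zeros gives
    h = kap P exp (a z) with a polynomial P. For a <> 0 the equation h' = b has
    solutions arbitrarily far out ([polynomial_exp_derivative_value]), hence a = 0
    and h is a polynomial.

    The function theory rests on a single consequence of Goursat's lemma,
    [centre_nonneg]: for a function with a limit at the centre of a disc, a
    nonnegative real part on a circle passes to the centre. Applied to suitable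
    combinations it gives Cauchy's estimate, the differentiability of f', the
    Borel-Caratheodory inequality and, through a disc automorphism, Harnack's
    inequality. *)

Local Open Scope R_scope.

(** * The complex derivative *)

(** The complex numbers carry two normed-module structures over themselves, with
    different balls but the same norm; this is the common content of the two
    derivatives they give. *)
Definition cdiff (f : C -> C) (z l : C) : Prop :=
  forall eps : R, 0 < eps -> exists del : R, 0 < del /\
    forall w : C, Cmod (w - z) < del ->
      Cmod (f w - f z - l * (w - z)) <= eps * Cmod (w - z).

Definition ccont (f : C -> C) (z : C) : Prop :=
  forall eps : R, 0 < eps -> exists del : R, 0 < del /\
    forall w : C, Cmod (w - z) < del -> Cmod (f w - f z) < eps.

Lemma Cmod_triangle_sub (a b : C) : Cmod (a - b) <= Cmod a + Cmod b.
Proof.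
  unfold Cminus. eapply Rle_trans; [apply Cmod_triangle|]. rewrite Cmod_opp; lra.
Qed.

Lemma Cmod_sub_comm (a b : C) : Cmod (a - b) = Cmod (b - a).
Proof. rewrite <- (Cmod_opp (a - b)). f_equal. ring. Qed.

Lemma Cmod_sub_trans (a b c : C) : Cmod (a - c) <= Cmod (a - b) + Cmod (b - c).
Proof. replace (a - c)%C with ((a - b) + (b - c))%C by ring. apply Cmod_triangle. Qed.

Lemma Cmod_sub_lower (a b : C) : Cmod a - Cmod b <= Cmod (a - b).
Proof.
  generalize (Cmod_triangle (a - b) b). replace (a - b + b)%C with a by ring. lra.
Qed.

Lemma Cmod_zero_sub (a : C) : Cmod (a - a) = 0.
Proof. replace (a - a)%C with (RtoC 0) by ring. apply Cmod_0. Qed.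

Lemma Cmod_le_sub_add (a b : C) : Cmod a <= Cmod (a - b) + Cmod b.
Proof. generalize (Cmod_sub_lower a b). lra. Qed.

Lemma Rlt_Rmin_l (x a b : R) : x < Rmin a b -> x < a.
Proof. intros H. exact (Rlt_le_trans _ _ _ H (Rmin_l a b)). Qed.

Lemma Rlt_Rmin_r (x a b : R) : x < Rmin a b -> x < b.
Proof. intros H. exact (Rlt_le_trans _ _ _ H (Rmin_r a b)). Qed.

Lemma RtoC_neq_0 (x : R) : x <> 0 -> RtoC x <> 0.
Proof. intros H E. apply H. apply RtoC_inj. exact E. Qed.

Lemma cdiff_is_derive (f : C -> C) (z l : C) :
  cdiff f z l <-> @is_derive C_AbsRing (AbsRing_NormedModule C_AbsRing) f z l.
Proof.
  split.
  - intros H. split.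
    + apply is_linear_scal_l.
    + intros x Hx eps.
      assert (Hxz : x = z).
      { symmetry; apply (is_filter_lim_locally_unique (K:=C_AbsRing) (V:=AbsRing_NormedModule C_AbsRing)).
        exact Hx. }
      subst x.
      destruct (H eps (cond_pos eps)) as [d [Hd Hf]].
      exists (mkposreal d Hd). intros w Hw.
      specialize (Hf w Hw). rewrite (Cmult_comm l) in Hf. exact Hf.
  - intros [_ H] eps Heps.
    destruct (H z (fun P HP => HP) (mkposreal eps Heps)) as [d Hd].
    exists d. split; [apply cond_pos|]. intros w Hw.
    rewrite (Cmult_comm l). exact (Hd w Hw).
Qed.

Lemma is_derive_cdiff (f : C -> C) (z l : C) :
  cdiff f z l <-> @is_derive C_AbsRing C_NormedModule f z l.
Proof.
  split.
  - intros H. split.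
    + apply is_linear_scal_l.
    + intros x Hx eps.
      assert (Hxz : x = z).
      { symmetry; apply (is_filter_lim_locally_unique (K:=C_AbsRing) (V:=AbsRing_NormedModule C_AbsRing)).
        exact Hx. }
      subst x.
      destruct (H eps (cond_pos eps)) as [d [Hd Hf]].
      exists (mkposreal d Hd). intros w Hw.
      specialize (Hf w Hw). rewrite (Cmult_comm l) in Hf. exact Hf.
  - intros [_ H] eps Heps.
    destruct (H z (fun P HP => HP) (mkposreal eps Heps)) as [d Hd].
    exists d. split; [apply cond_pos|]. intros w Hw.
    rewrite (Cmult_comm l). exact (Hd w Hw).
Qed.

Lemma cdiff_const (a z : C) : cdiff (fun _ => a) z 0.
Proof. apply cdiff_is_derive.
  exact (@is_derive_const C_AbsRing (AbsRing_NormedModule C_AbsRing) a z). Qed.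

Lemma cdiff_id (z : C) : cdiff (fun w => w) z 1.
Proof. apply cdiff_is_derive. exact (@is_derive_id C_AbsRing z). Qed.

Lemma cdiff_plus (f g : C -> C) (z l m : C) :
  cdiff f z l -> cdiff g z m -> cdiff (fun w => f w + g w)%C z (l + m).
Proof. rewrite !cdiff_is_derive.
  exact (@is_derive_plus C_AbsRing (AbsRing_NormedModule C_AbsRing) f g z l m). Qed.

Lemma cdiff_mult (f g : C -> C) (z l m : C) :
  cdiff f z l -> cdiff g z m -> cdiff (fun w => f w * g w)%C z (l * g z + f z * m).
Proof.
  rewrite !cdiff_is_derive. intros H1 H2.
  exact (@is_derive_mult C_AbsRing f g z l m H1 H2 Cmult_comm).
Qed.

Lemma cdiff_comp (f g : C -> C) (z l m : C) :
  cdiff f (g z) l -> cdiff g z m -> cdiff (fun w => f (g w)) z (m * l).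
Proof. rewrite !cdiff_is_derive.
  exact (@is_derive_comp C_AbsRing (AbsRing_NormedModule C_AbsRing) f g z l m). Qed.

Lemma cdiff_ext_loc (f g : C -> C) (z l : C) (r : R) :
  0 < r -> (forall w, Cmod (w - z) < r -> f w = g w) -> cdiff f z l -> cdiff g z l.
Proof.
  intros Hr He H eps Heps. destruct (H eps Heps) as [d [Hd Hf]].
  exists (Rmin d r). split; [apply Rmin_pos; assumption|].
  intros w Hw. rewrite <- He, <- He.
  - apply Hf. exact (Rlt_Rmin_l _ _ _ Hw).
  - rewrite Cmod_zero_sub; exact Hr.
  - exact (Rlt_Rmin_r _ _ _ Hw).
Qed.

Lemma cdiff_ext (f g : C -> C) (z l : C) :
  (forall w, f w = g w) -> cdiff f z l -> cdiff g z l.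
Proof. intros He. apply (cdiff_ext_loc f g z l 1); [lra|]. intros; apply He. Qed.

Lemma cdiff_eq (f : C -> C) (z l m : C) : l = m -> cdiff f z l -> cdiff f z m.
Proof. intros ->. exact (fun H => H). Qed.

Lemma cdiff_scal (a : C) (f : C -> C) (z l : C) :
  cdiff f z l -> cdiff (fun w => a * f w)%C z (a * l).
Proof.
  intros H. eapply cdiff_eq; [|exact (cdiff_mult _ _ _ _ _ (cdiff_const a z) H)]. cbv beta. ring.
Qed.

Lemma cdiff_opp (f : C -> C) (z l : C) :
  cdiff f z l -> cdiff (fun w => - f w)%C z (- l).
Proof.
  intros H. apply (cdiff_ext (fun w => (-(1)) * f w)%C); [intros; ring|].
  eapply cdiff_eq; [|exact (cdiff_scal (-(1)) f z l H)]. cbv beta; ring.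
Qed.

Lemma cdiff_minus (f g : C -> C) (z l m : C) :
  cdiff f z l -> cdiff g z m -> cdiff (fun w => f w - g w)%C z (l - m).
Proof. intros H1 H2. exact (cdiff_plus _ _ _ _ _ H1 (cdiff_opp _ _ _ H2)). Qed.

Lemma cdiff_affine (a b z : C) : cdiff (fun w => a + b * w)%C z b.
Proof.
  eapply cdiff_eq;
    [|exact (cdiff_plus _ _ _ _ _ (cdiff_const a z) (cdiff_scal b _ _ _ (cdiff_id z)))].
  cbv beta; ring.
Qed.

Lemma cdiff_ccont (f : C -> C) (z l : C) : cdiff f z l -> ccont f z.
Proof.
  intros H eps Heps. destruct (H 1 Rlt_0_1) as [d [Hd Hf]].
  assert (HM : 0 < Cmod l + 1 + 1) by (generalize (Cmod_ge_0 l); lra).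
  exists (Rmin d (eps / (Cmod l + 1 + 1))). split.
  - apply Rmin_pos; [lra|]. apply Rdiv_lt_0_compat; lra.
  - intros w Hw.
    assert (H1 : Cmod (w - z) < d) by (exact (Rlt_Rmin_l _ _ _ Hw)).
    assert (H2 : Cmod (w - z) < eps / (Cmod l + 1 + 1))
      by (exact (Rlt_Rmin_r _ _ _ Hw)).
    specialize (Hf w H1).
    replace (f w - f z)%C with ((f w - f z - l * (w - z)) + l * (w - z))%C by ring.
    eapply Rle_lt_trans; [apply Cmod_triangle|]. rewrite Cmod_mult.
    apply Rlt_div_r in H2; [|exact HM].
    generalize (Cmod_ge_0 (w - z)). intros. nra.
Qed.

Lemma cdiff_Cinv (z : C) : z <> 0 -> cdiff (fun w => / w)%C z (- / (z * z)).
Proof.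
  intros Hz eps Heps. assert (Hm := proj1 (Cmod_gt_0 z) Hz). set (m := Cmod z) in *.
  exists (Rmin (m / 2) (eps * m ^ 3 / 2)). split.
  { apply Rmin_pos; [lra|]. assert (0 < m ^ 3) by (apply pow_lt; exact Hm). nra. }
  intros w Hw.
  assert (H1 : Cmod (w - z) < m / 2) by (exact (Rlt_Rmin_l _ _ _ Hw)).
  assert (H2 : Cmod (w - z) < eps * m ^ 3 / 2)
    by (exact (Rlt_Rmin_r _ _ _ Hw)).
  assert (Hw2 : m / 2 < Cmod w).
  { generalize (Cmod_sub_lower z w). rewrite Cmod_sub_comm. fold m. lra. }
  assert (Hw0 : w <> 0) by (apply Cmod_gt_0; lra).
  replace (/ w - / z - - / (z * z) * (w - z))%C
    with ((w - z) * ((w - z) * / (w * (z * z))))%C by (field; auto).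
  rewrite !Cmod_mult, Cmod_inv by (repeat apply Cmult_neq_0; assumption).
  rewrite !Cmod_mult. fold m. rewrite Rmult_comm.
  apply Rmult_le_compat_r; [apply Cmod_ge_0|].
  assert (Hp : 0 < Cmod w * (m * m)) by (repeat apply Rmult_lt_0_compat; lra).
  apply (Rmult_le_reg_r (Cmod w * (m * m))); [exact Hp|].
  rewrite Rmult_assoc, Rinv_l, Rmult_1_r by lra.
  assert (eps * m ^ 3 / 2 <= eps * (Cmod w * (m * m))); [|lra].
  replace (eps * m ^ 3 / 2) with (eps * (m / 2 * (m * m))) by field.
  apply Rmult_le_compat_l; [lra|]. apply Rmult_le_compat_r; nra.
Qed.

Lemma cdiff_inv (f : C -> C) (z l : C) :
  f z <> 0 -> cdiff f z l -> cdiff (fun w => / f w)%C z (- l / (f z * f z)).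
Proof.
  intros Hz H.
  eapply cdiff_eq; [|exact (cdiff_comp (fun w => / w)%C f z _ _ (cdiff_Cinv _ Hz) H)].
  cbv beta; field. exact Hz.
Qed.

Lemma cdiff_div (f g : C -> C) (z l m : C) :
  g z <> 0 -> cdiff f z l -> cdiff g z m ->
  cdiff (fun w => f w / g w)%C z ((l * g z - f z * m) / (g z * g z)).
Proof.
  intros Hz H1 H2.
  eapply cdiff_eq; [|exact (cdiff_mult _ _ _ _ _ H1 (cdiff_inv _ _ _ Hz H2))].
  cbv beta; field. exact Hz.
Qed.

Lemma re_minus (a b : C) : Re (a - b) = Re a - Re b.
Proof. unfold Cminus. rewrite re_plus, re_opp. ring. Qed.

Lemma im_minus (a b : C) : Im (a - b) = Im a - Im b.
Proof. unfold Cminus. rewrite im_plus, im_opp. ring. Qed.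

Lemma C_re_im (z : C) : z = (Re z + Im z * Ci)%C.
Proof. destruct z as [x y]. apply injective_projections; simpl; ring. Qed.

(** * Paths and the mean value inequality *)

(** Componentwise, because the real mean value theorem and the real integral are
    applied to each coordinate. *)
Definition pdiff (F : R -> C) (t : R) (v : C) : Prop :=
  is_derive (fun s => Re (F s)) t (Re v) /\ is_derive (fun s => Im (F s)) t (Im v).

Lemma Re_le_Cmod (z : C) : Rabs (Re z) <= Cmod z.
Proof. apply re_le_Cmod. Qed.

Lemma Im_le_Cmod (z : C) : Rabs (Im z) <= Cmod z.
Proof. eapply Rle_trans; [apply Rmax_r|apply (Rmax_Cmod z)]. Qed.

Lemma pdiff_intro (F : R -> C) (t : R) (v : C) :
  (forall eps, 0 < eps -> exists del, 0 < del /\ forall s, Rabs (s - t) < del ->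
     Cmod (F s - F t - v * (s - t)%R) <= eps * Rabs (s - t)) -> pdiff F t v.
Proof.
  intros H.
  assert (K : forall (p : C -> R), (forall a b, p (a - b)%C = p a - p b) ->
     (forall (a : C) (r : R), p (a * r)%C = p a * r) -> (forall a, Rabs (p a) <= Cmod a) ->
     is_derive (fun s => p (F s)) t (p v)).
  { intros p Hs Hm Ha. apply is_derive_Reals. intros eps Heps.
    destruct (H (eps / 2) ltac:(lra)) as [d [Hd Hf]].
    exists (mkposreal d Hd). intros h Hh Hhd. simpl in Hhd.
    specialize (Hf (t + h)). replace (t + h - t) with h in Hf by ring.
    specialize (Hf Hhd).
    assert (Hr : Rabs (p (F (t + h)) - p (F t) - p v * h) <= eps / 2 * Rabs h).
    { rewrite <- Hm, <- !Hs. eapply Rle_trans; [apply Ha|]. exact Hf. }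
    assert (Hh' : 0 < Rabs h) by (apply Rabs_pos_lt; exact Hh).
    replace ((p (F (t + h)) - p (F t)) / h - p v)
      with ((p (F (t + h)) - p (F t) - p v * h) * / h) by (field; exact Hh).
    rewrite Rabs_mult, Rabs_inv.
    apply (Rmult_lt_reg_r (Rabs h)); [exact Hh'|].
    rewrite Rmult_assoc, Rinv_l, Rmult_1_r by lra. nra. }
  split; apply K.
  - intros a b. unfold Re, Cminus, Cplus, Copp; simpl; ring.
  - intros a r. unfold Re, Cmult, RtoC; simpl; ring.
  - apply Re_le_Cmod.
  - intros a b. unfold Im, Cminus, Cplus, Copp; simpl; ring.
  - intros a r. unfold Im, Cmult, RtoC; simpl; ring.
  - apply Im_le_Cmod.
Qed.

Lemma pdiff_line (f : C -> C) (p v l : C) (t : R) :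
  cdiff f (p + t * v) l -> pdiff (fun s => f (p + s * v)%C) t (l * v).
Proof.
  intros H. apply pdiff_intro. intros eps Heps.
  assert (Hv := Cmod_ge_0 v).
  destruct (H (eps / (Cmod v + 1))) as [d [Hd Hf]]; [apply Rdiv_lt_0_compat; lra|].
  exists (d / (Cmod v + 1)). split; [apply Rdiv_lt_0_compat; lra|].
  intros s Hs.
  assert (Heq : (p + s * v - (p + t * v))%C = ((s - t)%R * v)%C)
    by (rewrite RtoC_minus; ring).
  assert (Hm : Cmod (p + s * v - (p + t * v)) = Rabs (s - t) * Cmod v)
    by (rewrite Heq, Cmod_mult, Cmod_R; reflexivity).
  specialize (Hf (p + s * v)%C). rewrite Hm in Hf.
  assert (Hlt : Rabs (s - t) * (Cmod v + 1) < d).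
  { apply Rlt_div_r in Hs; [|lra]; lra. }
  assert (Hs0 := Rabs_pos (s - t)).
  assert (Hlt2 : Rabs (s - t) * Cmod v < d) by nra.
  specialize (Hf Hlt2). rewrite Heq in Hf.
  replace (l * v * (s - t)%R)%C with (l * ((s - t)%R * v))%C by ring.
  eapply Rle_trans; [exact Hf|].
  apply (Rmult_le_reg_r (Cmod v + 1)); [lra|].
  replace (eps / (Cmod v + 1) * (Rabs (s - t) * Cmod v) * (Cmod v + 1))
    with (eps * (Rabs (s - t) * Cmod v)) by (field; lra).
  nra.
Qed.

(** Project F onto the direction of F 1 - F 0 and apply the real mean value
    theorem. *)
Lemma mean_value_path (F dF : R -> C) (M : R) :
  (forall t, 0 <= t <= 1 -> pdiff F t (dF t)) ->
  (forall t, 0 <= t <= 1 -> Cmod (dF t) <= M) ->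
  Cmod (F 1 - F 0) <= M.
Proof.
  intros HF HM. set (u := (F 1 - F 0)%C).
  destruct (MVT_gen (fun t => Re u * Re (F t) + Im u * Im (F t)) 0 1
              (fun t => Re u * Re (dF t) + Im u * Im (dF t))) as [c [Hc He]].
  - rewrite Rmin_left, Rmax_right by lra. intros t Ht.
    destruct (HF t ltac:(lra)) as [H1 H2].
    apply (is_derive_plus (fun t => Re u * Re (F t)) (fun t => Im u * Im (F t)));
      apply is_derive_scal; assumption.
  - rewrite Rmin_left, Rmax_right by lra. intros t Ht.
    destruct (HF t ltac:(lra)) as [H1 H2].
    apply continuity_pt_filterlim.
    apply (ex_derive_continuous (fun t => Re u * Re (F t) + Im u * Im (F t))).
    eexists. apply (is_derive_plus (fun t => Re u * Re (F t)) (fun t => Im u * Im (F t)));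
      apply is_derive_scal; eassumption.
  - rewrite Rmin_left, Rmax_right in Hc by lra.
    assert (E : Cmod u * Cmod u = Re u * Re (dF c) + Im u * Im (dF c)).
    { transitivity (Re u * Re u + Im u * Im u).
      - assert (E2 := Cmod2_alt u). rewrite <- !Rsqr_pow2 in E2. unfold Rsqr in E2. lra.
      - rewrite Rminus_0_r, Rmult_1_r in He. rewrite <- He.
        assert (E1 : Re u = Re (F 1) - Re (F 0)) by (unfold u, Re; simpl; ring).
        assert (E2 : Im u = Im (F 1) - Im (F 0)) by (unfold u, Im; simpl; ring).
        rewrite E1, E2. ring. }
    assert (E2 : Re u * Re (dF c) + Im u * Im (dF c) <= Cmod u * Cmod (dF c)).
    { replace (Re u * Re (dF c) + Im u * Im (dF c)) with (Re (Cconj u * dF c))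
        by (unfold Re, Im, Cconj; simpl; ring).
      rewrite <- (Cmod_conj u), <- Cmod_mult.
      eapply Rle_trans; [apply Rle_abs|apply Re_le_Cmod]. }
    destruct (Req_dec (Cmod u) 0) as [E0|E0].
    + rewrite E0. eapply Rle_trans; [apply Cmod_ge_0|apply (HM 0); lra].
    + assert (0 < Cmod u) by (generalize (Cmod_ge_0 u); lra).
      eapply Rle_trans; [|apply (HM c Hc)]. nra.
Qed.

Lemma mean_value_ineq (f df : C -> C) (z w : C) (M : R) :
  (forall t : R, 0 <= t <= 1 -> cdiff f (z + t * (w - z)) (df (z + t * (w - z))%C)) ->
  (forall t : R, 0 <= t <= 1 -> Cmod (df (z + t * (w - z))%C) <= M) ->
  Cmod (f w - f z) <= M * Cmod (w - z).
Proof.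
  intros H HM.
  generalize (mean_value_path (fun t => f (z + t * (w - z))%C)
    (fun t => df (z + t * (w - z))%C * (w - z))%C (M * Cmod (w - z))).
  replace (z + 1 * (w - z))%C with w by ring.
  replace (z + 0 * (w - z))%C with z by ring.
  intros K. apply K.
  - intros t Ht. apply pdiff_line. apply H; exact Ht.
  - intros t Ht. rewrite Cmod_mult. apply Rmult_le_compat_r; [apply Cmod_ge_0|].
    apply HM; exact Ht.
Qed.

Lemma segment_in_disc (c z w : C) (r t : R) :
  Cmod (z - c) < r -> Cmod (w - c) < r -> 0 <= t <= 1 ->
  Cmod (z + t * (w - z) - c) < r.
Proof.
  intros Hz Hw Ht.
  replace (z + t * (w - z) - c)%C with ((1 - t)%R * (z - c) + t * (w - c))%C
    by (rewrite RtoC_minus; ring).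
  eapply Rle_lt_trans; [apply Cmod_triangle|].
  rewrite !Cmod_mult, !Cmod_R, !Rabs_pos_eq by lra.
  destruct (Req_dec t 0) as [->|Ht0]; [lra|]. nra.
Qed.

Lemma mean_value_disc (f df : C -> C) (c : C) (r M : R) (z w : C) :
  (forall x, Cmod (x - c) < r -> cdiff f x (df x)) ->
  (forall x, Cmod (x - c) < r -> Cmod (df x) <= M) ->
  Cmod (z - c) < r -> Cmod (w - c) < r ->
  Cmod (f w - f z) <= M * Cmod (w - z).
Proof.
  intros H HM Hz Hw. apply (mean_value_ineq f df); intros t Ht.
  - apply H. apply segment_in_disc; assumption.
  - apply HM. apply segment_in_disc; assumption.
Qed.

(** * The complex exponential *)

Definition Cexp (z : C) : C := (exp (Re z) * cos (Im z), exp (Re z) * sin (Im z)).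

Lemma Cexp_0 : Cexp 0 = 1.
Proof. unfold Cexp; simpl. rewrite exp_0, cos_0, sin_0. unfold RtoC. f_equal; ring. Qed.

Lemma Cexp_plus (z w : C) : Cexp (z + w) = (Cexp z * Cexp w)%C.
Proof.
  unfold Cexp. rewrite re_plus, im_plus, exp_plus, cos_plus, sin_plus.
  unfold Cmult; simpl. f_equal; ring.
Qed.

Lemma Cmod_Cexp (z : C) : Cmod (Cexp z) = exp (Re z).
Proof.
  unfold Cexp, Cmod; simpl.
  replace (exp (Re z) * cos (Im z) * (exp (Re z) * cos (Im z) * 1) +
     exp (Re z) * sin (Im z) * (exp (Re z) * sin (Im z) * 1))
    with (exp (Re z) * exp (Re z) * (Rsqr (sin (Im z)) + Rsqr (cos (Im z))))
    by (unfold Rsqr; ring).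
  rewrite sin2_cos2, Rmult_1_r. apply sqrt_square. left; apply exp_pos.
Qed.

Lemma Cexp_neq_0 (z : C) : Cexp z <> 0.
Proof. apply Cmod_gt_0. rewrite Cmod_Cexp. apply exp_pos. Qed.

Lemma Cexp_opp (z : C) : Cexp (- z) = (/ Cexp z)%C.
Proof.
  assert (E : (Cexp z * Cexp (- z))%C = 1).
  { rewrite <- Cexp_plus. replace (z + - z)%C with (RtoC 0) by ring. apply Cexp_0. }
  assert (Hz := Cexp_neq_0 z).
  rewrite <- (Cmult_1_r (/ Cexp z)), <- E. field. exact Hz.
Qed.

Lemma Re_le_Cmod_pos (z : C) : Re z <= Cmod z.
Proof. eapply Rle_trans; [apply Rle_abs|apply Re_le_Cmod]. Qed.

Lemma exp_mono (x y : R) : x <= y -> exp x <= exp y.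
Proof. intros [H| ->]; [left; apply exp_increasing; exact H|right; reflexivity]. Qed.

Lemma Cexp_sub_1 (h : C) : Cmod (Cexp h - 1) <= Cmod h * exp (Cmod h).
Proof.
  generalize (mean_value_path (fun t => Cexp (t * h)) (fun t => h * Cexp (t * h))%C
    (Cmod h * exp (Cmod h))).
  replace (0 * h)%C with (RtoC 0) by ring. rewrite Cexp_0, Cmult_1_l. intro K. apply K.
  - intros t _. destruct h as [x y]. unfold Cexp, pdiff, Re, Im, Cmult, RtoC; simpl.
    split; auto_derive; auto; unfold Rminus; ring.
  - intros t Ht. rewrite Cmod_mult, Cmod_Cexp.
    apply Rmult_le_compat_l; [apply Cmod_ge_0|].
    apply exp_mono. eapply Rle_trans; [apply Re_le_Cmod_pos|].
    rewrite Cmod_mult, Cmod_R, Rabs_pos_eq by lra. generalize (Cmod_ge_0 h). nra.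
Qed.

Lemma Cexp_taylor2 (h : C) :
  Cmod (Cexp h - 1 - h) <= Cmod h * Cmod h * exp (Cmod h).
Proof.
  generalize (mean_value_path (fun t => Cexp (t * h) - t * h)%C
    (fun t => h * (Cexp (t * h) - 1))%C (Cmod h * Cmod h * exp (Cmod h))).
  replace (0 * h)%C with (RtoC 0) by ring. rewrite Cexp_0, Cmult_1_l.
  replace (Cexp h - h - (1 - 0))%C with (Cexp h - 1 - h)%C by ring.
  intro K. apply K.
  - intros t _. destruct h as [x y].
    unfold Cexp, pdiff, Re, Im, Cmult, Cminus, Cplus, Copp, RtoC; simpl.
    split; auto_derive; auto; unfold Rminus; ring.
  - intros t Ht. rewrite Cmod_mult, Rmult_assoc.
    apply Rmult_le_compat_l; [apply Cmod_ge_0|].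
    eapply Rle_trans; [apply Cexp_sub_1|].
    rewrite Cmod_mult, Cmod_R, Rabs_pos_eq by lra.
    assert (Hh := Cmod_ge_0 h).
    apply Rmult_le_compat; try nra; [left; apply exp_pos|].
    apply exp_mono; nra.
Qed.

Lemma cdiff_Cexp (z : C) : cdiff Cexp z (Cexp z).
Proof.
  intros eps Heps. assert (Hm := exp_pos (Re z)).
  assert (He := exp_pos 1).
  exists (Rmin 1 (eps / (exp (Re z) * exp 1))). split.
  { apply Rmin_pos; [lra|]. apply Rdiv_lt_0_compat; [lra|]. apply Rmult_lt_0_compat; lra. }
  intros w Hw.
  assert (H1 : Cmod (w - z) < 1) by (exact (Rlt_Rmin_l _ _ _ Hw)).
  assert (H2 : Cmod (w - z) < eps / (exp (Re z) * exp 1))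
    by (exact (Rlt_Rmin_r _ _ _ Hw)).
  replace (Cexp w) with (Cexp z * Cexp (w - z))%C
    by (rewrite <- Cexp_plus; f_equal; ring).
  replace (Cexp z * Cexp (w - z) - Cexp z - Cexp z * (w - z))%C
    with (Cexp z * (Cexp (w - z) - 1 - (w - z)))%C by ring.
  rewrite Cmod_mult, Cmod_Cexp.
  assert (H3 := Cexp_taylor2 (w - z)).
  set (d := Cmod (w - z)) in *. assert (Hd : 0 <= d) by apply Cmod_ge_0.
  assert (H4 : exp d <= exp 1) by (apply exp_mono; lra).
  assert (H5 : d * (exp (Re z) * exp 1) <= eps).
  { apply (Rmult_le_reg_r (/ (exp (Re z) * exp 1))).
    - apply Rinv_0_lt_compat; nra.
    - rewrite Rmult_assoc, Rinv_r by nra. unfold Rdiv in H2. lra. }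
  apply Rle_trans with (exp (Re z) * (d * d * exp 1)).
  - apply Rmult_le_compat_l; [lra|]. eapply Rle_trans; [exact H3|].
    apply Rmult_le_compat_l; nra.
  - nra.
Qed.

Lemma cdiff_Cexp_comp (f : C -> C) (z l : C) :
  cdiff f z l -> cdiff (fun w => Cexp (f w)) z (l * Cexp (f z)).
Proof. intros H. exact (cdiff_comp Cexp f z _ _ (cdiff_Cexp _) H). Qed.

Lemma cdiff_Cexp_linear (a z : C) : cdiff (fun w => Cexp (a * w)) z (a * Cexp (a * z)).
Proof.
  eapply cdiff_eq; [|apply (cdiff_Cexp_comp (fun w => a * w)%C);
    apply (cdiff_scal a); apply cdiff_id]. ring.
Qed.

Lemma Cexp_surj (w : C) : w <> 0 ->
  exists z, Cexp z = w /\ Re z = ln (Cmod w) /\ Rabs (Im z) <= PI.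
Proof.
  intros Hw. assert (Hm := proj1 (Cmod_gt_0 w) Hw). destruct w as [x y].
  set (m := Cmod (x, y)) in *.
  assert (Hxy : x * x + y * y = m * m).
  { assert (E2 := Cmod2_alt (x, y)). fold m in E2.
    rewrite <- !Rsqr_pow2 in E2. unfold Rsqr, Re, Im in E2; simpl in E2. lra. }
  assert (Hx : -1 <= x / m <= 1).
  { split.
    - apply (Rmult_le_reg_r m); [lra|]. unfold Rdiv. rewrite Rmult_assoc, Rinv_l by lra. nra.
    - apply (Rmult_le_reg_r m); [lra|]. unfold Rdiv. rewrite Rmult_assoc, Rinv_l by lra. nra. }
  assert (Hs : sin (acos (x / m)) = Rabs y / m).
  { rewrite sin_acos by exact Hx.
    replace (1 - (x / m)²) with ((Rabs y / m) * (Rabs y / m)).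
    - apply sqrt_square. apply Rmult_le_pos; [apply Rabs_pos|]. left; apply Rinv_0_lt_compat; lra.
    - unfold Rsqr. replace (Rabs y / m * (Rabs y / m)) with (Rabs (y * y) / (m * m))
        by (rewrite Rabs_mult; field; lra).
      rewrite Rabs_pos_eq by nra. replace (y * y) with (m * m - x * x) by lra. field. lra. }
  assert (Hc : cos (acos (x / m)) = x / m) by (apply cos_acos; exact Hx).
  assert (Hb := acos_bound (x / m)).
  destruct (Rle_dec 0 y) as [Hy|Hy].
  - exists (ln m, acos (x / m)). unfold Cexp, Re, Im; simpl.
    rewrite exp_ln, Hc, Hs by exact Hm. rewrite (Rabs_pos_eq y) by exact Hy.
    split; [f_equal; field; lra|]. split; [reflexivity|]. rewrite Rabs_pos_eq; lra.
  - exists (ln m, - acos (x / m)). unfold Cexp, Re, Im; simpl.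
    rewrite cos_neg, sin_neg, exp_ln, Hc, Hs by exact Hm.
    rewrite (Rabs_left y) by lra.
    split; [f_equal; field; lra|]. split; [reflexivity|].
    rewrite Rabs_Ropp, Rabs_pos_eq; lra.
Qed.

Lemma Cexp_period (z : C) (k : nat) : Cexp (z + (0, 2 * INR k * PI)) = Cexp z.
Proof.
  unfold Cexp; simpl. unfold Re, Im; simpl.
  rewrite Rplus_0_r, cos_period, sin_period. reflexivity.
Qed.

(** * Goursat's lemma *)

Lemma cdiff_horizontal (F : C -> C) (x y : R) (l : C) :
  cdiff F (x, y) l ->
  is_derive (fun s : R => Re (F (s, y))) x (Re l) /\
  is_derive (fun s : R => Im (F (s, y))) x (Im l).
Proof.
  intros H.
  assert (E : forall s : R, ((0, y) + s * 1)%C = (s, y))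
    by (intros; unfold Cplus, Cmult, RtoC; simpl; f_equal; ring).
  assert (K := pdiff_line F (0, y) 1 l x). rewrite E, Cmult_1_r in K.
  destruct (K H) as [K1 K2]. split.
  - eapply is_derive_ext; [|exact K1]. intros s. simpl. rewrite E. reflexivity.
  - eapply is_derive_ext; [|exact K2]. intros s. simpl. rewrite E. reflexivity.
Qed.

Lemma cdiff_vertical (F : C -> C) (x y : R) (l : C) :
  cdiff F (x, y) l ->
  is_derive (fun s : R => Re (F (x, s))) y (- Im l) /\
  is_derive (fun s : R => Im (F (x, s))) y (Re l).
Proof.
  intros H.
  assert (E : forall s : R, ((x, 0) + s * Ci)%C = (x, s))
    by (intros; unfold Cplus, Cmult, Ci, RtoC; simpl; f_equal; ring).
  assert (K := pdiff_line F (x, 0) Ci l y). rewrite E in K.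
  destruct (K H) as [K1 K2].
  replace (Re (l * Ci)) with (- Im l) in K1 by (unfold Re, Im; simpl; ring).
  replace (Im (l * Ci)) with (Re l) in K2 by (unfold Re, Im; simpl; ring).
  split.
  - eapply is_derive_ext; [|exact K1]. intros s. simpl. rewrite E. reflexivity.
  - eapply is_derive_ext; [|exact K2]. intros s. simpl. rewrite E. reflexivity.
Qed.

Lemma RInt_near_const (f : R -> R) (a b k M : R) :
  a <= b -> ex_RInt f a b -> (forall t, a <= t <= b -> Rabs (f t - k) <= M) ->
  Rabs (RInt f a b - k * (b - a)) <= M * (b - a).
Proof.
  intros Hab Hf HM.
  assert (E : RInt (fun t => f t - k) a b = RInt f a b - k * (b - a)).
  { transitivity (minus (RInt f a b) (RInt (fun _ => k) a b)).
    - apply (RInt_minus f (fun _ => k)); [exact Hf|apply ex_RInt_const].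
    - rewrite RInt_const. unfold minus, plus, opp, scal; simpl. unfold mult; simpl. ring. }
  rewrite <- E, (Rmult_comm M).
  apply abs_RInt_le_const; [exact Hab| |exact HM].
  apply (ex_RInt_minus f (fun _ => k)); [exact Hf|apply ex_RInt_const].
Qed.

Lemma nested_intervals (u d : nat -> R) :
  (forall n, 0 <= d n) -> (forall n, u n <= u (S n)) ->
  (forall n, u (S n) + d (S n) <= u n + d n) ->
  exists a, forall n, u n <= a <= u n + d n.
Proof.
  intros Hd Hu Hv.
  assert (H1 : forall n k, u n <= u (n + k)%nat).
  { intros n k. induction k as [|k IH]; [rewrite Nat.add_0_r; lra|].
    rewrite Nat.add_succ_r. specialize (Hu (n + k)%nat). lra. }
  assert (H2 : forall n k, u (n + k)%nat + d (n + k)%nat <= u n + d n).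
  { intros n k. induction k as [|k IH]; [rewrite Nat.add_0_r; lra|].
    rewrite Nat.add_succ_r. specialize (Hv (n + k)%nat). lra. }
  assert (H3 : forall m n, u m <= u n + d n).
  { intros m n. generalize (H1 m n) (H2 n m) (Hd (n + m)%nat).
    rewrite (Nat.add_comm n m). lra. }
  destruct (completeness (fun x => exists n, x = u n)) as [a [Ha1 Ha2]].
  - exists (u 0%nat + d 0%nat). intros x [n ->]. apply H3.
  - exists (u 0%nat), 0%nat. reflexivity.
  - exists a. intros n. split.
    + apply Ha1. exists n; reflexivity.
    + apply Ha2. intros x [m ->]. apply H3.
Qed.

Section Goursat.

Variables (F : C -> C) (X : R).
Hypothesis HF : forall x y : R, x < X -> exists l, cdiff F (x, y) l.

Let P (x y : R) := Re (F (x, y)).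
Let Q (x y : R) := Im (F (x, y)).

(* The imaginary part of the integral of F over the boundary of the rectangle. *)
Let J (x0 x1 y0 y1 : R) : R :=
  RInt (fun x => Q x y0 - Q x y1) x0 x1 + RInt (fun y => P x1 y - P x0 y) y0 y1.

Lemma ex_RInt_Q (x0 x1 y0 y1 : R) :
  x0 <= x1 -> x1 < X -> ex_RInt (fun x => Q x y0 - Q x y1) x0 x1.
Proof.
  intros H01 HX. apply (ex_RInt_continuous (V:=R_CompleteNormedModule)).
  rewrite Rmin_left, Rmax_right by lra. intros t Ht.
  destruct (HF t y0 ltac:(lra)) as [l Hl]. destruct (HF t y1 ltac:(lra)) as [m Hm].
  apply cdiff_horizontal in Hl. apply cdiff_horizontal in Hm.
  apply (ex_derive_continuous (fun x => Q x y0 - Q x y1)).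
  eexists. apply (is_derive_minus (fun x => Q x y0) (fun x => Q x y1)); [apply Hl|apply Hm].
Qed.

Lemma ex_RInt_P1 (x y0 y1 : R) : x < X -> ex_RInt (fun y => P x y) y0 y1.
Proof.
  intros HX. apply (ex_RInt_continuous (V:=R_CompleteNormedModule)). intros t Ht.
  destruct (HF x t ltac:(lra)) as [l Hl].
  apply cdiff_vertical in Hl.
  apply (ex_derive_continuous (fun y => P x y)). exists (- Im l). exact (proj1 Hl).
Qed.

Lemma ex_RInt_P (x0 x1 y0 y1 : R) :
  x0 < X -> x1 < X -> ex_RInt (fun y => P x1 y - P x0 y) y0 y1.
Proof.
  intros H0 H1. apply (ex_RInt_minus (fun y => P x1 y) (fun y => P x0 y));
    apply ex_RInt_P1; assumption.
Qed.

Lemma J_split_x (x0 m x1 y0 y1 : R) :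
  x0 <= m <= x1 -> x1 < X -> J x0 x1 y0 y1 = J x0 m y0 y1 + J m x1 y0 y1.
Proof.
  intros Hm HX. unfold J.
  rewrite <- (RInt_Chasles (fun x => Q x y0 - Q x y1) x0 m x1)
    by (apply ex_RInt_Q; lra).
  rewrite (RInt_ext (fun y => P x1 y - P x0 y)
             (fun y => plus (P m y - P x0 y) (P x1 y - P m y)))
    by (intros; unfold plus; simpl; ring).
  rewrite (RInt_plus (fun y => P m y - P x0 y) (fun y => P x1 y - P m y))
    by (apply ex_RInt_P; lra).
  unfold plus; simpl. ring.
Qed.

Lemma J_split_y (x0 x1 y0 m y1 : R) :
  x0 <= x1 -> x1 < X -> J x0 x1 y0 y1 = J x0 x1 y0 m + J x0 x1 m y1.
Proof.
  intros Hx HX. unfold J.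
  rewrite <- (RInt_Chasles (fun y => P x1 y - P x0 y) y0 m y1)
    by (apply ex_RInt_P; lra).
  rewrite (RInt_ext (fun x => Q x y0 - Q x y1)
             (fun x => plus (Q x y0 - Q x m) (Q x m - Q x y1)))
    by (intros; unfold plus; simpl; ring).
  rewrite (RInt_plus (fun x => Q x y0 - Q x m) (fun x => Q x m - Q x y1))
    by (apply ex_RInt_Q; lra).
  unfold plus; simpl. ring.
Qed.

(** A complex affine function has integral zero, so on a small rectangle only the
    remainder of the derivative is seen: a small multiple of the diameter,
    integrated over a boundary of length comparable to the diameter. *)
Lemma J_local (a b eps : R) : a < X -> 0 < eps ->
  exists del, 0 < del /\ forall x0 x1 y0 y1,
    x0 <= a <= x1 -> y0 <= b <= y1 -> x1 < X -> (x1 - x0) + (y1 - y0) < del ->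
    Rabs (J x0 x1 y0 y1) <= eps * ((x1 - x0) + (y1 - y0)) ^ 2.
Proof.
  intros Ha Heps. destruct (HF a b Ha) as [l Hl].
  destruct (Hl (eps / 2) ltac:(lra)) as [del [Hdel Hd]].
  exists del. split; [exact Hdel|].
  intros x0 x1 y0 y1 Hx Hy HX HD. set (D := (x1 - x0) + (y1 - y0)) in *.
  assert (Hpt : forall x y, x0 <= x <= x1 -> y0 <= y <= y1 ->
     Cmod (F (x, y) - F (a, b) - l * ((x, y) - (a, b))) <= eps / 2 * D).
  { intros x y Hxx Hyy.
    assert (E : Cmod ((x, y) - (a, b)) <= D).
    { replace ((x, y) - (a, b))%C with ((x - a)%R + (y - b)%R * Ci)%C
        by (unfold Cminus, Cplus, Copp, Cmult, Ci, RtoC; simpl; f_equal; ring).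
      eapply Rle_trans; [apply Cmod_triangle|].
      rewrite Cmod_mult, Cmod_Ci, !Cmod_R, Rmult_1_r.
      assert (Rabs (x - a) <= x1 - x0) by (apply Rabs_le; lra).
      assert (Rabs (y - b) <= y1 - y0) by (apply Rabs_le; lra). unfold D; lra. }
    eapply Rle_trans; [apply Hd|]; [lra|]. apply Rmult_le_compat_l; lra. }
  assert (HQ : Rabs (RInt (fun x => Q x y0 - Q x y1) x0 x1 - Re l * (y0 - y1) * (x1 - x0))
                <= eps * D * (x1 - x0)).
  { apply RInt_near_const; [lra|apply ex_RInt_Q; lra|]. intros t Ht.
    assert (K0 := Hpt t y0 Ht ltac:(lra)). assert (K1 := Hpt t y1 Ht ltac:(lra)).
    assert (E : Q t y0 - Q t y1 - Re l * (y0 - y1) =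
      Im ((F (t, y0) - F (a, b) - l * ((t, y0) - (a, b)))
          - (F (t, y1) - F (a, b) - l * ((t, y1) - (a, b))))).
    { unfold Q, Re, Im, Cminus, Cplus, Copp, Cmult; simpl. ring. }
    rewrite E. eapply Rle_trans; [apply Im_le_Cmod|].
    eapply Rle_trans; [apply Cmod_triangle_sub|]. lra. }
  assert (HP : Rabs (RInt (fun y => P x1 y - P x0 y) y0 y1 - Re l * (x1 - x0) * (y1 - y0))
                <= eps * D * (y1 - y0)).
  { apply RInt_near_const; [lra|apply ex_RInt_P; lra|]. intros t Ht.
    assert (K0 := Hpt x0 t ltac:(lra) Ht). assert (K1 := Hpt x1 t ltac:(lra) Ht).
    assert (E : P x1 t - P x0 t - Re l * (x1 - x0) =
      Re ((F (x1, t) - F (a, b) - l * ((x1, t) - (a, b)))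
          - (F (x0, t) - F (a, b) - l * ((x0, t) - (a, b))))).
    { unfold P, Re, Im, Cminus, Cplus, Copp, Cmult; simpl. ring. }
    rewrite E. eapply Rle_trans; [apply Re_le_Cmod|].
    eapply Rle_trans; [apply Cmod_triangle_sub|]. lra. }
  unfold J. replace (eps * D ^ 2) with (eps * D * (x1 - x0) + eps * D * (y1 - y0))
    by (unfold D; ring).
  match goal with |- Rabs (?A + ?B) <= _ =>
    replace (A + B) with ((A - Re l * (y0 - y1) * (x1 - x0)) + (B - Re l * (x1 - x0) * (y1 - y0)))
    by ring end.
  eapply Rle_trans; [apply Rabs_triang|]. lra.
Qed.

(** Among the four quarters of a rectangle one carries at least a quarter of the
    integral, while the squared size is divided by exactly four. The nested
    rectangles shrink to a point, where [J_local] shows that the integral is an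
    arbitrarily small multiple of the squared size. Continuity
    of the derivative is a later consequence of this lemma, so no integral theorem
    that presupposes it can replace the bisection. *)
Lemma goursat (x0 x1 y0 y1 : R) : x0 <= x1 -> y0 <= y1 -> x1 < X -> J x0 x1 y0 y1 = 0.
Proof.
  intros Hx Hy HX.
  set (w := fun n => (x1 - x0) / 2 ^ n). set (h := fun n => (y1 - y0) / 2 ^ n).
  assert (Hp : forall n, 0 < 2 ^ n) by (intros; apply pow_lt; lra).
  assert (Hw : forall n, w n = 2 * w (S n))
    by (intros n; unfold w; simpl; field; specialize (Hp n); lra).
  assert (Hh : forall n, h n = 2 * h (S n))
    by (intros n; unfold h; simpl; field; specialize (Hp n); lra).
  assert (Hw0 : forall n, 0 <= w n)
    by (intros n; apply Rmult_le_pos; [lra|left; apply Rinv_0_lt_compat, Hp]).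
  assert (Hh0 : forall n, 0 <= h n)
    by (intros n; apply Rmult_le_pos; [lra|left; apply Rinv_0_lt_compat, Hp]).
  set (K := fun n (p : R * R) => J (fst p) (fst p + w n) (snd p) (snd p + h n)).
  assert (step : forall n (p : R * R), {q : R * R | fst p + w n < X ->
     ((fst q = fst p \/ fst q = fst p + w (S n)) /\
      (snd q = snd p \/ snd q = snd p + h (S n)) /\
      Rabs (K n p) <= 4 * Rabs (K (S n) q))}).
  { intros n p. apply constructive_indefinite_description.
    destruct (Rlt_dec (fst p + w n) X) as [Hlt|Hlt]; [|exists p; intro; lra].
    assert (Hwn := Hw n). assert (Hhn := Hh n).
    assert (Hwn0 := Hw0 (S n)). assert (Hhn0 := Hh0 (S n)).
    assert (E : K n p = K (S n) p + K (S n) (fst p + w (S n), snd p)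
      + K (S n) (fst p, snd p + h (S n)) + K (S n) (fst p + w (S n), snd p + h (S n))).
    { unfold K; simpl fst; simpl snd. rewrite Hwn, Hhn.
      rewrite (J_split_x _ (fst p + w (S n))) by lra.
      rewrite (J_split_y (fst p) (fst p + w (S n)) _ (snd p + h (S n))) by lra.
      rewrite (J_split_y (fst p + w (S n)) (fst p + 2 * w (S n)) _ (snd p + h (S n))) by lra.
      replace (fst p + w (S n) + w (S n)) with (fst p + 2 * w (S n)) by ring.
      replace (snd p + h (S n) + h (S n)) with (snd p + 2 * h (S n)) by ring. ring. }
    set (A := K (S n) p) in *. set (B := K (S n) (fst p + w (S n), snd p)) in *.
    set (A' := K (S n) (fst p, snd p + h (S n))) in *.
    set (B' := K (S n) (fst p + w (S n), snd p + h (S n))) in *.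
    assert (T : Rabs (K n p) <= Rabs A + Rabs B + Rabs A' + Rabs B').
    { rewrite E. repeat (eapply Rle_trans; [apply Rabs_triang|]; apply Rplus_le_compat_r).
      apply Rle_refl. }
    destruct (Rle_dec (Rabs (K n p)) (4 * Rabs A)) as [H|H1].
    { exists p. intros _. auto. }
    destruct (Rle_dec (Rabs (K n p)) (4 * Rabs B)) as [H|H2].
    { eexists. intros _. split; [|split; [|exact H]]; simpl; auto. }
    destruct (Rle_dec (Rabs (K n p)) (4 * Rabs A')) as [H|H3].
    { eexists. intros _. split; [|split; [|exact H]]; simpl; auto. }
    eexists. intros _. split; [|split; [|assert (H : Rabs (K n p) <= 4 * Rabs B') by lra; exact H]];
      simpl; auto. }
  (* Lower left corners; the n-th rectangle has sides w n and h n. *)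
  set (p := fix p n := match n with O => (x0, y0) | S n => proj1_sig (step n (p n)) end).
  assert (Hstep : forall n, fst (p n) + w n < X ->
     ((fst (p (S n)) = fst (p n) \/ fst (p (S n)) = fst (p n) + w (S n)) /\
      (snd (p (S n)) = snd (p n) \/ snd (p (S n)) = snd (p n) + h (S n)) /\
      Rabs (K n (p n)) <= 4 * Rabs (K (S n) (p (S n)))))
    by (intros n; exact (proj2_sig (step n (p n)))).
  assert (HX' : forall n, fst (p n) + w n < X).
  { induction n as [|n IH].
    - unfold w; simpl. replace (x0 + (x1 - x0) / 1) with x1 by field. exact HX.
    - destruct (Hstep n IH) as [[E|E] _]; rewrite E; specialize (Hw n); specialize (Hw0 (S n)); lra. }
  destruct (nested_intervals (fun n => fst (p n)) w Hw0) as [a Ha].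
  { intros n. destruct (Hstep n (HX' n)) as [[E|E] _]; rewrite E; specialize (Hw0 (S n)); lra. }
  { intros n. destruct (Hstep n (HX' n)) as [[E|E] _]; rewrite E;
      specialize (Hw0 (S n)); specialize (Hw n); lra. }
  destruct (nested_intervals (fun n => snd (p n)) h Hh0) as [b Hb].
  { intros n. destruct (Hstep n (HX' n)) as [_ [[E|E] _]]; rewrite E; specialize (Hh0 (S n)); lra. }
  { intros n. destruct (Hstep n (HX' n)) as [_ [[E|E] _]]; rewrite E;
      specialize (Hh0 (S n)); specialize (Hh n); lra. }
  assert (Hgrow : forall n, Rabs (J x0 x1 y0 y1) <= 4 ^ n * Rabs (K n (p n))).
  { induction n as [|n IH].
    - unfold K, w, h; simpl. rewrite !Rdiv_1_r, Rmult_1_l.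
      replace (x0 + (x1 - x0)) with x1 by ring. replace (y0 + (y1 - y0)) with y1 by ring. lra.
    - eapply Rle_trans; [exact IH|]. simpl pow.
      destruct (Hstep n (HX' n)) as [_ [_ E]].
      replace (4 * 4 ^ n * Rabs (K (S n) (p (S n)))) with
        (4 ^ n * (4 * Rabs (K (S n) (p (S n))))) by ring.
      apply Rmult_le_compat_l; [left; apply pow_lt; lra|exact E]. }
  set (T := (x1 - x0) + (y1 - y0)).
  assert (HT : 0 <= T) by (unfold T; lra).
  assert (Hall : forall eps, 0 < eps -> Rabs (J x0 x1 y0 y1) <= eps * T ^ 2).
  { intros eps Heps.
    assert (HaX : a < X) by (specialize (Ha 0%nat); specialize (HX' 0%nat); simpl in *; lra).
    destruct (J_local a b eps HaX Heps) as [del [Hdel Hloc]].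
    assert (Hn : exists n, T / 2 ^ n < del).
    { destruct (pow_lt_1_zero (/ 2) ltac:(rewrite Rabs_pos_eq; lra) (del / (T + 1)))
        as [n Hn]; [apply Rdiv_lt_0_compat; lra|].
      exists n. specialize (Hn n (Nat.le_refl n)). rewrite Rabs_pos_eq in Hn
        by (apply pow_le; lra).
      unfold Rdiv. rewrite <- pow_inv.
      assert (0 < (/ 2) ^ n) by (apply pow_lt; lra).
      apply Rlt_div_r in Hn; [|lra]. nra. }
    destruct Hn as [n Hn].
    eapply Rle_trans; [apply (Hgrow n)|].
    assert (E : w n + h n = T / 2 ^ n) by (unfold w, h, T, Rdiv; ring).
    assert (L := Hloc (fst (p n)) (fst (p n) + w n) (snd (p n)) (snd (p n) + h n)
                   (Ha n) (Hb n) (HX' n)).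
    replace (fst (p n) + w n - fst (p n) + (snd (p n) + h n - snd (p n)))
      with (T / 2 ^ n) in L by (rewrite <- E; ring).
    specialize (L Hn).
    assert (E4 : 4 ^ n = 2 ^ n * 2 ^ n) by (rewrite <- Rpow_mult_distr; f_equal; ring).
    fold (K n (p n)) in L. rewrite E4. specialize (Hp n).
    apply Rle_trans with (2 ^ n * 2 ^ n * (eps * (T / 2 ^ n) ^ 2)).
    - apply Rmult_le_compat_l; [nra|exact L].
    - right. field. lra. }
  assert (Hz : Rabs (J x0 x1 y0 y1) <= 0).
  { apply Rnot_lt_le. intros Hpos. set (j := Rabs (J x0 x1 y0 y1)) in *.
    assert (H := Hall (j / (2 * (T ^ 2 + 1))) ltac:(apply Rdiv_lt_0_compat; nra)).
    assert (E : j / (2 * (T ^ 2 + 1)) * T ^ 2 < j); [|lra].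
    apply (Rmult_lt_reg_r (2 * (T ^ 2 + 1))); [nra|].
    replace (j / (2 * (T ^ 2 + 1)) * T ^ 2 * (2 * (T ^ 2 + 1))) with (j * T ^ 2)
      by (field; nra). nra. }
  generalize (Rabs_pos (J x0 x1 y0 y1)). intros H0.
  destruct (Req_dec (J x0 x1 y0 y1) 0) as [E|E]; [exact E|].
  apply Rabs_pos_lt in E. lra.
Qed.

(** The two horizontal sides of the rectangle cancel by periodicity. *)
Lemma vertical_mean_constant (x0 x1 T : R) : 0 <= T ->
  (forall x y : R, F (x, y + T) = F (x, y)) -> x0 <= x1 -> x1 < X ->
  RInt (fun y => Re (F (x0, y))) 0 T = RInt (fun y => Re (F (x1, y))) 0 T.
Proof.
  intros HT Hper Hx HX.
  assert (G := goursat x0 x1 0 T Hx HT HX). unfold J in G.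
  rewrite (RInt_ext (fun x => Q x 0 - Q x T) (fun _ => 0)) in G.
  2:{ intros x _. unfold Q. rewrite <- (Hper x 0), Rplus_0_l. apply Rplus_opp_r. }
  rewrite RInt_const in G.
  assert (E : RInt (fun y => P x1 y - P x0 y) 0 T
     = RInt (fun y => P x1 y) 0 T - RInt (fun y => P x0 y) 0 T).
  { apply (RInt_minus (fun y => P x1 y) (fun y => P x0 y)); apply ex_RInt_P1; lra. }
  rewrite E in G. unfold scal in G; simpl in G. unfold mult in G; simpl in G.
  unfold P in G. lra.
Qed.

End Goursat.

(** * Positivity at the centre and Cauchy's estimate *)

(** In the coordinate s with z = z0 + exp s, circles about z0 are vertical segments
    and the function is periodic, so the circle means of Re H do not depend on
    the radius; for small radii they are close to Re l. Asking only for a limit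
    at z0 admits difference quotients and other functions with a removable
    singularity. *)
Lemma centre_nonneg (H : C -> C) (z0 l : C) (R0 r : R) :
  0 < r < R0 ->
  (forall z, z <> z0 -> Cmod (z - z0) < R0 -> exists m, cdiff H z m) ->
  (forall eps, 0 < eps -> exists del, 0 < del /\
     forall z, z <> z0 -> Cmod (z - z0) < del -> Cmod (H z - l) < eps) ->
  (forall z, Cmod (z - z0) = r -> 0 <= Re (H z)) ->
  0 <= Re l.
Proof.
  intros Hr Hd Hl Hpos. apply Rnot_lt_le. intros Hneg.
  set (F := fun s => H (z0 + Cexp s)%C).
  assert (Hmod : forall s, Cmod (z0 + Cexp s - z0) = exp (Re s)).
  { intros s. replace (z0 + Cexp s - z0)%C with (Cexp s) by ring. apply Cmod_Cexp. }
  assert (Hne : forall s, (z0 + Cexp s)%C <> z0).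
  { intros s E. apply (Cexp_neq_0 s). replace (Cexp s) with (z0 + Cexp s - z0)%C by ring.
    rewrite E. ring. }
  assert (HF : forall x y : R, x < ln R0 -> exists m, cdiff F (x, y) m).
  { intros x y Hx. destruct (Hd (z0 + Cexp (x, y))%C) as [m Hm].
    - apply Hne.
    - rewrite Hmod. rewrite <- (exp_ln R0) by lra. apply exp_increasing. exact Hx.
    - eexists. unfold F. apply (cdiff_comp H (fun s => z0 + Cexp s)%C); [exact Hm|].
      apply cdiff_plus; [apply cdiff_const|apply cdiff_Cexp]. }
  assert (Hper : forall x y : R, F (x, y + 2 * PI) = F (x, y)).
  { intros x y. unfold F.
    replace (Cexp (x, y + 2 * PI)) with (Cexp (x, y)); [reflexivity|].
    rewrite <- (Cexp_period (x, y) 1). f_equal.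
    unfold Cplus; simpl. apply injective_projections; simpl; ring. }
  destruct (Hl (- Re l / 2) ltac:(lra)) as [del [Hdel Hc]].
  set (x0 := Rmin (ln r) (ln (del / 2))).
  assert (HPI := PI_RGT_0).
  assert (E := vertical_mean_constant F (ln R0) HF x0 (ln r) (2 * PI) ltac:(lra) Hper
     (Rmin_l _ _) (ln_increasing _ _ (proj1 Hr) (proj2 Hr))).
  assert (H1 : 0 <= RInt (fun y => Re (F (ln r, y))) 0 (2 * PI)).
  { apply RInt_ge_0; [lra| |].
    - apply (ex_RInt_P1 F (ln R0) HF). apply ln_increasing; lra.
    - intros y _. apply Hpos. rewrite Hmod. simpl. apply exp_ln; lra. }
  assert (H2 : RInt (fun y => Re (F (x0, y))) 0 (2 * PI) <= RInt (fun _ => Re l / 2) 0 (2 * PI)).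
  { apply RInt_le; [lra| | |].
    - apply (ex_RInt_P1 F (ln R0) HF). eapply Rle_lt_trans; [apply Rmin_l|].
      apply ln_increasing; lra.
    - apply ex_RInt_const.
    - intros y _. unfold F.
      assert (K : Cmod (H (z0 + Cexp (x0, y))%C - l) < - Re l / 2).
      { apply Hc; [apply Hne|]. rewrite Hmod. simpl.
        apply Rle_lt_trans with (exp (ln (del / 2))).
        - apply exp_mono. apply Rmin_r.
        - rewrite exp_ln; lra. }
      assert (K2 := Re_le_Cmod_pos (H (z0 + Cexp (x0, y))%C - l)%C).
      rewrite re_minus in K2. lra. }
  rewrite RInt_const in H2. unfold scal in H2; simpl in H2. unfold mult in H2; simpl in H2.
  nra.
Qed.

Definition holo (f : C -> C) (z0 : C) (r : R) : Prop :=
  forall z, Cmod (z - z0) < r -> cdiff f z (C_derive f z).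

Lemma cdiff_C_derive (f : C -> C) (z l : C) : cdiff f z l -> C_derive f z = l.
Proof. intros H. apply is_C_derive_unique. apply is_derive_cdiff. exact H. Qed.

Lemma cdiff_derive (f : C -> C) (z l : C) : cdiff f z l -> cdiff f z (C_derive f z).
Proof. intros H. rewrite (cdiff_C_derive f z l H). exact H. Qed.

Lemma entire_cdiff (f : C -> C) :
  entire f <-> forall z, cdiff f z (C_derive f z).
Proof.
  split; intros H z.
  - apply is_derive_cdiff. apply C_derive_correct; [exact z|]. apply H.
  - eexists. apply is_derive_cdiff. apply H.
Qed.

Lemma entire_holo (f : C -> C) (z0 : C) (r : R) : entire f -> holo f z0 r.
Proof. intros H z _. apply entire_cdiff. exact H. Qed.

Lemma holo_sub (f : C -> C) (z0 z1 : C) (r s : R) :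
  holo f z0 r -> Cmod (z1 - z0) + s <= r -> holo f z1 s.
Proof.
  intros H Hs z Hz. apply H. eapply Rle_lt_trans; [apply (Cmod_sub_trans z z1 z0)|]. lra.
Qed.

Lemma exists_phase (l : C) : exists u, Cmod u = 1 /\ (u * l)%C = Cmod l.
Proof.
  destruct (Ceq_dec l 0) as [->|Hl].
  - exists 1%C. rewrite Cmod_1, Cmod_0. split; [reflexivity|ring].
  - assert (Hm := proj1 (Cmod_gt_0 l) Hl).
    assert (Hm0 : RtoC (Cmod l) <> 0) by (apply RtoC_neq_0; lra).
    exists (Cconj l / Cmod l)%C. split.
    + rewrite Cmod_div, Cmod_conj, Cmod_R, Rabs_pos_eq by (exact Hm0 || lra). field. lra.
    + replace (Cconj l / Cmod l * l)%C with (l * Cconj l / Cmod l)%C by (field; exact Hm0).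
      rewrite <- Cmod2_conj. rewrite RtoC_pow. field. exact Hm0.
Qed.

(** [centre_nonneg] for M - u H, where u turns l into the positive axis. *)
Lemma centre_bound (H : C -> C) (z0 l : C) (R0 r M : R) :
  0 < r < R0 ->
  (forall z, z <> z0 -> Cmod (z - z0) < R0 -> exists m, cdiff H z m) ->
  (forall eps, 0 < eps -> exists del, 0 < del /\
     forall z, z <> z0 -> Cmod (z - z0) < del -> Cmod (H z - l) < eps) ->
  (forall z, Cmod (z - z0) = r -> Cmod (H z) <= M) ->
  Cmod l <= M.
Proof.
  intros Hr Hd Hl HM. destruct (exists_phase l) as [u [Hu Hul]].
  assert (K : 0 <= Re (M - u * l)%C).
  { apply (centre_nonneg (fun z => M - u * H z)%C z0 (M - u * l)%C R0 r Hr).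
    - intros z Hz Hz2. destruct (Hd z Hz Hz2) as [m Hm]. eexists.
      apply cdiff_minus; [apply cdiff_const|]. apply cdiff_scal. exact Hm.
    - intros eps Heps. destruct (Hl eps Heps) as [del [Hdel Hc]].
      exists del. split; [exact Hdel|]. intros z Hz Hz2.
      replace (M - u * H z - (M - u * l))%C with (- (u * (H z - l)))%C by ring.
      rewrite Cmod_opp, Cmod_mult, Hu, Rmult_1_l. apply Hc; assumption.
    - intros z Hz. rewrite re_minus, re_RtoC.
      assert (K1 := Re_le_Cmod_pos (u * H z)%C). rewrite Cmod_mult, Hu in K1.
      specialize (HM z Hz). lra. }
  rewrite Hul, re_minus, !re_RtoC in K. lra.
Qed.

Lemma Rmult_le_of_lt (a b R0 : R) :
  0 < R0 -> 0 <= a -> (forall r, 0 < r < R0 -> a * r <= b) -> a * R0 <= b.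
Proof.
  intros HR Ha H. apply Rnot_lt_le. intros Hlt.
  assert (Ha' : 0 < a).
  { destruct Ha as [Ha|Ha]; [exact Ha|]. exfalso.
    specialize (H (R0 / 2) ltac:(lra)). rewrite <- Ha in *. lra. }
  set (r := Rmax (R0 / 2) ((R0 + b / a) / 2)).
  assert (Hb : a * (b / a) = b) by (field; lra).
  assert (b / a < R0) by nra.
  assert (Hr : 0 < r < R0).
  { split; [eapply Rlt_le_trans; [|apply Rmax_l]; lra|]. apply Rmax_lub_lt; lra. }
  specialize (H r Hr). assert ((R0 + b / a) / 2 <= r) by apply Rmax_r. nra.
Qed.

Lemma difference_quotient_limit (f : C -> C) (z0 l : C) :
  cdiff f z0 l -> forall eps, 0 < eps -> exists del, 0 < del /\
     forall z, z <> z0 -> Cmod (z - z0) < del ->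
       Cmod ((f z - f z0) / (z - z0) - l) < eps.
Proof.
  intros H eps Heps. destruct (H (eps / 2) ltac:(lra)) as [del [Hdel Hd]].
  exists del. split; [exact Hdel|]. intros z Hz Hz2.
  assert (Hn : (z - z0)%C <> 0) by (apply Cminus_eq_contra; exact Hz).
  assert (Hp := proj1 (Cmod_gt_0 _) Hn).
  replace ((f z - f z0) / (z - z0) - l)%C with ((f z - f z0 - l * (z - z0)) / (z - z0))%C
    by (field; exact Hn).
  rewrite Cmod_div by exact Hn. specialize (Hd z Hz2).
  apply (Rmult_lt_reg_r (Cmod (z - z0))); [exact Hp|].
  unfold Rdiv. rewrite Rmult_assoc, Rinv_l by lra. nra.
Qed.

(** The derivative is the limit at the centre of the difference quotient; the
    factor 2 comes from bounding f z - f z0 by the triangle inequality. *)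
Lemma cauchy_estimate (f : C -> C) (z0 : C) (R0 M : R) :
  0 < R0 -> holo f z0 R0 -> (forall z, Cmod (z - z0) < R0 -> Cmod (f z) <= M) ->
  Cmod (C_derive f z0) * R0 <= 2 * M.
Proof.
  intros HR Hf HM. apply Rmult_le_of_lt; [exact HR|apply Cmod_ge_0|]. intros r Hr.
  assert (Hc : Cmod (z0 - z0) < R0) by (rewrite Cmod_zero_sub; exact HR).
  assert (K : Cmod (C_derive f z0) <= 2 * M / r).
  { apply (centre_bound (fun z => (f z - f z0) / (z - z0))%C z0 _ R0 r _ Hr).
    - intros z Hz Hz2. eexists. apply cdiff_div.
      + apply Cminus_eq_contra. exact Hz.
      + apply cdiff_minus; [apply Hf; exact Hz2|apply cdiff_const].
      + apply cdiff_minus; [apply cdiff_id|apply cdiff_const].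
    - apply difference_quotient_limit. apply Hf. exact Hc.
    - intros z Hz.
      assert (Hn : (z - z0)%C <> 0) by (apply Cmod_gt_0; lra).
      rewrite Cmod_div, Hz by exact Hn. apply Rmult_le_compat_r.
      + left; apply Rinv_0_lt_compat; lra.
      + eapply Rle_trans; [apply Cmod_triangle_sub|].
        assert (Cmod (f z) <= M) by (apply HM; lra).
        assert (Cmod (f z0) <= M) by (apply HM; exact Hc). lra. }
  apply (Rmult_le_compat_r r) in K; [|lra].
  unfold Rdiv in K. rewrite Rmult_assoc, Rinv_l in K by lra. lra.
Qed.

Lemma centre_le_circle (f : C -> C) (z0 : C) (R0 r M : R) :
  0 < r < R0 -> holo f z0 R0 -> (forall z, Cmod (z - z0) = r -> Cmod (f z) <= M) ->
  Cmod (f z0) <= M.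
Proof.
  intros Hr Hf HM. apply (centre_bound f z0 _ R0 r M Hr); [| |exact HM].
  - intros z _ Hz. eexists. apply Hf. exact Hz.
  - intros eps Heps.
    assert (Hc : Cmod (z0 - z0) < R0) by (rewrite Cmod_zero_sub; lra).
    destruct (cdiff_ccont f z0 _ (Hf z0 Hc) eps Heps) as [d [Hd Hd2]].
    exists d. split; [exact Hd|]. intros z _ Hz. apply Hd2. exact Hz.
Qed.

(** * Sequences of complex numbers *)

Definition extraction (phi : nat -> nat) : Prop := forall n, (phi n < phi (S n))%nat.

Lemma extraction_le (phi : nat -> nat) : extraction phi -> forall n, (n <= phi n)%nat.
Proof. intros H n. induction n as [|n IH]; [lia|]. specialize (H n). lia. Qed.

Lemma extraction_mono (phi : nat -> nat) :
  extraction phi -> forall n m, (n <= m)%nat -> (phi n <= phi m)%nat.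
Proof. intros H n m Hm. induction Hm; [lia|]. specialize (H m). lia. Qed.

Lemma extraction_comp (phi psi : nat -> nat) :
  extraction phi -> extraction psi -> extraction (fun n => phi (psi n)).
Proof.
  intros H1 H2 n. specialize (H2 n).
  apply Nat.lt_le_trans with (phi (S (psi n))); [apply H1|].
  apply extraction_mono; assumption.
Qed.

Definition cconv (u : nat -> C) (l : C) : Prop :=
  forall eps, 0 < eps -> exists N, forall n, (N <= n)%nat -> Cmod (u n - l) < eps.

Lemma cconv_extraction (u : nat -> C) (l : C) (phi : nat -> nat) :
  extraction phi -> cconv u l -> cconv (fun n => u (phi n)) l.
Proof.
  intros Hp H eps Heps. destruct (H eps Heps) as [N HN]. exists N. intros n Hn.
  apply HN. generalize (extraction_le phi Hp n). lia.
Qed.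

Lemma extract_close (d : nat -> R) :
  (forall eps N, 0 < eps -> exists n, (N <= n)%nat /\ d n < eps) ->
  exists phi, extraction phi /\
    forall eps, 0 < eps -> exists N, forall n, (N <= n)%nat -> d (phi n) < eps.
Proof.
  intros H.
  assert (H' : forall (k N : nat), {n : nat | (N <= n)%nat /\ d n < / INR (S k)}).
  { intros k N. apply constructive_indefinite_description. apply H.
    apply Rinv_0_lt_compat. apply lt_0_INR. lia. }
  set (phi := fix phi k := match k with
     | O => proj1_sig (H' O O) | S j => proj1_sig (H' (S j) (S (phi j))) end).
  exists phi. split.
  - intros k. simpl. destruct (H' (S k) (S (phi k))) as [n [Hn Hn2]]. simpl. lia.
  - intros eps Heps. destruct (archimed_cor1 eps Heps) as [N [HN HN0]].
    exists N. intros n Hn.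
    assert (Hd : d (phi n) < / INR (S n)).
    { destruct n as [|n]; simpl phi.
      - destruct (H' O O) as [m [Hm0 Hm]]; exact Hm.
      - destruct (H' (S n) (S (phi n))) as [m [Hm0 Hm]]; exact Hm. }
    eapply Rlt_trans; [exact Hd|]. eapply Rle_lt_trans; [|exact HN].
    apply Rinv_le_contravar; [apply lt_0_INR; lia|]. apply le_INR. lia.
Qed.

Lemma bolzano_weierstrass_R (u : nat -> R) (M : R) :
  (forall n, Rabs (u n) <= M) ->
  exists l phi, extraction phi /\
    forall eps, 0 < eps -> exists N, forall n, (N <= n)%nat -> Rabs (u (phi n) - l) < eps.
Proof.
  intros HM.
  destruct (Bolzano_Weierstrass u (fun c => - M <= c <= M) (compact_P3 (- M) M)) as [l Hl].
  { intros n. specialize (HM n). apply Rabs_le_between in HM. exact HM. }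
  exists l. apply (extract_close (fun n => Rabs (u n - l))).
  intros eps N Heps.
  destruct (Hl (disc l (mkposreal eps Heps)) N) as [p [Hp1 Hp2]].
  - exists (mkposreal eps Heps). intros x Hx; exact Hx.
  - exists p. split; [exact Hp1|exact Hp2].
Qed.

Lemma bolzano_weierstrass_C (u : nat -> C) (M : R) :
  (forall n, Cmod (u n) <= M) ->
  exists l phi, extraction phi /\ cconv (fun n => u (phi n)) l.
Proof.
  intros HM.
  destruct (bolzano_weierstrass_R (fun n => Re (u n)) M) as [a [phi [Hphi Ha]]].
  { intros n. eapply Rle_trans; [apply Re_le_Cmod|apply HM]. }
  destruct (bolzano_weierstrass_R (fun n => Im (u (phi n))) M) as [b [psi [Hpsi Hb]]].
  { intros n. eapply Rle_trans; [apply Im_le_Cmod|apply HM]. }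
  exists (a, b), (fun n => phi (psi n)). split; [apply extraction_comp; assumption|].
  intros eps Heps.
  destruct (Ha (eps / 2) ltac:(lra)) as [N1 H1].
  destruct (Hb (eps / 2) ltac:(lra)) as [N2 H2].
  exists (N1 + N2)%nat. intros n Hn.
  assert (K1 := H1 (psi n) ltac:(generalize (extraction_le psi Hpsi n); lia)).
  assert (K2 := H2 n ltac:(lia)).
  set (z := u (phi (psi n))) in *.
  replace (z - (a, b))%C with ((Re z - a)%R + (Im z - b)%R * Ci)%C.
  - eapply Rle_lt_trans; [apply Cmod_triangle|].
    rewrite Cmod_mult, Cmod_Ci, !Cmod_R. lra.
  - destruct z as [x y]. apply injective_projections; simpl; ring.
Qed.

Lemma locally_bounded_on_disc (e : C -> R) :
  (forall z, exists r K, 0 < r /\ forall w, Cmod (w - z) < r -> e w <= K) ->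
  forall R0, exists K, forall z, Cmod z <= R0 -> e z <= K.
Proof.
  intros H R0. apply NNPP. intros Hn.
  assert (Hz : forall n : nat, {z : C | Cmod z <= R0 /\ INR n < e z}).
  { intros n. apply constructive_indefinite_description. apply NNPP. intros Hz.
    apply Hn. exists (INR n). intros z Hz1. apply Rnot_lt_le. intros Hz2.
    apply Hz. exists z. split; assumption. }
  destruct (bolzano_weierstrass_C (fun n => proj1_sig (Hz n)) R0) as [l [phi [Hphi Hl]]].
  { intros n. exact (proj1 (proj2_sig (Hz n))). }
  destruct (H l) as [r [K [Hr HK]]].
  destruct (Hl r Hr) as [N HN].
  destruct (INR_unbounded K) as [m Hm].
  assert (K1 := HK _ (HN (N + m)%nat ltac:(lia))).
  assert (K2 := proj2 (proj2_sig (Hz (phi (N + m)%nat)))).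
  assert (K3 : INR m <= INR (phi (N + m)%nat)).
  { apply le_INR. generalize (extraction_le phi Hphi (N + m)). lia. }
  cbv beta in K1, K2. lra.
Qed.

Lemma ccont_locally_bounded (f : C -> C) (z : C) : ccont f z ->
  exists r K, 0 < r /\ forall w, Cmod (w - z) < r -> Cmod (f w) <= K.
Proof.
  intros H. destruct (H 1 Rlt_0_1) as [d [Hd Hd2]].
  exists d, (Cmod (f z) + 1). split; [exact Hd|]. intros w Hw.
  specialize (Hd2 w Hw). generalize (Cmod_sub_lower (f w) (f z)). lra.
Qed.

(** * Holomorphy of the derivative *)

(** Cauchy's estimate for f (x + h) - f x shows that f' is Lipschitz near z, so the
    quotients (f (x + h) - f x) / h approach f' x at rate |h|, uniformly in x.
    Cauchy's estimate for the difference of two such quotients then bounds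
    q h - q k by a multiple of |h| + |k|, where q h is the difference quotient of
    f' at z; hence q has a limit. *)
Lemma holo_derive (f : C -> C) (z0 : C) (R0 : R) :
  holo f z0 R0 -> holo (C_derive f) z0 R0.
Proof.
  intros Hf z Hz.
  destruct (ccont_locally_bounded f z (cdiff_ccont f z _ (Hf z Hz))) as [d [M [Hd HM]]].
  set (s := R0 - Cmod (z - z0)).
  set (r := Rmin d s / 4).
  assert (Hs : 0 < Rmin d s) by (apply Rmin_pos; unfold s; lra).
  assert (Hr : 0 < r) by (unfold r; lra).
  assert (H4 : holo f z (4 * r)).
  { apply (holo_sub f z0 z R0); [exact Hf|]. unfold r. generalize (Rmin_r d s). unfold s. lra. }
  assert (HM4 : forall w, Cmod (w - z) < 4 * r -> Cmod (f w) <= M).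
  { intros w Hw. apply HM. generalize (Rmin_l d s). unfold r in Hw. lra. }
  assert (HM0 : 0 <= M).
  { eapply Rle_trans; [apply Cmod_ge_0|apply (HM4 z)]. rewrite Cmod_zero_sub; lra. }
  assert (HD : forall w, Cmod (w - z) < 2 * r -> Cmod (C_derive f w) <= M / r).
  { intros w Hw.
    assert (K : Cmod (C_derive f w) * (2 * r) <= 2 * M).
    { apply cauchy_estimate; [lra| |].
      - apply (holo_sub f z w (4 * r)); [exact H4|lra].
      - intros x Hx. apply HM4. eapply Rle_lt_trans; [apply (Cmod_sub_trans x w z)|]. lra. }
    apply (Rmult_le_reg_r r); [exact Hr|]. unfold Rdiv.
    rewrite Rmult_assoc, Rinv_l by lra. lra. }
  set (L := 4 * M / (r * r)).
  assert (HL0 : 0 <= L).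
  { unfold L. apply Rmult_le_pos; [lra|]. left. apply Rinv_0_lt_compat. nra. }
  assert (HLip : forall w h, Cmod (w - z) < r -> Cmod h < r / 2 ->
            Cmod (C_derive f (w + h)%C - C_derive f w) <= L * Cmod h).
  { intros w h Hw Hh.
    assert (Hin : forall x, Cmod (x - w) < r / 2 ->
       Cmod (x - z) < 2 * r /\ Cmod (x + h - z) < 2 * r).
    { intros x Hx. assert (K := Cmod_sub_trans x w z). split; [lra|].
      replace (x + h - z)%C with ((x - z) + h)%C by ring.
      eapply Rle_lt_trans; [apply Cmod_triangle|]. lra. }
    assert (Hdif : forall x, Cmod (x - w) < r / 2 ->
       cdiff (fun x => f (x + h) - f x)%C x (C_derive f (x + h)%C - C_derive f x)).
    { intros x Hx. destruct (Hin x Hx) as [K1 K2]. apply cdiff_minus; [|apply H4; lra].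
      eapply cdiff_eq; [|apply (cdiff_comp f (fun x => x + h)%C);
        [apply H4; lra|apply cdiff_plus; [apply cdiff_id|apply cdiff_const]]].
      ring. }
    assert (K : Cmod (C_derive (fun x => f (x + h) - f x)%C w) * (r / 2)
                <= 2 * (M / r * Cmod h)).
    { apply cauchy_estimate; [lra| |].
      - intros x Hx. eapply cdiff_derive. apply Hdif. exact Hx.
      - intros x Hx. destruct (Hin x Hx) as [K1 K2].
        replace (Cmod h) with (Cmod (x + h - x)) by (f_equal; ring).
        apply (mean_value_disc f (C_derive f) z (2 * r)); try assumption.
        intros y Hy. apply H4. lra. }
    rewrite (cdiff_C_derive _ w _ (Hdif w ltac:(rewrite Cmod_zero_sub; lra))) in K.
    apply (Rmult_le_reg_r (r / 2)); [lra|]. eapply Rle_trans; [exact K|].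
    right. unfold L. field. lra. }
  assert (HT : forall w h, Cmod (w - z) < r -> Cmod h < r / 2 ->
     Cmod (f (w + h)%C - f w - C_derive f w * h) <= L * Cmod h * Cmod h).
  { intros w h Hw Hh.
    assert (K := mean_value_ineq (fun x => f x - C_derive f w * x)%C
       (fun x => C_derive f x - C_derive f w)%C w (w + h)%C (L * Cmod h)).
    replace (w + h - w)%C with h in K by ring.
    replace (f (w + h) - C_derive f w * (w + h) - (f w - C_derive f w * w))%C
      with (f (w + h) - f w - C_derive f w * h)%C in K by ring.
    assert (Hth : forall t, 0 <= t <= 1 -> Cmod (t * h) <= Cmod h).
    { intros t Ht. rewrite Cmod_mult, Cmod_R, Rabs_pos_eq by lra.
      generalize (Cmod_ge_0 h). nra. }
    apply K.
    - intros t Ht. apply cdiff_minus.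
      + apply H4. replace (w + t * h - z)%C with ((w - z) + t * h)%C by ring.
        eapply Rle_lt_trans; [apply Cmod_triangle|]. generalize (Hth t Ht). lra.
      + eapply cdiff_eq; [|apply (cdiff_scal _ _ _ _ (cdiff_id _))]. ring.
    - intros t Ht. specialize (Hth t Ht). eapply Rle_trans; [apply HLip; lra|].
      apply Rmult_le_compat_l; lra. }
  set (q := fun h => ((C_derive f (z + h)%C - C_derive f z) / h)%C).
  assert (Hq : forall h k : C, h <> 0 -> k <> 0 -> Cmod h < r / 2 -> Cmod k < r / 2 ->
     Cmod (q h - q k) * r <= 2 * (L * (Cmod h + Cmod k))).
  { intros h k Hh Hk Hh2 Hk2.
    set (G := fun x => ((f (x + h) - f x) / h - (f (x + k) - f x) / k)%C).
    assert (HG1 : forall h : C, h <> 0 -> Cmod h < r / 2 -> forall x, Cmod (x - z) < r ->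
       cdiff (fun x => (f (x + h) - f x) / h)%C x ((C_derive f (x + h)%C - C_derive f x) / h)%C).
    { clear -Hr H4. intros h Hh Hh2 x Hx.
      assert (K2 : Cmod (x + h - z) < 4 * r).
      { replace (x + h - z)%C with ((x - z) + h)%C by ring.
        eapply Rle_lt_trans; [apply Cmod_triangle|]. lra. }
      apply (cdiff_ext (fun x => / h * (f (x + h) - f x))%C); [intros; unfold Cdiv; ring|].
      unfold Cdiv. rewrite (Cmult_comm _ (/ h)). apply cdiff_scal.
      apply cdiff_minus; [|apply H4; lra].
      eapply cdiff_eq; [|apply (cdiff_comp f (fun x => x + h)%C);
        [apply H4; exact K2|apply cdiff_plus; [apply cdiff_id|apply cdiff_const]]].
      ring. }
    assert (HG : forall x, Cmod (x - z) < r -> cdiff G x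
      ((C_derive f (x + h)%C - C_derive f x) / h - (C_derive f (x + k)%C - C_derive f x) / k)).
    { intros x Hx. apply cdiff_minus; apply HG1; assumption. }
    replace (q h - q k)%C with (C_derive G z).
    2:{ apply cdiff_C_derive. apply HG. rewrite Cmod_zero_sub. exact Hr. }
    apply cauchy_estimate; [exact Hr| |].
    - intros x Hx. eapply cdiff_derive. apply HG. exact Hx.
    - intros x Hx. unfold G.
      assert (E : forall h : C, h <> 0 -> Cmod h < r / 2 ->
        Cmod ((f (x + h)%C - f x) / h - C_derive f x) <= L * Cmod h).
      { clear -HT Hx. intros h Hh Hh2. specialize (HT x h Hx Hh2).
        assert (Hp := proj1 (Cmod_gt_0 h) Hh).
        replace ((f (x + h) - f x) / h - C_derive f x)%C
          with ((f (x + h) - f x - C_derive f x * h) / h)%C by (field; exact Hh).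
        rewrite Cmod_div by exact Hh. apply (Rmult_le_reg_r (Cmod h)); [exact Hp|].
        unfold Rdiv. rewrite Rmult_assoc, Rinv_l by lra. lra. }
      assert (E1 := E h Hh Hh2). assert (E2 := E k Hk Hk2).
      rewrite Cmod_sub_comm in E2.
      eapply Rle_trans; [apply (Cmod_sub_trans _ (C_derive f x))|]. lra. }
  (* A limit of q is found along this sequence, by compactness. *)
  set (hn := fun n : nat => RtoC (r / 4 * / INR (S n))).
  assert (HI : forall n, 0 < / INR (S n) <= 1).
  { intros n. split; [apply Rinv_0_lt_compat, lt_0_INR; lia|].
    rewrite <- Rinv_1. apply Rinv_le_contravar; [lra|]. apply (le_INR 1). lia. }
  assert (Hhn : forall n, Cmod (hn n) = r / 4 * / INR (S n)).
  { intros n. unfold hn. rewrite Cmod_R, Rabs_pos_eq; [reflexivity|].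
    generalize (HI n). nra. }
  assert (Hhn0 : forall n, hn n <> 0).
  { intros n. apply Cmod_gt_0. rewrite Hhn. generalize (HI n). nra. }
  assert (Hhn2 : forall n, Cmod (hn n) < r / 2).
  { intros n. rewrite Hhn. generalize (HI n). nra. }
  destruct (bolzano_weierstrass_C (fun n => q (hn n)) L) as [l [phi [Hphi Hl]]].
  { intros n. unfold q. rewrite Cmod_div by apply Hhn0.
    assert (Hp := proj1 (Cmod_gt_0 _) (Hhn0 n)).
    apply Rle_div_l; [exact Hp|]. apply HLip; [|apply Hhn2].
    rewrite Cmod_zero_sub. exact Hr. }
  assert (Hlim : forall h : C, h <> 0 -> Cmod h < r / 2 -> Cmod (q h - l) * r <= 2 * L * Cmod h).
  { intros h Hh Hh2. apply Rnot_lt_le. intros Hlt.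
    set (g := Cmod (q h - l) * r - 2 * L * Cmod h) in *.
    assert (Hg : 0 < g) by (unfold g; lra).
    destruct (Hl (g / (4 * r))) as [N1 HN1]; [apply Rdiv_lt_0_compat; lra|].
    destruct (archimed_cor1 (g / (2 * L * r + 1))) as [N2 [HN2 HN20]];
      [apply Rdiv_lt_0_compat; nra|].
    set (n := phi (N1 + N2)%nat).
    assert (K1 := HN1 (N1 + N2)%nat ltac:(lia)). cbv beta in K1. fold n in K1.
    assert (K2 := Hq h (hn n) Hh (Hhn0 n) Hh2 (Hhn2 n)). rewrite Hhn in K2.
    assert (K3 : / INR (S n) <= / INR N2).
    { apply Rinv_le_contravar; [apply lt_0_INR; lia|]. apply le_INR.
      generalize (extraction_le phi Hphi (N1 + N2)). unfold n. lia. }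
    assert (K4 : / INR (S n) * (2 * L * r + 1) < g).
    { assert (K5 : / INR (S n) < g / (2 * L * r + 1)) by lra.
      apply Rlt_div_r in K5; [|nra]. lra. }
    assert (K5 : Cmod (q (hn n) - l) * r < g / 4).
    { apply (Rmult_lt_compat_r r) in K1; [|exact Hr].
      replace (g / (4 * r) * r) with (g / 4) in K1 by (field; lra). exact K1. }
    assert (K6 := Cmod_sub_trans (q h) (q (hn n)) l).
    assert (K7 : Cmod (q h - l) * r <= Cmod (q h - q (hn n)) * r + Cmod (q (hn n) - l) * r)
      by nra.
    generalize (HI n). unfold g in *. nra. }
  apply (cdiff_derive _ _ l). intros eps Heps.
  exists (Rmin (r / 2) (eps * r / (2 * L + 1))). split.
  { apply Rmin_pos; [lra|]. apply Rdiv_lt_0_compat; nra. }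
  intros w Hw.
  destruct (Ceq_dec w z) as [->|Hwz].
  { replace (C_derive f z - C_derive f z - l * (z - z))%C with (RtoC 0) by ring.
    rewrite Cmod_0, Cmod_zero_sub. lra. }
  assert (Hn : (w - z)%C <> 0) by (apply Cminus_eq_contra; exact Hwz).
  assert (K := Hlim (w - z)%C Hn (Rlt_Rmin_l _ _ _ Hw)).
  unfold q in K. replace (z + (w - z))%C with w in K by ring.
  replace (C_derive f w - C_derive f z - l * (w - z))%C
    with (((C_derive f w - C_derive f z) / (w - z) - l) * (w - z))%C by (field; exact Hn).
  rewrite Cmod_mult. apply Rmult_le_compat_r; [apply Cmod_ge_0|].
  apply (Rmult_le_reg_r r); [exact Hr|]. eapply Rle_trans; [exact K|].
  assert (K2 : Cmod (w - z) < eps * r / (2 * L + 1))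
    by (exact (Rlt_Rmin_r _ _ _ Hw)).
  apply Rlt_div_r in K2; [|lra].
  generalize (Cmod_ge_0 (w - z)). nra.
Qed.

Lemma entire_derive (f : C -> C) : entire f -> entire (C_derive f).
Proof.
  intros H. apply entire_cdiff. intros z.
  apply (holo_derive f z 1 (entire_holo f z 1 H)). rewrite Cmod_zero_sub. lra.
Qed.

Lemma zero_derive_const (f : C -> C) (z0 : C) (r : R) :
  (forall z, Cmod (z - z0) < r -> cdiff f z 0) ->
  forall z, Cmod (z - z0) < r -> f z = f z0.
Proof.
  intros H z Hz.
  assert (K : Cmod (f z - f z0) <= 0 * Cmod (z - z0)).
  { apply (mean_value_disc f (fun _ => 0%C) z0 r); [exact H| | |exact Hz].
    - intros x _. rewrite Cmod_0. lra.
    - rewrite Cmod_zero_sub. generalize (Cmod_ge_0 (z - z0)). lra. }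
  apply Ceq_minus. apply Cmod_eq_0. generalize (Cmod_ge_0 (f z - f z0)). lra.
Qed.

Lemma holo_bounded (f : C -> C) (z0 : C) (R0 rho : R) :
  holo f z0 R0 -> rho < R0 ->
  exists K, 0 <= K /\ forall w, Cmod (w - z0) <= rho -> Cmod (f w) <= K.
Proof.
  intros Hf Hrho.
  destruct (locally_bounded_on_disc
    (fun x => if Rle_dec (Cmod x) rho then Cmod (f (z0 + x)%C) else 0)) with (R0 := rho)
    as [K HK].
  - intros x. destruct (Rle_dec (Cmod x) rho) as [Hx|Hx].
    + assert (Hin : Cmod (z0 + x - z0) < R0)
        by (replace (z0 + x - z0)%C with x by ring; lra).
      destruct (ccont_locally_bounded f _ (cdiff_ccont f _ _ (Hf _ Hin))) as [d [K [Hd HK]]].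
      exists d, (Rmax K 0). split; [exact Hd|]. intros w Hw.
      destruct (Rle_dec (Cmod w) rho).
      * eapply Rle_trans; [|apply Rmax_l]. apply HK.
        replace (z0 + w - (z0 + x))%C with (w - x)%C by ring. exact Hw.
      * apply Rmax_r.
    + exists (Cmod x - rho), 0. split; [lra|]. intros w Hw.
      destruct (Rle_dec (Cmod w) rho) as [Hw2|_]; [|lra].
      generalize (Cmod_sub_lower x w). rewrite Cmod_sub_comm. lra.
  - exists (Rmax K 0). split; [apply Rmax_r|]. intros w Hw.
    eapply Rle_trans; [|apply Rmax_l]. specialize (HK (w - z0)%C Hw). cbv beta in HK.
    destruct (Rle_dec (Cmod (w - z0)) rho) as [_|Hn]; [|lra].
    replace (z0 + (w - z0))%C with w in HK by ring. exact HK.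
Qed.

Lemma taylor_order_2 (f df ddf : C -> C) (c : C) (r K : R) (a b : C) :
  (forall x, Cmod (x - c) < r -> cdiff f x (df x)) ->
  (forall x, Cmod (x - c) < r -> cdiff df x (ddf x)) ->
  (forall x, Cmod (x - c) < r -> Cmod (ddf x) <= K) ->
  Cmod (a - c) < r -> Cmod (b - c) < r ->
  Cmod (f b - f a - df a * (b - a)) <= K * Cmod (b - a) * Cmod (b - a).
Proof.
  intros Hf Hdf HK Ha Hb.
  assert (HK0 : 0 <= K) by (eapply Rle_trans; [apply Cmod_ge_0|exact (HK a Ha)]).
  replace (f b - f a - df a * (b - a))%C
    with ((f b - df a * b) - (f a - df a * a))%C by ring.
  apply (mean_value_ineq (fun x => f x - df a * x)%C (fun x => df x - df a)%C).
  - intros t Ht. apply cdiff_minus.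
    + apply Hf. apply segment_in_disc; assumption.
    + eapply cdiff_eq; [|apply (cdiff_scal _ _ _ _ (cdiff_id _))]. ring.
  - intros t Ht.
    eapply Rle_trans; [apply (mean_value_disc df ddf c r K); try eassumption;
      apply segment_in_disc; assumption|].
    apply Rmult_le_compat_l; [exact HK0|].
    replace (a + t * (b - a) - a)%C with (t * (b - a))%C by ring.
    rewrite Cmod_mult, Cmod_R, Rabs_pos_eq by lra. generalize (Cmod_ge_0 (b - a)). nra.
Qed.

(** * Primitives and logarithms *)

Definition pcont (F : R -> C) : Prop :=
  forall t : R, 0 <= t <= 1 ->
    continuous (fun s => Re (F s)) t /\ continuous (fun s => Im (F s)) t.

Definition pint (F : R -> C) : C :=
  (RInt (fun s => Re (F s)) 0 1, RInt (fun s => Im (F s)) 0 1).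

Lemma pdiff_pcont (F dF : R -> C) :
  (forall t : R, 0 <= t <= 1 -> pdiff F t (dF t)) -> pcont F.
Proof.
  intros H t Ht. destruct (H t Ht) as [H1 H2].
  split; apply (ex_derive_continuous (V:=R_NormedModule)); eexists; eassumption.
Qed.

Lemma pcont_ex_RInt (F : R -> C) : pcont F ->
  ex_RInt (fun s => Re (F s)) 0 1 /\ ex_RInt (fun s => Im (F s)) 0 1.
Proof.
  intros H. split; apply (ex_RInt_continuous (V:=R_CompleteNormedModule));
    rewrite Rmin_left, Rmax_right by lra; intros t Ht; apply (H t Ht).
Qed.

Lemma pint_minus (F G : R -> C) : pcont F -> pcont G ->
  pint (fun t => F t - G t)%C = (pint F - pint G)%C.
Proof.
  intros HF HG. apply pcont_ex_RInt in HF. apply pcont_ex_RInt in HG.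
  unfold pint. apply injective_projections; simpl.
  - rewrite (RInt_ext _ (fun s => minus (Re (F s)) (Re (G s))))
      by (intros; apply re_minus).
    apply (RInt_minus (fun s => Re (F s)) (fun s => Re (G s))); [apply HF|apply HG].
  - rewrite (RInt_ext _ (fun s => minus (Im (F s)) (Im (G s))))
      by (intros; apply im_minus).
    apply (RInt_minus (fun s => Im (F s)) (fun s => Im (G s))); [apply HF|apply HG].
Qed.

Lemma pcont_minus (F G : R -> C) : pcont F -> pcont G -> pcont (fun t => F t - G t)%C.
Proof.
  intros HF HG t Ht. destruct (HF t Ht), (HG t Ht). split.
  - apply (continuous_ext (fun s => minus (Re (F s)) (Re (G s)))).
    + intros s. symmetry. apply re_minus.
    + apply (continuous_minus (V:=R_NormedModule)); assumption.
  - apply (continuous_ext (fun s => minus (Im (F s)) (Im (G s)))).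
    + intros s. symmetry. apply im_minus.
    + apply (continuous_minus (V:=R_NormedModule)); assumption.
Qed.

Lemma pint_bound (F : R -> C) (M : R) : pcont F ->
  (forall t : R, 0 <= t <= 1 -> Cmod (F t) <= M) -> Cmod (pint F) <= 2 * M.
Proof.
  intros HF HM. apply pcont_ex_RInt in HF.
  rewrite (C_re_im (pint F)). eapply Rle_trans; [apply Cmod_triangle|].
  rewrite Cmod_mult, Cmod_Ci, !Cmod_R. unfold pint; simpl.
  assert (H1 : Rabs (RInt (fun s => Re (F s)) 0 1) <= (1 - 0) * M).
  { apply abs_RInt_le_const; [lra|apply HF|]. intros t Ht.
    eapply Rle_trans; [apply Re_le_Cmod|apply HM; exact Ht]. }
  assert (H2 : Rabs (RInt (fun s => Im (F s)) 0 1) <= (1 - 0) * M).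
  { apply abs_RInt_le_const; [lra|apply HF|]. intros t Ht.
    eapply Rle_trans; [apply Im_le_Cmod|apply HM; exact Ht]. }
  unfold Re, Im in *. simpl. lra.
Qed.

Lemma pint_derive (F dF : R -> C) :
  (forall t : R, 0 <= t <= 1 -> pdiff F t (dF t)) -> pcont dF ->
  pint dF = (F 1 - F 0)%C.
Proof.
  intros H Hc.
  assert (E : (F 1 - F 0)%C = (Re (F 1) - Re (F 0), Im (F 1) - Im (F 0)))
    by (apply injective_projections; [apply re_minus|apply im_minus]).
  rewrite E. unfold pint. f_equal; apply is_RInt_unique.
  - apply (is_RInt_derive (V:=R_CompleteNormedModule) (fun s => Re (F s)));
      rewrite Rmin_left, Rmax_right by lra; intros t Ht; [apply (H t Ht)|apply (Hc t Ht)].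
  - apply (is_RInt_derive (V:=R_CompleteNormedModule) (fun s => Im (F s)));
      rewrite Rmin_left, Rmax_right by lra; intros t Ht; [apply (H t Ht)|apply (Hc t Ht)].
Qed.

Lemma cdiff_path (f : C -> C) (l : R -> C) :
  (forall t : R, 0 <= t <= 1 -> cdiff f t (l t)) ->
  forall t : R, 0 <= t <= 1 -> pdiff (fun s => f s) t (l t).
Proof.
  intros H t Ht. assert (K := pdiff_line f 0 1 (l t) t).
  rewrite Cmult_1_r, Cplus_0_l, Cmult_1_r in K. specialize (K (H t Ht)).
  destruct K as [K1 K2]. split.
  - eapply is_derive_ext; [|exact K1]. intros s. cbv beta. do 2 f_equal. ring.
  - eapply is_derive_ext; [|exact K2]. intros s. cbv beta. do 2 f_equal. ring.
Qed.

Lemma cdiff_ray (psi : C -> C) (z0 v : C) (R0 : R) (t : R) :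
  holo psi z0 R0 -> Cmod v < R0 -> 0 <= t <= 1 ->
  cdiff (fun s => psi (z0 + s * v)%C) t (v * C_derive psi (z0 + t * v)%C).
Proof.
  intros H Hv Ht. apply (cdiff_comp psi (fun s => z0 + s * v)%C).
  - apply H. replace (z0 + t * v - z0)%C with (t * v)%C by ring.
    rewrite Cmod_mult, Cmod_R, Rabs_pos_eq by lra. generalize (Cmod_ge_0 v). nra.
  - apply (cdiff_ext (fun s => z0 + v * s)%C); [intros; ring|]. apply cdiff_affine.
Qed.

(** Integrate along rays from the centre: the derivative of v psi (z0 + t v) with
    respect to v is the derivative of t psi (z0 + t v) with respect to t, which
    integrates to psi (z0 + v). *)
Lemma holo_primitive (psi : C -> C) (z0 : C) (R0 : R) :
  holo psi z0 R0 ->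
  exists P, forall z, Cmod (z - z0) < R0 -> cdiff P z (psi z).
Proof.
  intros Hpsi. assert (Hpsi' := holo_derive _ _ _ Hpsi).
  assert (Hpsi'' := holo_derive _ _ _ Hpsi').
  set (integrand := fun (v : C) (t : R) => (v * psi (z0 + t * v))%C).
  exists (fun z => pint (integrand (z - z0)%C)).
  assert (Hcont : forall v, Cmod v < R0 -> pcont (integrand v)).
  { intros v Hv. eapply pdiff_pcont.
    apply (cdiff_path (fun s => v * psi (z0 + s * v))%C
      (fun t => v * (v * C_derive psi (z0 + t * v)))%C).
    intros t Ht. apply (cdiff_scal v). apply (cdiff_ray psi z0 v R0); assumption. }
  intros z Hz. set (v := (z - z0)%C) in *.
  set (rho := (Cmod v + R0) / 2).
  destruct (holo_bounded _ _ _ rho Hpsi' ltac:(unfold rho; lra)) as [C1 [HC1 HC1b]].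
  destruct (holo_bounded _ _ _ rho Hpsi'' ltac:(unfold rho; lra)) as [C2 [HC2 HC2b]].
  set (KK := Cmod v * C2 + C1).
  assert (HK : forall h, Cmod h < (R0 - Cmod v) / 2 ->
    Cmod (pint (integrand (v + h)%C) - pint (integrand v) - h * psi z) <= 2 * (KK * Cmod h * Cmod h)).
  { intros h Hh.
    assert (Hvh : Cmod (v + h) < rho)
      by (eapply Rle_lt_trans; [apply Cmod_triangle|]; unfold rho; lra).
    set (W := fun s : C => (h * (s * psi (z0 + s * v)))%C).
    set (dW := fun s : C => (h * (psi (z0 + s * v) + s * (v * C_derive psi (z0 + s * v))))%C).
    assert (HW : forall t : R, 0 <= t <= 1 -> cdiff W t (dW t)).
    { intros t Ht. apply (cdiff_scal h). eapply cdiff_eq;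
        [|exact (cdiff_mult _ _ _ _ _ (cdiff_id _) (cdiff_ray psi z0 v R0 t Hpsi Hz Ht))].
      cbv beta. ring. }
    assert (HdW : pcont (fun t : R => dW t)).
    { eapply pdiff_pcont. eapply cdiff_path. intros t Ht.
      apply (cdiff_scal h). apply cdiff_plus.
      - apply (cdiff_ray psi z0 v R0); assumption.
      - apply cdiff_mult; [apply cdiff_id|]. apply (cdiff_scal v).
        apply (cdiff_ray (C_derive psi) z0 v R0); assumption. }
    assert (E : pint (fun t : R => dW t) = (h * psi z)%C).
    { rewrite (pint_derive (fun t => W t) (fun t => dW t)); [|apply cdiff_path; exact HW|exact HdW].
      unfold W. replace (z0 + 1 * v)%C with z by (unfold v; ring). ring. }
    rewrite <- E, <- pint_minus by (apply Hcont; unfold rho in *; lra).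
    rewrite <- pint_minus; [|apply pcont_minus; apply Hcont; unfold rho in *; lra|exact HdW].
    apply pint_bound.
    { apply pcont_minus; [apply pcont_minus; apply Hcont; unfold rho in *; lra|exact HdW]. }
    intros t Ht. unfold integrand, dW.
    set (a := (z0 + t * v)%C). set (k := (t * h)%C).
    replace (z0 + t * (v + h))%C with (a + k)%C by (unfold a, k; ring).
    replace ((v + h) * psi (a + k)%C - v * psi a - h * (psi a + t * (v * C_derive psi a)))%C
      with (v * (psi (a + k)%C - psi a - C_derive psi a * k) + h * (psi (a + k)%C - psi a))%C
      by (unfold k; ring).
    assert (Hv0 := Cmod_ge_0 v). assert (Hh0 := Cmod_ge_0 h).
    assert (Ha : Cmod (a - z0) < rho).
    { unfold a. replace (z0 + t * v - z0)%C with (t * v)%C by ring.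
      rewrite Cmod_mult, Cmod_R, Rabs_pos_eq by lra. unfold rho. nra. }
    assert (Hak : Cmod (a + k - z0) < rho).
    { unfold a, k. replace (z0 + t * v + t * h - z0)%C with (t * (v + h))%C by ring.
      rewrite Cmod_mult, Cmod_R, Rabs_pos_eq by lra. generalize (Cmod_ge_0 (v + h)). nra. }
    assert (Hk : Cmod k <= Cmod h).
    { unfold k. rewrite Cmod_mult, Cmod_R, Rabs_pos_eq by lra. nra. }
    assert (Hin : forall x, Cmod (x - z0) < rho -> Cmod (x - z0) < R0)
      by (intros; unfold rho in *; lra).
    assert (T1 := taylor_order_2 psi (C_derive psi) (C_derive (C_derive psi)) z0 rho C2 a (a + k)%C
      ltac:(intros; apply Hpsi; auto) ltac:(intros; apply Hpsi'; auto)
      ltac:(intros; apply HC2b; lra) Ha Hak).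
    assert (T2 := mean_value_disc psi (C_derive psi) z0 rho C1 a (a + k)%C
      ltac:(intros; apply Hpsi; auto) ltac:(intros; apply HC1b; lra) Ha Hak).
    replace (a + k - a)%C with k in T1, T2 by ring.
    assert (Hk0 := Cmod_ge_0 k).
    assert (T3 : C2 * Cmod k * Cmod k <= C2 * Cmod h * Cmod h).
    { rewrite !Rmult_assoc. apply Rmult_le_compat_l; [exact HC2|]. nra. }
    assert (T4 : C1 * Cmod k <= C1 * Cmod h) by (apply Rmult_le_compat_l; lra).
    eapply Rle_trans; [apply Cmod_triangle|]. rewrite !Cmod_mult. unfold KK.
    apply Rle_trans with (Cmod v * (C2 * Cmod h * Cmod h) + Cmod h * (C1 * Cmod h)).
    - apply Rplus_le_compat; apply Rmult_le_compat_l; lra.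
    - right. ring. }
  assert (HKK : 0 <= KK) by (unfold KK; generalize (Cmod_ge_0 v); nra).
  intros eps Heps. exists (Rmin ((R0 - Cmod v) / 2) (eps / (2 * KK + 1))). split.
  { apply Rmin_pos; [lra|apply Rdiv_lt_0_compat; lra]. }
  intros w Hw.
  assert (K := HK (w - z)%C (Rlt_Rmin_l _ _ _ Hw)).
  replace (v + (w - z))%C with (w - z0)%C in K by (unfold v; ring).
  rewrite (Cmult_comm (psi z)). eapply Rle_trans; [exact K|].
  rewrite <- Rmult_assoc. apply Rmult_le_compat_r; [apply Cmod_ge_0|].
  assert (K2 : Cmod (w - z) < eps / (2 * KK + 1))
    by (exact (Rlt_Rmin_r _ _ _ Hw)).
  apply Rlt_div_r in K2; [|lra].
  generalize (Cmod_ge_0 (w - z)). nra.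
Qed.

Lemma holo_log (F : C -> C) (z0 : C) (R0 : R) :
  holo F z0 R0 -> (forall z, Cmod (z - z0) < R0 -> F z <> 0) ->
  exists L, forall z, Cmod (z - z0) < R0 ->
    cdiff L z (C_derive F z / F z) /\ Cexp (L z) = F z.
Proof.
  intros HF Hnz.
  destruct (Rle_dec R0 0) as [HR|HR].
  { exists F. intros z Hz. generalize (Cmod_ge_0 (z - z0)). lra. }
  assert (Hc : Cmod (z0 - z0) < R0) by (rewrite Cmod_zero_sub; lra).
  destruct (holo_primitive (fun z => C_derive F z / F z)%C z0 R0) as [P HP].
  { intros z Hz. eapply cdiff_derive. apply cdiff_div; [apply Hnz; exact Hz| |].
    - apply (holo_derive F z0 R0 HF z Hz).
    - apply HF. exact Hz. }
  set (k := (F z0 * Cexp (- P z0))%C).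
  assert (Hk : k <> 0) by (apply Cmult_neq_0; [apply Hnz; exact Hc|apply Cexp_neq_0]).
  destruct (Cexp_surj k Hk) as [c [Hc1 _]].
  exists (fun z => P z + c)%C. intros z Hz. split.
  - eapply cdiff_eq; [|apply cdiff_plus; [apply HP; exact Hz|apply cdiff_const]]. ring.
  - assert (E : (F z * Cexp (- P z))%C = k).
    { apply (zero_derive_const (fun z => F z * Cexp (- P z))%C z0 R0); [|exact Hz].
      intros w Hw. eapply cdiff_eq; [|apply cdiff_mult; [apply HF; exact Hw|
        apply cdiff_Cexp_comp; apply cdiff_opp; apply HP; exact Hw]].
      cbv beta. field. apply Hnz; exact Hw. }
    rewrite Cexp_plus, Hc1, <- E, Cexp_opp. field. apply Cexp_neq_0.
Qed.

(** * Harnack's inequality *)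

(** On the circle of radius r put e = (z - z0) / r, and let u turn L' z0 into the
    positive axis. Then Re L (2 - 2 Re (u conj e)) >= 0, and this is the real part
    of the function A - r u B of the proof, whose limit at the centre is
    2 L z0 - r u L' z0. The last term of A compensates the constant L z0
    subtracted in B. *)
Lemma derive_bound_of_re_nonneg (L : C -> C) (z0 : C) (R0 : R) :
  0 < R0 -> holo L z0 R0 -> (forall z, Cmod (z - z0) < R0 -> 0 <= Re (L z)) ->
  Cmod (C_derive L z0) * R0 <= 2 * Re (L z0).
Proof.
  intros HR HL Hpos. apply Rmult_le_of_lt; [exact HR|apply Cmod_ge_0|]. intros r Hr.
  destruct (exists_phase (C_derive L z0)) as [u [Hu Hul]].
  assert (Hc : Cmod (z0 - z0) < R0) by (rewrite Cmod_zero_sub; exact HR).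
  assert (Hr0 : RtoC r <> 0) by (apply RtoC_neq_0; lra).
  set (v := L z0).
  set (A := fun z => (2 * L z - Cconj u * L z * ((z - z0) / r)
                      - Cconj (v * u) * ((z - z0) / r))%C).
  set (B := fun z => ((L z - L z0) / (z - z0))%C).
  assert (HA : forall z, Cmod (z - z0) < R0 -> exists m, cdiff A z m).
  { intros z Hz. unfold A, Cdiv. eexists.
    assert (K : cdiff (fun z => (z - z0) * / r)%C z (/ r)).
    { apply (cdiff_ext (fun z => - (z0 / r) + / r * z)%C);
        [intros; field; exact Hr0|apply cdiff_affine]. }
    apply cdiff_minus; [apply cdiff_minus|].
    - apply (cdiff_scal 2). apply HL; exact Hz.
    - apply cdiff_mult; [apply (cdiff_scal (Cconj u)); apply HL; exact Hz|exact K].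
    - apply (cdiff_scal (Cconj (v * u))). exact K. }
  assert (HAc : A z0 = (2 * v)%C) by (unfold A; fold v; field; exact Hr0).
  assert (K : 0 <= Re (2 * v - r * u * C_derive L z0)%C).
  { apply (centre_nonneg (fun z => A z - r * u * B z)%C z0 _ R0 r Hr).
    - intros z Hz Hz2. destruct (HA z Hz2) as [m Hm]. eexists.
      apply cdiff_minus; [exact Hm|]. apply (cdiff_scal (r * u)). apply cdiff_div.
      + apply Cminus_eq_contra. exact Hz.
      + apply cdiff_minus; [apply HL; exact Hz2|apply cdiff_const].
      + apply cdiff_minus; [apply cdiff_id|apply cdiff_const].
    - intros eps Heps.
      destruct (HA z0 Hc) as [m Hm].
      destruct (cdiff_ccont A z0 m Hm (eps / 2) ltac:(lra)) as [d1 [Hd1 H1]].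
      destruct (difference_quotient_limit L z0 _ (HL z0 Hc) (eps / (2 * r)))
        as [d2 [Hd2 H2]]; [apply Rdiv_lt_0_compat; lra|].
      exists (Rmin d1 d2). split; [apply Rmin_pos; assumption|]. intros z Hz Hz2.
      assert (K1 := H1 z (Rlt_Rmin_l _ _ _ Hz2)).
      assert (K2 := H2 z Hz (Rlt_Rmin_r _ _ _ Hz2)).
      rewrite HAc in K1. fold (B z) in K2.
      replace (A z - r * u * B z - (2 * v - r * u * C_derive L z0))%C
        with ((A z - 2 * v) - r * u * (B z - C_derive L z0))%C by ring.
      eapply Rle_lt_trans; [apply Cmod_triangle_sub|].
      rewrite !Cmod_mult, Hu, Cmod_R, Rabs_pos_eq, Rmult_1_r by lra.
      apply (Rmult_lt_compat_l r) in K2; [|lra].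
      replace (r * (eps / (2 * r))) with (eps / 2) in K2 by (field; lra). lra.
    - intros z Hz.
      assert (Hn : (z - z0)%C <> 0) by (apply Cmod_gt_0; lra).
      assert (HLz := Hpos z ltac:(lra)).
      set (e := ((z - z0) / r)%C).
      assert (He : Cmod e = 1).
      { unfold e. rewrite Cmod_div, Hz, Cmod_R, Rabs_pos_eq by (exact Hr0 || lra). field; lra. }
      assert (He2 : (e * Cconj e)%C = 1).
      { rewrite <- Cmod2_conj, He, RtoC_pow. ring. }
      assert (HB : (r * u * B z)%C = (u * Cconj e * (L z - v))%C).
      { assert (Hez : (z - z0)%C = (r * e)%C) by (unfold e; field; exact Hr0).
        assert (He0 : e <> 0) by (apply Cmod_gt_0; lra).
        unfold B. fold v. rewrite Hez. transitivity (u * (L z - v) * (/ e))%C.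
        - field. split; [exact He0|exact Hr0].
        - replace (/ e)%C with (Cconj e); [ring|].
          rewrite <- (Cmult_1_r (/ e)), <- He2. field. exact He0. }
      assert (E : Re (A z - r * u * B z)%C = Re (L z) * (2 - 2 * Re (u * Cconj e)%C)).
      { rewrite HB. unfold A. fold e.
        destruct (L z) as [l1 l2], u as [u1 u2], e as [e1 e2], v as [v1 v2].
        unfold Re, Cconj, Cminus, Cplus, Copp, Cmult, RtoC; simpl. ring. }
      rewrite E. apply Rmult_le_pos; [exact HLz|].
      assert (K1 := Re_le_Cmod_pos (u * Cconj e)%C).
      rewrite Cmod_mult, Cmod_conj, Hu, He in K1. lra. }
  replace (r * u * C_derive L z0)%C with (r * (u * C_derive L z0))%C in K by ring.
  rewrite Hul, re_minus, !re_scal_l, re_RtoC in K. fold v in K. lra.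
Qed.

Lemma mobius_in_disc (s : R) (w : C) : 0 <= s < 1 -> Cmod w < 1 ->
  (1 + s * w)%C <> 0 /\ Cmod ((w + s) / (1 + s * w)) < 1.
Proof.
  intros Hs Hw. assert (Hw0 := Cmod_ge_0 w).
  assert (Hn : (1 + s * w)%C <> 0).
  { intros E. assert (E2 : (s * w)%C = (- (1))%C)
      by (replace (s * w)%C with (1 + s * w - 1)%C by ring; rewrite E; ring).
    assert (E3 : Cmod (s * w) = 1) by (rewrite E2, Cmod_opp, Cmod_1; reflexivity).
    rewrite Cmod_mult, Cmod_R, Rabs_pos_eq in E3 by lra. nra. }
  split; [exact Hn|]. rewrite Cmod_div by exact Hn.
  assert (Hp := proj1 (Cmod_gt_0 _) Hn).
  apply (Rmult_lt_reg_r (Cmod (1 + s * w))); [exact Hp|].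
  unfold Rdiv. rewrite Rmult_assoc, Rinv_l, Rmult_1_r, Rmult_1_l by lra.
  assert (H1 := Cmod2_alt (w + s)). assert (H2 := Cmod2_alt (1 + s * w)).
  assert (H3 := Cmod2_alt w).
  apply Rsqr_incrst_0; [|apply Cmod_ge_0|apply Cmod_ge_0].
  rewrite !Rsqr_pow2, H1, H2.
  assert (Hw2 : Re w ^ 2 + Im w ^ 2 < 1) by (rewrite <- H3; simpl; nra).
  rewrite !re_plus, !im_plus, re_scal_l, im_scal_l, !re_RtoC, !im_RtoC.
  assert (Hq : 0 < (1 - s * s) * (1 - (Re w ^ 2 + Im w ^ 2)))
    by (apply Rmult_lt_0_compat; nra).
  ring_simplify in Hq. ring_simplify. lra.
Qed.

(** The bound at the centre, transported by the automorphism of the disc that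
    moves the centre to the point at relative distance s. Compared with using a
    smaller disc about that point this gains the factor 1 + s, and it is this
    gain that makes the exponent in [harnack] equal to one. *)
Lemma harnack_derive (L : C -> C) (z0 w : C) (R0 s : R) :
  0 < R0 -> holo L z0 R0 -> (forall z, Cmod (z - z0) < R0 -> 0 <= Re (L z)) ->
  Cmod w = 1 -> 0 <= s < 1 ->
  Cmod (C_derive L (z0 + s * (R0 * w))%C) * R0 * (1 - s * s) <= 2 * Re (L (z0 + s * (R0 * w))%C).
Proof.
  intros HR HL Hpos Hw Hs.
  set (m := fun x => (z0 + R0 * w * ((x + s) / (1 + s * x)))%C).
  assert (Hm : forall x, Cmod (x - 0) < 1 -> Cmod (m x - z0) < R0).
  { intros x Hx. replace (x - 0)%C with x in Hx by ring.
    destruct (mobius_in_disc s x Hs Hx) as [_ H].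
    unfold m. replace (z0 + R0 * w * ((x + s) / (1 + s * x)) - z0)%C
      with (R0 * w * ((x + s) / (1 + s * x)))%C by (unfold Cminus, Cdiv; ring).
    rewrite !Cmod_mult, Hw, Cmod_R, Rabs_pos_eq by lra. nra. }
  assert (Hmd : forall x, Cmod (x - 0) < 1 ->
    cdiff m x (R0 * w * ((1 - s * s) / ((1 + s * x) * (1 + s * x))))%C).
  { intros x Hx. replace (x - 0)%C with x in Hx by ring.
    destruct (mobius_in_disc s x Hs Hx) as [H _].
    eapply cdiff_eq; [|apply cdiff_plus; [apply cdiff_const|apply (cdiff_scal (R0 * w));
      apply cdiff_div; [exact H| |]]].
    3: apply cdiff_affine.
    2: apply cdiff_plus; [apply cdiff_id|apply cdiff_const].
    cbv beta. field. exact H. }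
  assert (Hmc : m 0 = (z0 + s * (R0 * w))%C).
  { unfold m. assert (E : (1 + s * 0)%C = 1) by ring. rewrite E. field. }
  assert (Hc0 : Cmod (0 - 0) < 1) by (rewrite Cmod_zero_sub; lra).
  assert (HG : forall x, Cmod (x - 0) < 1 -> cdiff (fun x => L (m x)) x
     (R0 * w * ((1 - s * s) / ((1 + s * x) * (1 + s * x))) * C_derive L (m x))).
  { intros x Hx. apply (cdiff_comp L m); [apply HL; apply Hm; exact Hx|apply Hmd; exact Hx]. }
  assert (K := derive_bound_of_re_nonneg (fun x => L (m x)) 0 1 Rlt_0_1).
  assert (K1 : Cmod (C_derive (fun x => L (m x)) 0) * 1 <= 2 * Re (L (m 0))).
  { apply K.
    - intros x Hx. eapply cdiff_derive. apply HG. exact Hx.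
    - intros x Hx. apply Hpos. apply Hm. exact Hx. }
  rewrite (cdiff_C_derive _ _ _ (HG 0 Hc0)), Hmc in K1.
  replace (R0 * w * ((1 - s * s) / ((1 + s * 0) * (1 + s * 0))))%C
    with (w * ((R0 * (1 - s * s))%R))%C in K1.
  - assert (Hq : 0 <= R0 * (1 - s * s)) by (apply Rmult_le_pos; nra).
    rewrite !Cmod_mult, Hw, Cmod_R, Rabs_pos_eq in K1 by exact Hq. lra.
  - assert (E : (1 + s * 0)%C = 1) by ring. rewrite E.
    rewrite RtoC_mult, RtoC_minus, RtoC_mult. field.
Qed.

(** By [harnack_derive], Re L (1 + s) / (1 - s) does not decrease as s grows along
    a radius. *)
Lemma harnack (L : C -> C) (z0 z : C) (R0 : R) :
  holo L z0 R0 -> (forall z, Cmod (z - z0) < R0 -> 0 <= Re (L z)) ->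
  Cmod (z - z0) < R0 ->
  Re (L z0) * (R0 - Cmod (z - z0)) <= Re (L z) * (R0 + Cmod (z - z0)).
Proof.
  intros HL Hpos Hz. set (rho := Cmod (z - z0)) in *.
  assert (Hrho : 0 <= rho) by apply Cmod_ge_0.
  destruct (Ceq_dec z z0) as [E|E].
  { assert (E0 : rho = 0) by (unfold rho; rewrite E; apply Cmod_zero_sub).
    rewrite E0, E. lra. }
  assert (Hn : (z - z0)%C <> 0) by (apply Cminus_eq_contra; exact E).
  assert (Hrho' : 0 < rho) by (apply Cmod_gt_0; exact Hn).
  assert (HR : 0 < R0) by lra.
  assert (Hrc : RtoC rho <> 0) by (apply RtoC_neq_0; lra).
  assert (HRc : RtoC R0 <> 0) by (apply RtoC_neq_0; lra).
  set (w := ((z - z0) / rho)%C).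
  assert (Hw : Cmod w = 1).
  { unfold w. rewrite Cmod_div by exact Hrc. fold rho. rewrite Cmod_R, Rabs_pos_eq by lra.
    field; lra. }
  set (a := rho / R0).
  assert (HaR : a * R0 = rho) by (unfold a; field; lra).
  assert (Ha : 0 < a < 1) by nra.
  assert (Hpz : (z0 + a * (R0 * w))%C = z).
  { unfold a, w. rewrite RtoC_div by lra. field. split; assumption. }
  set (U := fun s : R => Re (L (z0 + s * (R0 * w))%C)).
  assert (HU : forall s, 0 <= s < 1 ->
    is_derive U s (Re (C_derive L (z0 + s * (R0 * w)) * (R0 * w))%C)).
  { intros s Hs.
    assert (K := pdiff_line L z0 (R0 * w)%C (C_derive L (z0 + s * (R0 * w))%C) s).
    apply K. apply HL. replace (z0 + s * (R0 * w) - z0)%C with (s * (R0 * w))%C by ring.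
    rewrite !Cmod_mult, Hw, !Cmod_R, !Rabs_pos_eq by lra. nra. }
  set (V := fun s : R => U s * ((1 + s) / (1 - s))).
  set (dV := fun s : R => Re (C_derive L (z0 + s * (R0 * w)) * (R0 * w))%C * ((1 + s) / (1 - s))
     + U s * (2 / ((1 - s) * (1 - s)))).
  assert (HV : forall s, 0 <= s < 1 -> is_derive V s (dV s)).
  { intros s Hs. apply (is_derive_mult U (fun s => (1 + s) / (1 - s))).
    - apply HU; exact Hs.
    - auto_derive; [lra|]. field. lra.
    - apply Rmult_comm. }
  assert (HV0 : forall s, 0 <= s < 1 -> 0 <= dV s).
  { intros s Hs. unfold dV.
    assert (K := harnack_derive L z0 w R0 s HR HL Hpos Hw Hs). fold (U s) in K.
    set (D := C_derive L (z0 + s * (R0 * w))%C) in *.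
    assert (K1 : - (Cmod D * R0) <= Re (D * (R0 * w))%C).
    { assert (K2 := Re_le_Cmod (D * (R0 * w))%C).
      rewrite !Cmod_mult, Hw, Cmod_R, (Rabs_pos_eq R0), Rmult_1_r in K2 by lra.
      apply Rabs_le_between in K2. lra. }
    replace (Re (D * (R0 * w))%C * ((1 + s) / (1 - s)) + U s * (2 / ((1 - s) * (1 - s))))
      with ((Re (D * (R0 * w))%C * (1 - s * s) + 2 * U s) * / ((1 - s) * (1 - s)))
      by (field; lra).
    apply Rmult_le_pos; [|left; apply Rinv_0_lt_compat; nra].
    assert (K3 : - (Cmod D * R0) * (1 - s * s) <= Re (D * (R0 * w))%C * (1 - s * s))
      by (apply Rmult_le_compat_r; nra).
    nra. }
  destruct (MVT_gen V 0 a dV) as [c [Hc Hc2]].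
  - rewrite Rmin_left, Rmax_right by lra. intros t Ht. apply HV. lra.
  - rewrite Rmin_left, Rmax_right by lra. intros t Ht. apply continuity_pt_filterlim.
    apply (ex_derive_continuous V). eexists. apply HV. lra.
  - rewrite Rmin_left, Rmax_right in Hc by lra.
    assert (K := HV0 c ltac:(lra)).
    assert (K1 : V 0 <= V a) by nra.
    unfold V, U in K1. rewrite Hpz in K1.
    replace (z0 + 0 * (R0 * w))%C with z0 in K1 by ring.
    replace ((1 + 0) / (1 - 0)) with 1 in K1 by field.
    apply (Rmult_le_compat_r (1 - a)) in K1; [|lra].
    replace (Re (L z) * ((1 + a) / (1 - a)) * (1 - a)) with (Re (L z) * (1 + a)) in K1
      by (field; lra).
    assert (E1 : rho = a * R0) by lra. rewrite E1.
    replace (Re (L z0) * (R0 - a * R0)) with (Re (L z0) * 1 * (1 - a) * R0) by ring.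
    replace (Re (L z) * (R0 + a * R0)) with (Re (L z) * (1 + a) * R0) by ring.
    apply Rmult_le_compat_r; lra.
Qed.

Section Nonvanishing.

Variables (F : C -> C) (z0 : C) (R0 : R).
Hypothesis HF : holo F z0 R0.
Hypothesis HF1 : forall z, Cmod (z - z0) < R0 -> 1 <= Cmod (F z).

Lemma log_of_large : exists L, holo L z0 R0 /\
  forall z, Cmod (z - z0) < R0 ->
    C_derive L z = (C_derive F z / F z)%C /\ Re (L z) = ln (Cmod (F z)) /\ 0 <= Re (L z).
Proof.
  destruct (holo_log F z0 R0 HF) as [L HL].
  { intros z Hz. apply Cmod_gt_0. specialize (HF1 z Hz). lra. }
  exists L. split.
  - intros z Hz. eapply cdiff_derive. apply HL. exact Hz.
  - intros z Hz. destruct (HL z Hz) as [H1 H2].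
    assert (E : Re (L z) = ln (Cmod (F z))) by (rewrite <- H2, Cmod_Cexp, ln_exp; reflexivity).
    split; [apply cdiff_C_derive; exact H1|]. split; [exact E|].
    rewrite E, <- ln_1. apply ln_le; [lra|]. apply HF1. exact Hz.
Qed.

Lemma log_derive_bound : 0 < R0 ->
  Cmod (C_derive F z0) * R0 <= 2 * (Cmod (F z0) * ln (Cmod (F z0))).
Proof.
  intros HR. destruct log_of_large as [L [HL H]].
  assert (Hc : Cmod (z0 - z0) < R0) by (rewrite Cmod_zero_sub; exact HR).
  destruct (H z0 Hc) as [E1 [E2 _]].
  assert (K := derive_bound_of_re_nonneg L z0 R0 HR HL (fun z Hz => proj2 (proj2 (H z Hz)))).
  assert (Hp : 0 < Cmod (F z0)) by (specialize (HF1 z0 Hc); lra).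
  rewrite E1, E2, Cmod_div in K by (apply Cmod_gt_0; exact Hp).
  apply (Rmult_le_compat_r (Cmod (F z0))) in K; [|lra].
  replace (Cmod (C_derive F z0) / Cmod (F z0) * R0 * Cmod (F z0))
    with (Cmod (C_derive F z0) * R0) in K by (field; lra). lra.
Qed.

Lemma log_harnack (z : C) : Cmod (z - z0) < R0 ->
  ln (Cmod (F z0)) * (R0 - Cmod (z - z0)) <= ln (Cmod (F z)) * (R0 + Cmod (z - z0)).
Proof.
  intros Hz. destruct log_of_large as [L [HL H]].
  assert (Hc : Cmod (z0 - z0) < R0)
    by (rewrite Cmod_zero_sub; generalize (Cmod_ge_0 (z - z0)); lra).
  destruct (H z0 Hc) as [_ [<- _]]. destruct (H z Hz) as [_ [<- _]].
  apply harnack; [exact HL| |exact Hz]. intros w Hw. apply (H w Hw).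
Qed.

End Nonvanishing.

(** * Entire functions with bounded spherical derivative *)

Lemma entire_is_cdiff (f : C -> C) (z : C) : entire f -> cdiff f z (C_derive f z).
Proof. intros H. apply entire_cdiff. exact H. Qed.

Lemma entire_of_cdiff (f df : C -> C) : (forall z, cdiff f z (df z)) -> entire f.
Proof. intros H. apply entire_cdiff. intros z. eapply cdiff_derive. apply H. Qed.

Lemma Cmod_sq (z : C) : Cmod z * Cmod z = Re z * Re z + Im z * Im z.
Proof. assert (E := Cmod2_alt z). rewrite <- !Rsqr_pow2 in E. exact E. Qed.

(** |g'| / (1 + |g|^2) is, up to a constant factor, the speed of g measured on the
    Riemann sphere. *)
Definition spherical_bound (g : C -> C) (Lam N : R) : Prop :=
  forall z, Cmod z < N -> Cmod (C_derive g z) <= Lam * (1 + Cmod (g z) * Cmod (g z)).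

(** The derivative of 1 / (1 + |g|^2) is at most 2 |g| |g'| / (1 + |g|^2)^2, and
    2 |g| <= 1 + |g|^2. *)
Lemma spherical_lipschitz (g : C -> C) (Lam N : R) (z w : C) :
  entire g -> spherical_bound g Lam N -> Cmod z < N -> Cmod w < N ->
  / (1 + Cmod (g z) * Cmod (g z)) - / (1 + Cmod (g w) * Cmod (g w)) <= Lam * Cmod (w - z).
Proof.
  intros Hg Hb Hz Hw.
  set (p := fun t : R => (z + t * (w - z))%C).
  set (a := fun t : R => Re (g (p t))). set (b := fun t : R => Im (g (p t))).
  set (d := fun t : R => (C_derive g (p t) * (w - z))%C).
  assert (Hp : forall t, pdiff (fun t => g (p t)) t (d t)).
  { intros t. apply pdiff_line. apply entire_is_cdiff. exact Hg. }
  set (chi := fun t : R => / (1 + (a t * a t + b t * b t))).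
  set (dchi := fun t : R => - (2 * (a t * Re (d t) + b t * Im (d t))) /
      ((1 + (a t * a t + b t * b t)) * (1 + (a t * a t + b t * b t)))).
  assert (Hchi : forall t, is_derive chi t (dchi t)).
  { intros t. destruct (Hp t) as [H1 H2]. fold a in H1. fold b in H2.
    unfold chi. auto_derive.
    - repeat split; try (eexists; exact H1); try (eexists; exact H2). nra.
    - assert (D1 : Derive (fun x => a x) t = Re (d t)) by exact (is_derive_unique _ _ _ H1).
      assert (D2 : Derive (fun x => b x) t = Im (d t)) by exact (is_derive_unique _ _ _ H2).
      rewrite D1, D2.
      unfold dchi. field. nra. }
  destruct (MVT_gen chi 0 1 dchi) as [c [Hc Hc2]].
  - intros t _. apply Hchi.
  - intros t _. apply continuity_pt_filterlim. apply (ex_derive_continuous chi).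
    eexists. apply Hchi.
  - rewrite Rmin_left, Rmax_right in Hc by lra.
    assert (E0 : / (1 + Cmod (g z) * Cmod (g z)) = chi 0).
    { unfold chi, a, b, p. rewrite Cmod_sq. do 3 f_equal; do 2 f_equal; f_equal; ring. }
    assert (E1 : / (1 + Cmod (g w) * Cmod (g w)) = chi 1).
    { unfold chi, a, b, p. rewrite Cmod_sq. do 3 f_equal; do 2 f_equal; f_equal; ring. }
    rewrite E0, E1.
    assert (Hpc : Cmod (p c) < N).
    { assert (K := segment_in_disc 0 z w N c). unfold Cminus in K.
      rewrite !Copp_0, !Cplus_0_r in K. apply K; assumption. }
    assert (K := Hb (p c) Hpc).
    set (m := Cmod (g (p c))) in *. assert (Hm : 0 <= m) by apply Cmod_ge_0.
    assert (Em : a c * a c + b c * b c = m * m) by (unfold a, b, m; rewrite Cmod_sq; reflexivity).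
    unfold dchi in Hc2. rewrite Em in Hc2.
    assert (K2 : Rabs (a c * Re (d c) + b c * Im (d c)) <= m * Cmod (d c)).
    { replace (a c * Re (d c) + b c * Im (d c)) with (Re (Cconj (g (p c)) * d c))
        by (unfold a, b, Re, Im, Cconj; simpl; ring).
      unfold m. rewrite <- (Cmod_conj (g (p c))), <- Cmod_mult. apply Re_le_Cmod. }
    unfold d in K2. rewrite Cmod_mult in K2. fold (d c) in K2.
    set (x := a c * Re (d c) + b c * Im (d c)) in *.
    assert (Hv := Cmod_ge_0 (w - z)). set (v := Cmod (w - z)) in *.
    set (g' := Cmod (C_derive g (p c))) in *.
    assert (K3 : Rabs x <= m * (Lam * (1 + m * m) * v)).
    { eapply Rle_trans; [exact K2|]. apply Rmult_le_compat_l; [exact Hm|].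
      apply Rmult_le_compat_r; assumption. }
    assert (K4 := Rle_abs x).
    assert (HL : 0 <= Lam).
    { assert (0 <= Lam * (1 + m * m)) by (eapply Rle_trans; [apply Cmod_ge_0|exact K]).
      apply Rnot_lt_le. intro. assert (0 <= m * m) by nra. nra. }
    replace (chi 0 - chi 1) with (2 * x / ((1 + m * m) * (1 + m * m))) by lra.
    apply Rle_div_l; [nra|].
    assert (K5 : 2 * m * (Lam * v * (1 + m * m)) <= (1 + m * m) * (Lam * v * (1 + m * m))).
    { apply Rmult_le_compat_r; [repeat apply Rmult_le_pos; nra|].
      assert (Hsq := Rle_0_sqr (m - 1)). unfold Rsqr in Hsq. lra. }
    lra.
Qed.

Lemma first_failure (P : nat -> Prop) (n : nat) :
  P O -> ~ P n -> exists k, P k /\ ~ P (S k).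
Proof.
  intros H0 Hn. apply NNPP. intros Hc. apply Hn. clear Hn.
  induction n as [|n IH]; [exact H0|].
  apply NNPP. intros Hs. apply Hc. exists n. split; assumption.
Qed.

(** The argument of Clunie and Hayman. Suppose |g z| > 1. A maximal disc about z
    on which |g| > 1 has radius d <= |z|, and up to eps it reaches a point y with
    |g y| <= 1. By the Lipschitz bound |g| <= 2 at the point p of the segment from
    z to y that lies eps inside the disc, and Harnack's inequality for log |g|
    between z and p gives eps log |g z| <= 2 d. *)
Lemma spherical_growth_1 (g : C -> C) (Lam N : R) (z : C) :
  entire g -> 1 <= Lam -> spherical_bound g Lam N -> Cmod (g 0) <= 1 ->
  2 * Cmod z + 1 <= N -> Cmod (g z) <= exp (1 + 16 * Lam * Cmod z).
Proof.
  intros Hg HL Hb H0 HN. assert (Hz := Cmod_ge_0 z).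
  assert (He : 2 <= exp 1) by (generalize (exp_ineq1 1 ltac:(lra)); lra).
  assert (Hee : exp 1 <= exp (1 + 16 * Lam * Cmod z)) by (apply exp_mono; nra).
  destruct (Rle_dec (Cmod (g z)) 1) as [Hle|Hgt]; [lra|].
  (* Moving by 2 eps changes 1 / (1 + |g|^2) by at most 1/4. *)
  set (eps := / (8 * Lam)).
  assert (Heps : 0 < eps) by (apply Rinv_0_lt_compat; lra).
  assert (HepsL : Lam * eps = / 8) by (unfold eps; field; lra).
  assert (Heps1 : eps <= / 8) by nra.
  assert (Hsmall : forall x y, Cmod x < N -> Cmod y < N -> Cmod (g y) <= 1 ->
            Cmod (x - y) <= 2 * eps -> Cmod (g x) <= 2).
  { intros x y Hx Hy Hy1 Hd.
    assert (K := spherical_lipschitz g Lam N y x Hg Hb Hy Hx).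
    assert (Ky := Cmod_ge_0 (g y)). assert (Kx := Cmod_ge_0 (g x)).
    assert (K1 : / 2 <= / (1 + Cmod (g y) * Cmod (g y)))
      by (apply Rinv_le_contravar; nra).
    assert (K2 : / 4 <= / (1 + Cmod (g x) * Cmod (g x))).
    { assert (Lam * Cmod (x - y) <= Lam * (2 * eps)) by (apply Rmult_le_compat_l; lra). lra. }
    apply Rnot_lt_le. intros Hlt.
    assert (/ (1 + Cmod (g x) * Cmod (g x)) < / 4).
    { apply Rinv_lt_contravar; nra. }
    lra. }
  (* The radius is sought among the multiples of eps. *)
  set (adm := fun k : nat => forall x, Cmod (x - z) < INR k * eps -> 1 < Cmod (g x)).
  destruct (INR_unbounded (Cmod z / eps)) as [n Hn].
  assert (Hadm0 : adm O).
  { intros x Hx. simpl in Hx. generalize (Cmod_ge_0 (x - z)). lra. }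
  assert (Hadmn : ~ adm n).
  { intros H. assert (K : 1 < Cmod (g 0)); [|lra].
    apply H. replace (0 - z)%C with (- z)%C by ring. rewrite Cmod_opp.
    apply (Rmult_gt_compat_r eps) in Hn; [|exact Heps].
    unfold Rdiv in Hn. rewrite Rmult_assoc, Rinv_l in Hn by lra. lra. }
  destruct (first_failure adm n Hadm0 Hadmn) as [k [Hk Hkn]].
  assert (Hkz : INR k * eps <= Cmod z).
  { apply Rnot_lt_le. intros Hlt. assert (K : 1 < Cmod (g 0)); [|lra].
    apply Hk. replace (0 - z)%C with (- z)%C by ring. rewrite Cmod_opp. exact Hlt. }
  assert (Hex : exists y, Cmod (y - z) < INR (S k) * eps /\ Cmod (g y) <= 1).
  { apply NNPP. intros Hc. apply Hkn. intros x Hx. apply Rnot_le_lt. intros Hle.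
    apply Hc. exists x. split; assumption. }
  destruct Hex as [y [Hy Hy1]]. rewrite S_INR in Hy.
  assert (HyN : Cmod y < N).
  { assert (Htri := Cmod_le_sub_add y z). lra. }
  assert (Hyz : INR k * eps <= Cmod (y - z)).
  { apply Rnot_lt_le. intros Hlt. specialize (Hk y Hlt). lra. }
  destruct k as [|k].
  { simpl in Hy. assert (Cmod (g z) <= 2); [|lra].
    apply (Hsmall z y); try lra. rewrite Cmod_sub_comm. lra. }
  rewrite S_INR in Hy, Hkz, Hyz. assert (Hk0 := pos_INR k).
  assert (Hk' : forall x, Cmod (x - z) < (INR k + 1) * eps -> 1 < Cmod (g x))
    by (intros x Hx; apply Hk; rewrite S_INR; exact Hx).
  set (r := INR k * eps). set (d := (INR k + 1) * eps) in *.
  assert (Hd : d = r + eps) by (unfold d, r; ring).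
  assert (Hyd : Cmod (y - z) < d + eps) by (unfold d; lra).
  assert (Hr : 0 <= r) by (unfold r; apply Rmult_le_pos; lra).
  set (l := Cmod (y - z)) in *. assert (Hl : 0 < l) by lra.
  assert (Hlc : RtoC l <> 0) by (apply RtoC_neq_0; lra).
  set (p := (z + r / l * (y - z))%C).
  assert (Hpz : Cmod (p - z) = r).
  { unfold p. replace (z + r / l * (y - z) - z)%C with (r / l * (y - z))%C by ring.
    rewrite Cmod_mult, Cmod_div by exact Hlc. rewrite !Cmod_R, !Rabs_pos_eq by lra.
    fold l. field. lra. }
  assert (Hpy : Cmod (p - y) <= 2 * eps).
  { unfold p. replace (z + r / l * (y - z) - y)%C with ((r / l - 1)%R * (y - z))%C
      by (rewrite RtoC_minus, RtoC_div by lra; ring).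
    rewrite Cmod_mult, Cmod_R. fold l.
    rewrite Rabs_left1.
    - replace (- (r / l - 1) * l) with (l - r) by (field; lra). lra.
    - assert (r / l <= 1); [|lra]. apply (Rmult_le_reg_r l); [lra|].
      unfold Rdiv. rewrite Rmult_assoc, Rinv_l by lra. lra. }
  assert (Hp2 : Cmod (g p) <= 2).
  { apply (Hsmall p y); try lra.
    assert (Htri := Cmod_le_sub_add p z). lra. }
  assert (K := log_harnack g z d (entire_holo g z d Hg)
     (fun x Hx => Rlt_le _ _ (Hk' x Hx)) p ltac:(lra)).
  rewrite Hpz in K.
  assert (Hgp : 1 < Cmod (g p)) by (apply Hk'; lra).
  assert (Hlnp : ln (Cmod (g p)) <= 1).
  { rewrite <- (ln_exp 1). apply ln_le; lra. }
  assert (Hlnz : ln (Cmod (g z)) <= 16 * Lam * Cmod z).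
  { replace (d - r) with eps in K by lra.
    assert (K2 : ln (Cmod (g z)) * eps <= 2 * Cmod z).
    { assert (ln (Cmod (g p)) * (d + r) <= 1 * (d + r)) by (apply Rmult_le_compat_r; lra). lra. }
    apply (Rmult_le_reg_r eps); [exact Heps|].
    replace (16 * Lam * Cmod z * eps) with (16 * (Lam * eps) * Cmod z) by ring.
    rewrite HepsL. lra. }
  rewrite <- (exp_ln (Cmod (g z))) by lra. apply exp_mono. lra.
Qed.

(** Dividing g by M multiplies its spherical derivative by at most M. *)
Lemma spherical_growth (g : C -> C) (Lam N M : R) (z : C) :
  entire g -> 1 <= Lam -> spherical_bound g Lam N -> 1 <= M -> Cmod (g 0) <= M ->
  2 * Cmod z + 1 <= N -> Cmod (g z) <= M * exp (1 + 16 * (Lam * M) * Cmod z).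
Proof.
  intros Hg HL Hb HM H0 HN.
  assert (HMc : RtoC M <> 0) by (apply RtoC_neq_0; lra).
  assert (Hmod : forall x, Cmod (/ M * x) = Cmod x / M).
  { intros x. rewrite Cmod_mult, Cmod_inv, Cmod_R, Rabs_pos_eq by (exact HMc || lra).
    unfold Rdiv; ring. }
  assert (Hd : forall x, cdiff (fun x => / M * g x)%C x (/ M * C_derive g x)%C).
  { intros x. apply cdiff_scal. apply entire_is_cdiff. exact Hg. }
  assert (K : Cmod (/ M * g z) <= exp (1 + 16 * (Lam * M) * Cmod z)).
  { apply (spherical_growth_1 (fun x => / M * g x)%C (Lam * M) N z).
    - eapply entire_of_cdiff. exact Hd.
    - nra.
    - intros x Hx. rewrite (cdiff_C_derive _ _ _ (Hd x)), !Hmod.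
      specialize (Hb x Hx). apply Rle_div_l; [lra|].
      eapply Rle_trans; [exact Hb|].
      replace (Lam * M * (1 + Cmod (g x) / M * (Cmod (g x) / M)) * M)
        with (Lam * (M * M + Cmod (g x) * Cmod (g x))) by (field; lra).
      apply Rmult_le_compat_l; nra.
    - rewrite Hmod. apply Rle_div_l; [lra|]. lra.
    - exact HN. }
  rewrite Hmod in K. apply (Rmult_le_compat_r M) in K; [|lra].
  replace (Cmod (g z) / M * M) with (Cmod (g z)) in K by (field; lra). lra.
Qed.

(** If M = |g 0| is huge, then |g' 0| >= M^2 and [log_derive_bound] produce a point y
    with |g y| <= 1 at distance at most 4 log M / M from 0, which is too close for
    [spherical_lipschitz]. *)
Lemma centre_not_huge (g : C -> C) (Lam : R) :
  entire g -> 1 <= Lam -> spherical_bound g Lam 2 ->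
  Cmod (g 0) * Cmod (g 0) <= Cmod (C_derive g 0) ->
  Cmod (g 0) <= (32 * Lam) * (32 * Lam).
Proof.
  intros Hg HL Hb H0. apply Rnot_lt_le. intros Hlt. set (M := Cmod (g 0)) in *.
  set (s := sqrt M).
  assert (Hs2 : s * s = M) by (apply sqrt_sqrt; nra).
  assert (Hs : 32 * Lam < s).
  { apply Rnot_le_lt. intros Hle. assert (0 <= s) by apply sqrt_pos. nra. }
  assert (Hln : ln M <= 2 * s).
  { rewrite <- Hs2, ln_mult by lra.
    assert (K := exp_ineq1_le (ln s)). rewrite exp_ln in K by lra. lra. }
  assert (Hln0 : 0 < ln M) by (rewrite <- ln_1; apply ln_increasing; nra).
  set (r := 4 * ln M / M).
  assert (HrM : r * M = 4 * ln M) by (unfold r; field; nra).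
  assert (Hr0 : 0 < r) by (unfold r; apply Rdiv_lt_0_compat; nra).
  assert (Hrs : r * s <= 8).
  { apply (Rmult_le_reg_r s); [lra|]. rewrite Rmult_assoc, Hs2, HrM. lra. }
  assert (HrL : Lam * r <= / 4) by nra.
  assert (Hex : exists y, Cmod (y - 0) < r /\ Cmod (g y) <= 1).
  { apply NNPP. intros Hc.
    assert (Hadm : forall x, Cmod (x - 0) < r -> 1 <= Cmod (g x)).
    { intros x Hx. apply Rnot_lt_le. intros Hle. apply Hc. exists x. split; [exact Hx|lra]. }
    assert (K := log_derive_bound g 0 r (entire_holo g 0 r Hg) Hadm Hr0). fold M in K.
    assert (K2 : M * M * r <= 2 * (M * ln M)).
    { eapply Rle_trans; [|exact K]. apply Rmult_le_compat_r; lra. }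
    rewrite Rmult_assoc, (Rmult_comm M r), HrM in K2.
    assert (M > 1024) by nra. nra. }
  destruct Hex as [y [Hy Hy1]].
  assert (E : (y - 0)%C = y) by ring. rewrite E in Hy.
  assert (Hr2 : r < 2) by nra.
  assert (K := spherical_lipschitz g Lam 2 y 0 Hg Hb ltac:(lra) ltac:(rewrite Cmod_0; lra)).
  fold M in K. replace (0 - y)%C with (- y)%C in K by ring. rewrite Cmod_opp in K.
  assert (Ky := Cmod_ge_0 (g y)).
  assert (K1 : / 2 <= / (1 + Cmod (g y) * Cmod (g y))) by (apply Rinv_le_contravar; nra).
  assert (HM : 1024 < M) by (rewrite <- Hs2; nra).
  assert (K2 : / (1 + M * M) <= / 8) by (apply Rinv_le_contravar; nra).
  assert (Lam * Cmod y <= Lam * r) by (apply Rmult_le_compat_l; lra). lra.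
Qed.

Lemma ln_nonneg (x : R) : 1 <= x -> 0 <= ln x.
Proof. intros H. rewrite <- ln_1. apply ln_le; lra. Qed.

(** * Zero-free functions of exponential growth *)

Section ZeroFree.

Variables (F : C -> C) (K N : R).
Hypothesis HF : entire F.
Hypothesis HK : 1 <= K.
Hypothesis HN : 1 <= N.
Hypothesis Hnz : forall z, Cmod z < N -> F z <> 0.
Hypothesis Hgr : forall z, Cmod z < N -> Cmod (F z) <= exp (K * (1 + Cmod z)).
Hypothesis HF0 : 1 <= Cmod (F 0).

(** G = exp B / F has modulus at least 1 on the disc of radius N, and log |G 0| <= B.
    Harnack's inequality about z doubles this bound at most, and
    [log_derive_bound] divides it by the radius, which is comparable to N and
    hence to B. *)
Lemma log_derivative_bounded (z : C) : Cmod z < N / 4 ->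
  Cmod (C_derive F z / F z) <= 11 * K.
Proof.
  intros Hz. set (B := K * (1 + N)). assert (Hz0 := Cmod_ge_0 z).
  assert (HeB := exp_pos B).
  assert (HBc : RtoC (exp B) <> 0) by (apply RtoC_neq_0; lra).
  set (G := fun x => (exp B * / F x)%C).
  set (Rr := 3 * N / 4).
  assert (Hin : forall x, Cmod (x - z) < Rr -> Cmod x < N).
  { intros x Hx. assert (Htri := Cmod_le_sub_add x z). unfold Rr in Hx. lra. }
  assert (HGd : forall x, Cmod (x - z) < Rr ->
     cdiff G x (exp B * (- C_derive F x / (F x * F x)))%C).
  { intros x Hx. apply cdiff_scal. apply cdiff_inv; [apply Hnz; auto|].
    apply entire_is_cdiff. exact HF. }
  assert (HGm : forall x, Cmod (x - z) < Rr -> Cmod (G x) = exp B / Cmod (F x)).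
  { intros x Hx. unfold G. rewrite Cmod_mult, Cmod_R, Rabs_pos_eq, Cmod_inv
      by (apply Hnz; auto) || lra. reflexivity. }
  assert (HG : holo G z Rr) by (intros x Hx; eapply cdiff_derive; apply HGd; exact Hx).
  assert (HFp : forall x, Cmod (x - z) < Rr -> 0 < Cmod (F x))
    by (intros x Hx; apply Cmod_gt_0, Hnz; auto).
  assert (HG1 : forall x, Cmod (x - z) < Rr -> 1 <= Cmod (G x)).
  { intros x Hx. rewrite HGm by exact Hx. specialize (HFp x Hx).
    apply (Rmult_le_reg_r (Cmod (F x))); [exact HFp|].
    unfold Rdiv. rewrite Rmult_assoc, Rinv_l, Rmult_1_r, Rmult_1_l by lra.
    eapply Rle_trans; [apply Hgr; auto|]. apply exp_mono. unfold B.
    apply Rmult_le_compat_l; [lra|]. specialize (Hin x Hx). lra. }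
  assert (Hr : Cmod (0 - z) = Cmod z)
    by (replace (0 - z)%C with (- z)%C by ring; apply Cmod_opp).
  assert (H0 : Cmod (0 - z) < Rr) by (rewrite Hr; unfold Rr; lra).
  assert (Hzz : Cmod (z - z) < Rr) by (rewrite Cmod_zero_sub; unfold Rr; lra).
  assert (HlnG0 : ln (Cmod (G 0)) <= B).
  { rewrite HGm by exact H0. rewrite ln_div by lra. rewrite ln_exp.
    assert (0 <= ln (Cmod (F 0))) by (apply ln_nonneg; exact HF0). lra. }
  assert (HlnG00 : 0 <= ln (Cmod (G 0))) by (apply ln_nonneg; auto).
  assert (HlnGz0 : 0 <= ln (Cmod (G z))) by (apply ln_nonneg; auto).
  assert (K1 := log_harnack G z Rr HG HG1 0 H0). rewrite Hr in K1.
  assert (HlnGz : ln (Cmod (G z)) <= 2 * B).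
  { unfold Rr in K1.
    assert (K2 : ln (Cmod (G z)) * (N / 2) <= ln (Cmod (G z)) * (3 * N / 4 - Cmod z))
      by (apply Rmult_le_compat_l; lra).
    assert (K3 : ln (Cmod (G 0)) * (3 * N / 4 + Cmod z) <= B * N)
      by (apply Rmult_le_compat; lra).
    apply (Rmult_le_reg_r (N / 2)); lra. }
  assert (K2 := log_derive_bound G z Rr HG HG1 ltac:(unfold Rr; lra)).
  rewrite (cdiff_C_derive _ _ _ (HGd z Hzz)) in K2.
  assert (HFz := HFp z Hzz).
  replace (exp B * (- C_derive F z / (F z * F z)))%C
    with (- (G z * (C_derive F z / F z)))%C in K2 by (unfold G; field; auto).
  rewrite Cmod_opp, Cmod_mult in K2.
  set (psi := Cmod (C_derive F z / F z)) in *.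
  assert (HGz := HG1 z Hzz).
  assert (K3 : psi * Rr <= 4 * B).
  { apply (Rmult_le_reg_l (Cmod (G z))); [lra|].
    assert (Cmod (G z) * ln (Cmod (G z)) <= Cmod (G z) * (2 * B))
      by (apply Rmult_le_compat_l; lra). lra. }
  unfold Rr, B in K3.
  assert (K4 : K * (1 + N) <= K * (2 * N)) by (apply Rmult_le_compat_l; lra).
  apply (Rmult_le_reg_r (3 * N / 4)); [lra|]. nra.
Qed.

(** Cauchy's estimate for the bounded function F' / F. *)
Lemma log_derivative_nearly_constant (z : C) : Cmod z < N / 8 ->
  Cmod (C_derive F z / F z - C_derive F 0 / F 0) <= 176 * K / N * Cmod z.
Proof.
  intros Hz. assert (Hz0 := Cmod_ge_0 z).
  set (psi := fun x => (C_derive F x / F x)%C).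
  assert (Hpsi : forall x, Cmod x < N -> exists m, cdiff psi x m).
  { intros x Hx. eexists. apply cdiff_div; [apply Hnz; exact Hx| |].
    - apply entire_is_cdiff, entire_derive, HF.
    - apply entire_is_cdiff, HF. }
  assert (E0 : forall x : C, (x - 0)%C = x) by (intros; ring).
  replace (Cmod z) with (Cmod (z - 0)) by (f_equal; ring).
  apply (mean_value_disc psi (C_derive psi) 0 (N / 8)); rewrite ?E0;
    [| |rewrite Cmod_0; lra|exact Hz].
  - intros x Hx. rewrite E0 in Hx. destruct (Hpsi x ltac:(lra)) as [m Hm].
    exact (cdiff_derive _ _ _ Hm).
  - intros x Hx. rewrite E0 in Hx.
    assert (Hin : forall w, Cmod (w - x) < N / 8 -> Cmod w < N / 4).
    { intros w Hw. assert (Htri := Cmod_le_sub_add w x). lra. }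
    assert (Kc : Cmod (C_derive psi x) * (N / 8) <= 2 * (11 * K)).
    { apply cauchy_estimate; [lra| |].
      - intros w Hw. specialize (Hin w Hw). destruct (Hpsi w ltac:(lra)) as [m Hm].
        exact (cdiff_derive _ _ _ Hm).
      - intros w Hw. apply log_derivative_bounded. apply Hin. exact Hw. }
    apply (Rmult_le_reg_r (N / 8)); [lra|]. eapply Rle_trans; [exact Kc|].
    right. field. lra.
Qed.

End ZeroFree.

(** [log_derivative_nearly_constant] with N tending to infinity makes F' / F
    constant. *)
Lemma zero_free_exponential_type (F : C -> C) (K : R) :
  entire F -> (forall z, F z <> 0) -> (forall z, Cmod (F z) <= exp (K * (1 + Cmod z))) ->
  exists a, forall z, F z = (F 0 * Cexp (a * z))%C.
Proof.
  intros HF Hnz Hgr.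
  set (G := fun z => (/ F 0 * F z)%C).
  assert (HGd : forall z, cdiff G z (/ F 0 * C_derive F z)%C).
  { intros z. apply cdiff_scal. apply entire_is_cdiff. exact HF. }
  assert (HG : entire G) by (eapply entire_of_cdiff; exact HGd).
  assert (H0 := proj1 (Cmod_gt_0 _) (Hnz 0)).
  set (K2 := Rabs K + Rabs (ln (/ Cmod (F 0))) + 1).
  assert (HK2 : 1 <= K2)
    by (unfold K2; generalize (Rabs_pos K) (Rabs_pos (ln (/ Cmod (F 0)))); lra).
  assert (HGnz : forall z, G z <> 0).
  { intros z. apply Cmult_neq_0; [|apply Hnz]. apply Cmod_gt_0.
    rewrite Cmod_inv by apply Hnz. apply Rinv_0_lt_compat. exact H0. }
  assert (HGgr : forall z, Cmod (G z) <= exp (K2 * (1 + Cmod z))).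
  { intros z. unfold G. rewrite Cmod_mult, Cmod_inv by apply Hnz.
    rewrite <- (exp_ln (/ Cmod (F 0))) by (apply Rinv_0_lt_compat; exact H0).
    eapply Rle_trans; [apply Rmult_le_compat_l; [left; apply exp_pos|apply Hgr]|].
    rewrite <- exp_plus. apply exp_mono. unfold K2.
    assert (Hz := Cmod_ge_0 z).
    generalize (Rle_abs K) (Rle_abs (ln (/ Cmod (F 0)))) (Rabs_pos (ln (/ Cmod (F 0)))).
    intros. nra. }
  assert (HG0 : 1 <= Cmod (G 0)).
  { unfold G. rewrite Cinv_l by apply Hnz. rewrite Cmod_1. lra. }
  set (a := (C_derive G 0 / G 0)%C).
  assert (Ha : forall z, (C_derive G z / G z)%C = a).
  { intros z. apply Ceq_minus. apply Cmod_eq_0. apply Rle_antisym; [|apply Cmod_ge_0].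
    apply Rnot_lt_le. intros Hp. set (c := Cmod (C_derive G z / G z - a)) in *.
    assert (Hz := Cmod_ge_0 z).
    set (N := Rmax (1 + 8 * (Cmod z + 1)) (1 + 176 * K2 * Cmod z / c)).
    assert (HN1 : 1 + 8 * (Cmod z + 1) <= N) by apply Rmax_l.
    assert (HN2 : 1 + 176 * K2 * Cmod z / c <= N) by apply Rmax_r.
    assert (Kc : c <= 176 * K2 / N * Cmod z).
    { apply (log_derivative_nearly_constant G K2 N HG HK2); try lra; auto. }
    apply (Rmult_le_compat_r (N / c)) in Kc;
      [|left; apply Rdiv_lt_0_compat; lra].
    replace (c * (N / c)) with N in Kc by (field; lra).
    replace (176 * K2 / N * Cmod z * (N / c)) with (176 * K2 * Cmod z / c) in Kc
      by (field; lra). lra. }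
  exists a. intros z.
  assert (E : (G z * Cexp (- (a * z)))%C = (G 0 * Cexp (- (a * 0)))%C).
  { apply (zero_derive_const (fun z => G z * Cexp (- (a * z)))%C 0 (Cmod (z - 0) + 1)); [|lra].
    intros w _. eapply cdiff_eq; [|apply cdiff_mult; [apply entire_is_cdiff; exact HG|
      apply cdiff_Cexp_comp; apply cdiff_opp; apply (cdiff_scal a); apply cdiff_id]].
    cbv beta. rewrite <- (Ha w). field. apply HGnz. }
  rewrite Cexp_opp in E. replace (a * 0)%C with (RtoC 0) in E by ring.
  replace (- 0)%C with (RtoC 0) in E by ring. rewrite Cexp_0 in E.
  unfold G in E. rewrite (Cinv_l (F 0)) in E by apply Hnz.
  assert (He := Cexp_neq_0 (a * z)%C).
  assert (E2 : (/ F 0 * F z * / Cexp (a * z) * (F 0 * Cexp (a * z)))%C = (F 0 * Cexp (a * z))%C).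
  { rewrite E. ring. }
  rewrite <- E2. field. split; [exact He|apply Hnz].
Qed.

(** * Persistence and existence of zeros *)

Lemma cconv_ccont (f : C -> C) (u : nat -> C) (l : C) :
  ccont f l -> cconv u l -> cconv (fun n => f (u n)) (f l).
Proof.
  intros Hf Hu eps Heps. destruct (Hf eps Heps) as [d [Hd Hd2]].
  destruct (Hu d Hd) as [N HN]. exists N. intros n Hn. apply Hd2. apply HN. exact Hn.
Qed.

(** Newton's iteration with the fixed slope a contracts by the factor 1/2 and stays
    within 2 |F z| / |a| of z. *)
Lemma newton_zero (F dF : C -> C) (z a : C) (r : R) :
  a <> 0 -> (forall x, Cmod (x - z) < r -> cdiff F x (dF x)) ->
  (forall x, Cmod (x - z) < r -> Cmod (dF x - a) <= Cmod a / 2) ->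
  4 * Cmod (F z) < Cmod a * r ->
  exists x, Cmod (x - z) < r /\ F x = 0.
Proof.
  intros Ha HF HdF Hz. assert (Ha0 := proj1 (Cmod_gt_0 a) Ha).
  (* The length of the first Newton step. *)
  set (del := Cmod (F z) / Cmod a).
  assert (Hdel : 4 * del < r).
  { apply (Rmult_lt_reg_r (Cmod a)); [exact Ha0|].
    replace (4 * del * Cmod a) with (4 * Cmod (F z)) by (unfold del; field; lra). lra. }
  assert (Hdel0 : 0 <= del).
  { apply Rmult_le_pos; [apply Cmod_ge_0|left; apply Rinv_0_lt_compat; exact Ha0]. }
  set (T := fun x => (x - / a * F x)%C).
  set (x := fix x n := match n with O => z | S n => T (x n) end).
  assert (Hp : forall n, 0 < / 2 ^ n) by (intros; apply Rinv_0_lt_compat, pow_lt; lra).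
  assert (HS : forall n, / 2 ^ S n = / 2 ^ n / 2)
    by (intros; simpl; field; apply pow_nonzero; lra).
  assert (Hind : forall n, Cmod (x n - z) <= 2 * del * (1 - / 2 ^ n) /\
                           Cmod (x (S n) - x n) <= del * / 2 ^ n).
  { induction n as [|n [IH1 IH2]].
    - simpl. rewrite Cmod_zero_sub. split; [lra|].
      unfold T. replace (z - / a * F z - z)%C with (- (/ a * F z))%C by ring.
      rewrite Cmod_opp, Cmod_mult, Cmod_inv by exact Ha. unfold del, Rdiv. lra.
    - assert (K1 : Cmod (x (S n) - z) <= 2 * del * (1 - / 2 ^ S n)).
      { eapply Rle_trans; [apply (Cmod_sub_trans _ (x n))|]. rewrite HS. lra. }
      split; [exact K1|].
      assert (Hin1 : Cmod (x n - z) < r) by (specialize (Hp n); nra).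
      assert (Hin2 : Cmod (x (S n) - z) < r) by (specialize (Hp (S n)); nra).
      change (x (S (S n))) with (T (x (S n))). change (x (S n)) with (T (x n)) at 2.
      eapply Rle_trans; [apply (mean_value_disc T (fun x => 1 - / a * dF x)%C z r (/ 2));
        try assumption|].
      + intros y Hy. apply cdiff_minus; [apply cdiff_id|apply cdiff_scal; apply HF; exact Hy].
      + intros y Hy. replace (1 - / a * dF y)%C with (- (/ a * (dF y - a)))%C
          by (field; exact Ha).
        rewrite Cmod_opp, Cmod_mult, Cmod_inv by exact Ha.
        apply (Rmult_le_reg_l (Cmod a)); [exact Ha0|].
        rewrite <- Rmult_assoc, Rinv_r, Rmult_1_l by lra. specialize (HdF y Hy). lra.
      + rewrite HS. lra. }
  assert (Hb : forall n, Cmod (x n - z) <= 2 * del).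
  { intros n. destruct (Hind n) as [K _]. specialize (Hp n). nra. }
  destruct (bolzano_weierstrass_C x (2 * del + Cmod z)) as [l [phi [Hphi Hl]]].
  { intros n. replace (x n) with ((x n - z) + z)%C by ring.
    eapply Rle_trans; [apply Cmod_triangle|]. specialize (Hb n). lra. }
  assert (Hlz : Cmod (l - z) < r).
  { destruct (Hl (r / 2 - del)) as [N HN]; [lra|].
    specialize (HN N (Nat.le_refl N)). specialize (Hb (phi N)).
    rewrite Cmod_sub_comm in HN.
    generalize (Cmod_sub_trans l (x (phi N)) z). lra. }
  exists l. split; [exact Hlz|]. apply Cmod_eq_0. apply Rle_antisym; [|apply Cmod_ge_0].
  apply Rnot_lt_le. intros Hpos. set (e := Cmod (F l)) in *.
  destruct (cconv_ccont F _ l (cdiff_ccont _ _ _ (HF l Hlz)) Hl (e / 2) ltac:(lra)) as [N1 HN1].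
  destruct (pow_lt_1_zero (/ 2) ltac:(rewrite Rabs_pos_eq; lra) (e / (2 * (del * Cmod a + 1))))
    as [N2 HN2]; [apply Rdiv_lt_0_compat; nra|].
  set (n := phi (N1 + N2)%nat).
  assert (K1 := HN1 (N1 + N2)%nat ltac:(lia)). cbv beta in K1. fold n in K1.
  assert (K2 := HN2 n ltac:(generalize (extraction_le phi Hphi (N1 + N2)); unfold n; lia)).
  rewrite pow_inv, Rabs_pos_eq in K2 by (left; apply Hp).
  destruct (Hind n) as [_ K3]. change (x (S n)) with (T (x n)) in K3.
  unfold T in K3. replace (x n - / a * F (x n) - x n)%C with (- (/ a * F (x n)))%C in K3 by ring.
  rewrite Cmod_opp, Cmod_mult, Cmod_inv in K3 by exact Ha.
  assert (K4 : Cmod (F (x n)) <= del * Cmod a * / 2 ^ n).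
  { apply (Rmult_le_compat_l (Cmod a)) in K3; [|lra].
    rewrite <- Rmult_assoc, Rinv_r, Rmult_1_l in K3 by lra. lra. }
  assert (K5 : / 2 ^ n * (2 * (del * Cmod a + 1)) < e).
  { apply Rlt_div_r in K2; [|nra]. lra. }
  assert (K6 := Cmod_sub_lower (F l) (F (x n))). fold e in K6.
  rewrite Cmod_sub_comm in K1. specialize (Hp n). nra.
Qed.

Lemma ln_sublinear (C1 C2 c : R) : 0 <= C1 -> 0 < c ->
  exists X, 1 <= X /\ forall x, X <= x -> C1 * ln x + C2 < c * x.
Proof.
  intros H1 Hc. set (s0 := 1 + (2 * C1 + Rabs C2 + 1) / c).
  assert (HC2 := Rabs_pos C2). assert (HC2' := Rle_abs C2).
  assert (Hs0c : (s0 - 1) * c = 2 * C1 + Rabs C2 + 1) by (unfold s0; field; lra).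
  assert (Hs0 : 1 <= s0) by nra.
  exists (s0 * s0). split; [nra|]. intros x Hx.
  set (s := sqrt x). assert (Hss : s * s = x) by (apply sqrt_sqrt; nra).
  assert (Hs : s0 <= s).
  { apply Rnot_lt_le. intros Hlt. assert (0 <= s) by apply sqrt_pos. nra. }
  assert (Hln : ln x <= 2 * s).
  { rewrite <- Hss, ln_mult by lra.
    assert (K := exp_ineq1_le (ln s)). rewrite exp_ln in K by lra. lra. }
  assert (K1 : C1 * ln x <= C1 * (2 * s)) by (apply Rmult_le_compat_l; lra).
  assert (K2 : (2 * C1 + Rabs C2 + 1) * s <= c * x).
  { rewrite <- Hss, <- Hs0c. replace (c * (s * s)) with (s * c * s) by ring.
    apply Rmult_le_compat_r; nra. }
  nra.
Qed.

Lemma exp_small_disc (a eta : C) : Cmod (a * eta) <= / 16 -> Cmod (Cexp (a * eta) - 1) <= / 8.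
Proof.
  intros H. assert (H0 := Cmod_ge_0 (a * eta)).
  eapply Rle_trans; [apply Cexp_sub_1|].
  assert (K : exp (Cmod (a * eta)) <= 2).
  { apply Rle_trans with (exp (/ 16)); [apply exp_mono; exact H|].
    assert (K1 := exp_ineq1_le (- / 16)). rewrite exp_Ropp in K1.
    assert (K2 := exp_pos (/ 16)).
    apply (Rmult_le_compat_r (exp (/ 16))) in K1; [|lra]. rewrite Rinv_l in K1 by lra. lra. }
  assert (Cmod (a * eta) * exp (Cmod (a * eta)) <= / 16 * 2); [|lra].
  apply Rmult_le_compat; try lra. left; apply exp_pos.
Qed.

Lemma Cexp_log_bound (w : C) : w <> 0 ->
  exists y, Cexp y = w /\ Cmod y <= Rabs (ln (Cmod w)) + 4.
Proof.
  intros Hw. destruct (Cexp_surj w Hw) as [y [E [Er Ei]]]. exists y. split; [exact E|].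
  rewrite (C_re_im y). eapply Rle_trans; [apply Cmod_triangle|].
  rewrite Cmod_mult, Cmod_Ci, !Cmod_R, Er. generalize PI_4. lra.
Qed.

Lemma large_period (a : C) (X : R) : a <> 0 ->
  exists (k : nat) (T : C), (a * T)%C = (0, 2 * INR k * PI) /\ X < Cmod T.
Proof.
  intros Ha. assert (Ha0 := proj1 (Cmod_gt_0 a) Ha).
  destruct (INR_unbounded (Rabs X * Cmod a)) as [k Hk].
  exists k, ((0%R, (2 * INR k * PI)%R) / a)%C. split; [field; exact Ha|].
  rewrite Cmod_div by exact Ha.
  replace (0, 2 * INR k * PI) with ((2 * INR k * PI)%R * Ci)%C
    by (apply injective_projections; simpl; ring).
  assert (Hp := PI2_1). assert (HX := Rle_abs X). assert (HX0 := Rabs_pos X).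
  assert (Hk0 := pos_INR k).
  rewrite Cmod_mult, Cmod_Ci, Cmod_R, Rabs_pos_eq by nra.
  apply Rlt_div_r; [exact Ha0|].
  assert (X * Cmod a <= Rabs X * Cmod a) by (apply Rmult_le_compat_r; lra). nra.
Qed.

(** Choose T with a T = 2 pi i k, and s with kap exp (a s) = - (c T + d). At T + s the
    function equals c s, which is of size log k, and its derivative
    c - a (c T + d) is of size k, so [newton_zero] finds a zero nearby. *)
Lemma affine_exp_simple_zero (c d kap a : C) (B : R) :
  c <> 0 -> kap <> 0 -> a <> 0 ->
  exists z, (c * z + d + kap * Cexp (a * z))%C = 0 /\
    B < Cmod (c + kap * (a * Cexp (a * z))).
Proof.
  intros Hc Hkap Ha.
  assert (Hc0 := proj1 (Cmod_gt_0 c) Hc). assert (Ha0 := proj1 (Cmod_gt_0 a) Ha).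
  assert (Hk0 := proj1 (Cmod_gt_0 kap) Hkap).
  set (mc := Cmod c) in *. set (ma := Cmod a) in *. set (mk := Cmod kap) in *.
  destruct (ln_sublinear (128 * mc) (128 * mc * 4) (ma * mk)) as [X [HX1 HX]]; [lra|nra|].
  (* For |c T + d| > Q the derivative at T + s dominates B and c, and the logarithm
     that bounds s is small against it. *)
  set (Q := Rabs B * 4 / ma + 2 * mc / ma + X * mk + 1).
  assert (Hinva : 0 < / ma) by (apply Rinv_0_lt_compat; exact Ha0).
  assert (HB0 := Rabs_pos B).
  assert (HQ0 : 0 <= Rabs B * 4 / ma /\ 0 <= 2 * mc / ma).
  { split; apply Rmult_le_pos; lra. }
  destruct (large_period a ((Q + Cmod d) / mc) Ha) as [k [T [HaT HT]]].
  set (q := (c * T + d)%C).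
  assert (Hq : Q < Cmod q).
  { apply Rlt_div_l in HT; [|exact Hc0].
    assert (K3 := Cmod_sub_lower (c * T) (- d)). rewrite Cmod_opp, Cmod_mult in K3.
    fold mc in K3. replace (c * T - - d)%C with q in K3 by (unfold q; ring). lra. }
  set (mq := Cmod q) in *.
  assert (Hq0 : q <> 0) by (apply Cmod_gt_0; fold mq; unfold Q in Hq; nra).
  assert (HXq : X * mk <= mq) by (unfold Q in Hq; lra).
  assert (Hq1 : 2 * mc <= ma * mq).
  { assert (2 * mc / ma <= mq) by (unfold Q in Hq; nra).
    apply (Rmult_le_reg_r (/ ma)); [exact Hinva|].
    replace (ma * mq * / ma) with mq by (field; lra). exact H. }
  assert (Hq2 : 4 * B < ma * mq).
  { assert (Rabs B * 4 / ma < mq) by (unfold Q in Hq; nra).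
    apply Rle_lt_trans with (Rabs B * 4); [generalize (Rle_abs B); lra|].
    apply (Rmult_lt_reg_r (/ ma)); [exact Hinva|].
    replace (ma * mq * / ma) with mq by (field; lra). exact H. }
  destruct (Cexp_log_bound (- q / kap)%C) as [y [Ey Hy]].
  { apply Cmod_gt_0. rewrite Cmod_div, Cmod_opp by exact Hkap.
    fold mq mk. apply Rdiv_lt_0_compat; [|lra]. nra. }
  rewrite Cmod_div, Cmod_opp in Hy by exact Hkap. fold mq mk in Hy.
  assert (HXqk : X <= mq / mk).
  { apply Rle_div_r; [exact Hk0|]. exact HXq. }
  rewrite Rabs_pos_eq in Hy by (apply ln_nonneg; lra).
  assert (Hsmall : 128 * mc * Cmod y < ma * mq).
  { specialize (HX _ HXqk). replace (ma * mk * (mq / mk)) with (ma * mq) in HX by (field; lra).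
    assert (128 * mc * Cmod y <= 128 * mc * (ln (mq / mk) + 4))
      by (apply Rmult_le_compat_l; lra). lra. }
  set (s := (y / a)%C). set (z0 := (T + s)%C).
  assert (Has : (a * s)%C = y) by (unfold s; field; exact Ha).
  set (G := fun z => (c * z + d + kap * Cexp (a * z))%C).
  set (dG := fun z => (c + kap * (a * Cexp (a * z)))%C).
  assert (HG : forall z, cdiff G z (dG z)).
  { intros z. apply cdiff_plus.
    - eapply cdiff_eq; [|apply cdiff_plus; [apply (cdiff_scal c); apply cdiff_id|
        apply cdiff_const]]. ring.
    - apply (cdiff_scal kap). apply cdiff_Cexp_linear. }
  assert (Hexp : forall eta, (kap * Cexp (a * (z0 + eta)))%C = (- q * Cexp (a * eta))%C).
  { intros eta. replace (a * (z0 + eta))%C with (y + (0%R, (2 * INR k * PI)%R) + a * eta)%C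
      by (unfold z0; rewrite <- HaT, <- Has; ring).
    rewrite Cexp_plus, Cexp_period, Ey. field. exact Hkap. }
  set (A := (c - a * q)%C).
  assert (HdG : forall eta, dG (z0 + eta)%C = (A - a * q * (Cexp (a * eta) - 1))%C).
  { intros eta. unfold dG, A.
    replace (kap * (a * Cexp (a * (z0 + eta))))%C with (a * (kap * Cexp (a * (z0 + eta))))%C
      by ring. rewrite Hexp. ring. }
  assert (HA : ma * mq / 2 <= Cmod A).
  { assert (K := Cmod_sub_lower (a * q) c). rewrite Cmod_mult, Cmod_sub_comm in K.
    fold ma mq mc A in K. lra. }
  assert (Hqp : 0 < ma * mq) by nra.
  assert (HA0 : A <> 0) by (apply Cmod_gt_0; lra).
  assert (Hdist : forall x, Cmod (x - z0) < / (16 * ma) -> Cmod (dG x - A) <= ma * mq / 8).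
  { intros x Hx. replace x with (z0 + (x - z0))%C by ring. rewrite HdG.
    set (eta := (x - z0)%C) in *.
    replace (A - a * q * (Cexp (a * eta) - 1) - A)%C
      with (- (a * q * (Cexp (a * eta) - 1)))%C by ring.
    rewrite Cmod_opp, !Cmod_mult. fold ma mq.
    assert (K : Cmod (Cexp (a * eta) - 1) <= / 8).
    { apply exp_small_disc. rewrite Cmod_mult. fold ma.
      apply (Rmult_le_reg_l (/ ma)); [exact Hinva|].
      rewrite <- Rmult_assoc, Rinv_l, Rmult_1_l by lra. rewrite Rinv_mult in Hx. lra. }
    apply (Rmult_le_compat_l (ma * mq)) in K; lra. }
  destruct (newton_zero G dG z0 A (/ (16 * ma)) HA0) as [z [Hz1 Hz2]].
  - intros x _. apply HG.
  - intros x Hx. eapply Rle_trans; [apply Hdist; exact Hx|]. lra.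
  - assert (E : G z0 = (c * s)%C).
    { unfold G. replace (a * z0)%C with (a * (z0 + 0))%C by ring. rewrite Hexp.
      replace (a * 0)%C with (RtoC 0) by ring. rewrite Cexp_0. unfold z0, q. ring. }
    rewrite E, Cmod_mult. unfold s. rewrite Cmod_div by exact Ha. fold mc ma.
    apply (Rmult_lt_reg_r (32 * ma)); [lra|].
    replace (4 * (mc * (Cmod y / ma)) * (32 * ma)) with (128 * mc * Cmod y) by (field; lra).
    replace (Cmod A * / (16 * ma) * (32 * ma)) with (2 * Cmod A) by (field; lra). lra.
  - exists z. split; [exact Hz2|]. change (B < Cmod (dG z)).
    assert (K := Hdist z Hz1). rewrite Cmod_sub_comm in K.
    assert (K2 := Cmod_sub_lower A (A - dG z)).
    replace (A - (A - dG z))%C with (dG z) in K2 by ring. lra.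
Qed.

(** * Polynomials near infinity *)

(** What is needed of a nonzero polynomial near infinity: it lies between 1 and a
    power of |T|, and it is nearly constant on discs about T of radius eps |T|. *)
Definition tame (P : C -> C) : Prop :=
  (exists (m : nat) (R0 : R), 1 <= R0 /\
     forall T, R0 <= Cmod T -> 1 <= Cmod (P T) <= (2 * Cmod T) ^ m) /\
  (forall del, 0 < del -> exists eps R0, 0 < eps /\ forall T z,
     R0 <= Cmod T -> Cmod (z - T) <= eps * Cmod T -> Cmod (P z - P T) <= del * Cmod (P T)).

Lemma tame_1 : tame (fun _ => 1).
Proof.
  split.
  - exists O, 1. split; [lra|]. intros T _. rewrite Cmod_1. simpl. lra.
  - intros del Hdel. exists 1, 0. split; [lra|]. intros T z _ _.
    rewrite Cmod_zero_sub, Cmod_1. lra.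
Qed.

Lemma tame_linear_factor (P : C -> C) (z0 : C) :
  tame P -> tame (fun z => (z - z0) * P z)%C.
Proof.
  intros [[m [R0 [HR0 Hm]]] Hs]. assert (Hz0 := Cmod_ge_0 z0).
  assert (Hfac : forall T, Cmod z0 + 1 <= Cmod T ->
            1 <= Cmod (T - z0) <= 2 * Cmod T).
  { intros T HT. generalize (Cmod_sub_lower T z0) (Cmod_triangle_sub T z0). lra. }
  split.
  - exists (S m), (R0 + Cmod z0 + 1). split; [lra|]. intros T HT.
    destruct (Hm T ltac:(lra)) as [H1 H2]. destruct (Hfac T ltac:(lra)) as [H3 H4].
    rewrite Cmod_mult. simpl pow. split; [nra|]. apply Rmult_le_compat; lra.
  - intros del Hdel.
    set (d1 := Rmin 1 (del / 4)).
    assert (Hd1 : 0 < d1) by (apply Rmin_pos; lra).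
    destruct (Hs d1 Hd1) as [eps [R1 [Heps HP]]].
    exists (Rmin eps (d1 / 2)), (Rmax R1 (2 * Cmod z0 + 2)).
    split; [apply Rmin_pos; lra|]. intros T z HT Hz.
    assert (HT1 : R1 <= Cmod T) by (eapply Rle_trans; [apply Rmax_l|exact HT]).
    assert (HT2 : 2 * Cmod z0 + 2 <= Cmod T) by (eapply Rle_trans; [apply Rmax_r|exact HT]).
    assert (HTp : 0 < Cmod T) by lra.
    assert (Hz1 : Cmod (z - T) <= eps * Cmod T).
    { eapply Rle_trans; [exact Hz|]. apply Rmult_le_compat_r; [lra|apply Rmin_l]. }
    assert (Hz2 : Cmod (z - T) <= d1 / 2 * Cmod T).
    { eapply Rle_trans; [exact Hz|]. apply Rmult_le_compat_r; [lra|apply Rmin_r]. }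
    specialize (HP T z HT1 Hz1).
    assert (HTz : Cmod T / 2 <= Cmod (T - z0)) by (generalize (Cmod_sub_lower T z0); lra).
    assert (HPT := Cmod_ge_0 (P T)).
    assert (HPz : Cmod (P z) <= 2 * Cmod (P T)).
    { assert (K := Cmod_sub_lower (P z) (P T)).
      assert (d1 <= 1) by apply Rmin_l. nra. }
    replace ((z - z0) * P z - (T - z0) * P T)%C
      with ((T - z0) * (P z - P T) + (z - T) * P z)%C by ring.
    eapply Rle_trans; [apply Cmod_triangle|]. rewrite !Cmod_mult.
    assert (Hd4 : d1 <= del / 4) by apply Rmin_r.
    set (A := Cmod (T - z0)) in *. set (p := Cmod (P T)) in *.
    assert (K1 : A * Cmod (P z - P T) <= A * (d1 * p)) by (apply Rmult_le_compat_l; lra).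
    assert (K2 : Cmod (z - T) * Cmod (P z) <= (d1 * A) * (2 * p)).
    { apply Rmult_le_compat; try apply Cmod_ge_0; [|exact HPz]. nra. }
    assert (K3 : 3 * d1 * (A * p) <= del * (A * p)).
    { apply Rmult_le_compat_r; [apply Rmult_le_pos; lra|lra]. }
    lra.
Qed.

(** Choose T with a T = 2 pi i k, and s with kap a P T exp (a s) = b. Since s is only
    of size log k, P is nearly constant around T + s, so the derivative of
    kap P exp (a z) there is close to b exp (a eta) as a function of the
    displacement eta, and [newton_zero] applies to its difference with b. *)
Lemma polynomial_exp_derivative_value (P : C -> C) (kap a b : C) (R0 : R) :
  entire P -> tame P -> kap <> 0 -> a <> 0 -> b <> 0 ->
  exists z, R0 < Cmod z /\ C_derive (fun z => kap * (P z * Cexp (a * z)))%C z = b.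
Proof.
  intros HP [[m [R1 [HR1 Hm]]] Hs] Hkap Ha Hb.
  assert (Ha0 := proj1 (Cmod_gt_0 a) Ha). assert (Hb0 := proj1 (Cmod_gt_0 b) Hb).
  set (ma := Cmod a) in *. set (mb := Cmod b) in *.
  (* 1/600 keeps the correction E below within 1/200 of 1, and E' below 4 |a| / 25. *)
  destruct (Hs (/ 600) ltac:(lra)) as [eps0 [R2 [Heps0 HPs]]].
  set (eps := Rmin eps0 (/ 2)).
  assert (Heps : 0 < eps <= / 2) by (split; [apply Rmin_pos; lra|apply Rmin_r]).
  set (w0 := (b / (kap * a))%C).
  assert (Hw0 : w0 <> 0).
  { apply Cmod_gt_0. unfold w0. rewrite Cmod_div by (apply Cmult_neq_0; assumption).
    apply Rdiv_lt_0_compat; [exact Hb0|]. apply Cmod_gt_0. apply Cmult_neq_0; assumption. }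
  set (W := Rabs (ln (Cmod w0))).
  destruct (ln_sublinear (INR m) (INR m * ln 2 + W + 4 + 2) (eps * ma / 2)) as [X [HX1 HX]];
    [apply pos_INR|nra|].
  set (Tm := R1 + Rabs R2 + 2 * Rabs R0 + X + 1).
  assert (HR2 := Rabs_pos R2). assert (HR2' := Rle_abs R2).
  assert (HR0 := Rabs_pos R0). assert (HR0' := Rle_abs R0).
  destruct (large_period a Tm Ha) as [k [T [HaT HT]]].
  set (mT := Cmod T) in *. unfold Tm in HT.
  destruct (Hm T ltac:(fold mT; lra)) as [HPT1 HPT2]. fold mT in HPT2.
  assert (HPT : P T <> 0) by (apply Cmod_gt_0; lra).
  assert (Hden : (kap * a * P T)%C <> 0) by (repeat apply Cmult_neq_0; assumption).
  destruct (Cexp_log_bound (w0 / P T)%C) as [y [Ey Hy]].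
  { apply Cmod_gt_0. rewrite Cmod_div by exact HPT. apply Rdiv_lt_0_compat; [|lra].
    apply Cmod_gt_0; exact Hw0. }
  assert (Hy2 : Cmod y <= W + INR m * (ln 2 + ln mT) + 4).
  { eapply Rle_trans; [exact Hy|]. rewrite Cmod_div by exact HPT.
    rewrite ln_div by (lra || (apply Cmod_gt_0; exact Hw0)).
    assert (K1 : 0 <= ln (Cmod (P T))) by (apply ln_nonneg; exact HPT1).
    assert (K2 : ln (Cmod (P T)) <= INR m * (ln 2 + ln mT)).
    { rewrite <- ln_mult by lra. rewrite <- ln_pow by lra. apply ln_le; lra. }
    unfold Rminus. eapply Rle_trans; [apply Rplus_le_compat_r, Rabs_triang|].
    rewrite Rabs_Ropp, (Rabs_pos_eq (ln (Cmod (P T)))) by exact K1. unfold W. lra. }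
  set (s := (y / a)%C). set (z0 := (T + s)%C).
  assert (Has : (a * s)%C = y) by (unfold s; field; exact Ha).
  set (r := / (16 * ma)).
  assert (Hr : r * ma = / 16) by (unfold r; field; lra).
  assert (Hr0 : 0 < r) by (unfold r; apply Rinv_0_lt_compat; lra).
  assert (Hnear : Cmod s + 2 * r + / ma <= eps / 2 * mT).
  { specialize (HX mT ltac:(lra)).
    apply (Rmult_le_reg_r ma); [exact Ha0|].
    replace ((Cmod s + 2 * r + / ma) * ma) with (Cmod s * ma + 2 * (r * ma) + 1)
      by (field; lra).
    assert (E : Cmod s * ma = Cmod y).
    { unfold ma. rewrite <- Has, Cmod_mult. ring. }
    rewrite E, Hr. lra. }
  assert (HPnear : forall z, Cmod (z - z0) < 2 * r + / ma ->
    Cmod (P z - P T) <= / 600 * Cmod (P T) /\ R0 < Cmod z).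
  { intros z Hz.
    assert (K : Cmod (z - T) <= eps / 2 * mT).
    { replace (z - T)%C with ((z - z0) + s)%C by (unfold z0; ring).
      eapply Rle_trans; [apply Cmod_triangle|]. lra. }
    split.
    - apply HPs; fold mT; [lra|]. eapply Rle_trans; [exact K|].
      apply Rmult_le_compat_r; [lra|]. assert (eps <= eps0) by apply Rmin_l. lra.
    - assert (K2 := Cmod_sub_lower T (T - z)).
      replace (T - (T - z))%C with z in K2 by ring. rewrite Cmod_sub_comm in K.
      fold mT in K2. nra. }
  set (P' := C_derive P).
  assert (HP' : forall z, Cmod (z - z0) < 2 * r -> Cmod (P' z) <= ma / 300 * Cmod (P T)).
  { intros z Hz.
    assert (HD : forall x, cdiff (fun x => P x - P T)%C x (P' x - 0)).
    { intros x. apply cdiff_minus; [apply entire_is_cdiff; exact HP|apply cdiff_const]. }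
    assert (K : Cmod (C_derive (fun x => P x - P T)%C z) * / ma <= 2 * (/ 600 * Cmod (P T))).
    { apply cauchy_estimate; [apply Rinv_0_lt_compat; lra| |].
      - intros x _. eapply cdiff_derive. apply HD.
      - intros x Hx. apply HPnear.
        eapply Rle_lt_trans; [apply (Cmod_sub_trans x z z0)|]. lra. }
    rewrite (cdiff_C_derive _ _ _ (HD z)) in K.
    replace (P' z - 0)%C with (P' z) in K by ring.
    apply (Rmult_le_reg_r (/ ma)); [apply Rinv_0_lt_compat; lra|].
    eapply Rle_trans; [exact K|]. right. field. lra. }
  set (E := fun z => (P z / P T + P' z / (a * P T))%C).
  set (E' := fun z => (P' z / P T + C_derive P' z / (a * P T))%C).
  assert (HaPT : (a * P T)%C <> 0) by (apply Cmult_neq_0; assumption).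
  assert (HE' : forall z, cdiff E z (E' z)).
  { intros z. unfold E, E', Cdiv.
    assert (K : forall (f : C -> C) (c l : C), cdiff f z l -> cdiff (fun z => f z * c)%C z (l * c)).
    { intros f c l Hf. apply (cdiff_ext (fun z => c * f z)%C); [intros; ring|].
      eapply cdiff_eq; [|apply (cdiff_scal c); exact Hf]. ring. }
    apply cdiff_plus; apply K; apply entire_is_cdiff; [exact HP|].
    apply entire_derive. exact HP. }
  assert (HE1 : forall z, Cmod (z - z0) < 2 * r -> Cmod (E z - 1) <= / 200).
  { intros z Hz. destruct (HPnear z) as [K1 _].
    { generalize (Rinv_0_lt_compat ma Ha0). lra. }
    assert (K2 := HP' z Hz).
    replace (E z - 1)%C with ((P z - P T) / P T + P' z / (a * P T))%C
      by (unfold E; field; split; assumption).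
    eapply Rle_trans; [apply Cmod_triangle|].
    rewrite !Cmod_div, Cmod_mult by assumption. fold ma.
    assert (L1 : Cmod (P z - P T) / Cmod (P T) <= / 600).
    { apply Rle_div_l; [lra|]. exact K1. }
    assert (L2 : Cmod (P' z) / (ma * Cmod (P T)) <= / 300).
    { apply Rle_div_l; [nra|]. lra. }
    lra. }
  assert (HE2 : forall z, Cmod (z - z0) < r -> Cmod (E' z) <= ma * 16 / 100).
  { intros z Hz.
    assert (HD : forall x, cdiff (fun x => E x - 1)%C x (E' x - 0)).
    { intros x. apply cdiff_minus; [apply HE'|apply cdiff_const]. }
    assert (K : Cmod (C_derive (fun x => E x - 1)%C z) * r <= 2 * / 200).
    { apply cauchy_estimate; [exact Hr0| |].
      - intros x _. eapply cdiff_derive. apply HD.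
      - intros x Hx. apply HE1. eapply Rle_lt_trans; [apply (Cmod_sub_trans x z z0)|]. lra. }
    rewrite (cdiff_C_derive _ _ _ (HD z)) in K.
    replace (E' z - 0)%C with (E' z) in K by ring.
    apply (Rmult_le_reg_r r); [exact Hr0|].
    replace (ma * 16 / 100 * r) with (16 * (r * ma) / 100) by field. rewrite Hr. lra. }
  set (h' := fun z => (b * (Cexp (a * (z - z0)) * E z))%C).
  set (h'' := fun z => (b * (a * Cexp (a * (z - z0)) * E z + Cexp (a * (z - z0)) * E' z))%C).
  assert (Hh'' : forall z, cdiff (fun z => h' z - b)%C z (h'' z)).
  { intros z. eapply cdiff_eq; [|apply cdiff_minus; [|apply cdiff_const];
      apply (cdiff_scal b); apply cdiff_mult; [|apply HE'];
      apply cdiff_Cexp_comp; apply (cdiff_scal a); apply cdiff_minus;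
      [apply cdiff_id|apply cdiff_const]].
    unfold h''. cbv beta. ring. }
  assert (Hab : (a * b)%C <> 0) by (apply Cmult_neq_0; assumption).
  destruct (newton_zero (fun z => h' z - b)%C h'' z0 (a * b)%C r Hab) as [z [Hz1 Hz2]].
  - intros x _. apply Hh''.
  - intros x Hx. unfold h''. set (e := Cexp (a * (x - z0))).
    assert (He : Cmod (e - 1) <= / 8).
    { apply exp_small_disc. rewrite Cmod_mult. fold ma. nra. }
    assert (He2 : Cmod e <= 9 / 8).
    { generalize (Cmod_sub_lower e 1). rewrite Cmod_1. lra. }
    assert (K1 := HE1 x ltac:(lra)). assert (K2 := HE2 x Hx).
    replace (b * (a * e * E x + e * E' x) - a * b)%C
      with (b * (a * (e * (E x - 1) + (e - 1)) + e * E' x))%C by ring.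
    rewrite !(Cmod_mult b), (Cmod_mult a b). fold ma mb.
    assert (K3 : Cmod (a * (e * (E x - 1) + (e - 1)) + e * E' x)
       <= ma * (9 / 8 * / 200 + / 8) + 9 / 8 * (ma * 16 / 100)).
    { eapply Rle_trans; [apply Cmod_triangle|]. rewrite !Cmod_mult. fold ma.
      apply Rplus_le_compat.
      - apply Rmult_le_compat_l; [lra|].
        eapply Rle_trans; [apply Cmod_triangle|]. rewrite Cmod_mult.
        apply Rplus_le_compat; [|exact He].
        apply Rmult_le_compat; try apply Cmod_ge_0; assumption.
      - apply Rmult_le_compat; try apply Cmod_ge_0; assumption. }
    apply (Rmult_le_compat_l mb) in K3; [|lra].
    eapply Rle_trans; [exact K3|].
    assert (0 < ma * mb) by (apply Rmult_lt_0_compat; lra). lra.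
  - unfold h'. replace (a * (z0 - z0))%C with (RtoC 0) by ring. rewrite Cexp_0.
    replace (b * (1 * E z0) - b)%C with (b * (E z0 - 1))%C by ring.
    rewrite !Cmod_mult. fold ma mb.
    assert (K1 := HE1 z0 ltac:(rewrite Cmod_zero_sub; lra)).
    replace (ma * mb * r) with (mb * (r * ma)) by ring. rewrite Hr.
    apply (Rmult_le_compat_l mb) in K1; lra.
  - exists z. split; [apply (HPnear z); generalize (Rinv_0_lt_compat ma Ha0); lra|].
    rewrite (cdiff_C_derive _ z (kap * (P' z * Cexp (a * z) + P z * (a * Cexp (a * z))))%C).
    + assert (Ez : Cexp (a * z) = (w0 / P T * Cexp (a * (z - z0)))%C).
      { replace (a * z)%C with (y + (0%R, (2 * INR k * PI)%R) + a * (z - z0))%C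
          by (unfold z0; rewrite <- HaT, <- Has; ring).
        rewrite Cexp_plus, Cexp_period, Ey. reflexivity. }
      rewrite Ez.
      transitivity (h' z); [|replace (h' z) with (h' z - b + b)%C by ring; rewrite Hz2; ring].
      unfold h', E, w0. field. repeat split; assumption.
    + apply (cdiff_scal kap). apply (cdiff_mult P (fun z => Cexp (a * z))%C); [apply entire_is_cdiff; exact HP|].
      apply cdiff_Cexp_linear.
Qed.

(** * Rescaling *)

(** Otherwise every point p with e p >= e z has a neighbour within N / e p at which e
    more than doubles. Passing from neighbour to neighbour, the steps shrink
    geometrically, so the points converge, and e is unbounded near the limit. *)
Lemma point_selection (e : C -> R) (N : R) (z : C) :
  (forall z, exists r K, 0 < r /\ forall w, Cmod (w - z) < r -> e w <= K) ->
  0 < N -> 0 < e z ->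
  exists z', e z <= e z' /\ forall w, Cmod (w - z') * e z' <= N -> e w <= 2 * e z'.
Proof.
  intros Hloc HN Hz. apply NNPP. intros Hc.
  assert (step : forall p, {q | e z <= e p -> Cmod (q - p) * e p <= N /\ 2 * e p < e q}).
  { intros p. apply constructive_indefinite_description. apply NNPP. intros Hq.
    destruct (Rle_dec (e z) (e p)) as [Hp|Hp]; [|apply Hq; exists p; intro; contradiction].
    apply Hc. exists p. split; [exact Hp|]. intros w Hw. apply Rnot_lt_le. intros Hlt.
    apply Hq. exists w. intros _. split; assumption. }
  set (x := fix x n := match n with O => z | S n => proj1_sig (step (x n)) end).
  assert (Hstep : forall n, e z <= e (x n) ->
     Cmod (x (S n) - x n) * e (x n) <= N /\ 2 * e (x n) < e (x (S n)))
    by (intros n; exact (proj2_sig (step (x n)))).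
  assert (Hp2 : forall n, 0 < 2 ^ n) by (intros; apply pow_lt; lra).
  assert (Hgrow : forall n, 2 ^ n * e z <= e (x n)).
  { induction n as [|n IH]; [simpl; lra|].
    assert (Hge : e z <= e (x n)).
    { eapply Rle_trans; [|exact IH]. assert (1 <= 2 ^ n) by (apply pow_R1_Rle; lra). nra. }
    destruct (Hstep n Hge) as [_ H]. simpl pow. lra. }
  assert (Hge : forall n, e z <= e (x n)).
  { intros n. eapply Rle_trans; [|apply Hgrow].
    assert (1 <= 2 ^ n) by (apply pow_R1_Rle; lra). nra. }
  assert (Hdist : forall n, Cmod (x n - z) <= 2 * (N / e z) * (1 - / 2 ^ n)).
  { induction n as [|n IH]; [simpl; rewrite Cmod_zero_sub; lra|].
    eapply Rle_trans; [apply (Cmod_sub_trans _ (x n))|].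
    assert (Hs : Cmod (x (S n) - x n) <= N / e z * / 2 ^ n).
    { destruct (Hstep n (Hge n)) as [H _]. specialize (Hgrow n). specialize (Hp2 n).
      apply (Rmult_le_reg_r (2 ^ n * e z)); [nra|].
      replace (N / e z * / 2 ^ n * (2 ^ n * e z)) with N by (field; lra).
      eapply Rle_trans; [apply Rmult_le_compat_l; [apply Cmod_ge_0|exact Hgrow]|]. exact H. }
    replace (/ 2 ^ S n) with (/ 2 ^ n / 2) by (simpl; field; specialize (Hp2 n); lra).
    lra. }
  assert (HNz : 0 < N / e z) by (apply Rdiv_lt_0_compat; lra).
  destruct (bolzano_weierstrass_C x (2 * (N / e z) + Cmod z)) as [l [phi [Hphi Hl]]].
  { intros n. replace (x n) with ((x n - z) + z)%C by ring.
    eapply Rle_trans; [apply Cmod_triangle|].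
    specialize (Hdist n). assert (0 < / 2 ^ n) by (apply Rinv_0_lt_compat, Hp2). nra. }
  destruct (Hloc l) as [r [K [Hr HK]]]. destruct (Hl r Hr) as [N1 HN1].
  destruct (Pow_x_infinity 2 ltac:(rewrite Rabs_pos_eq; lra) ((Rabs K + 1) / e z)) as [N2 HN2].
  set (n := phi (N1 + N2)%nat).
  assert (K1 := HK _ (HN1 (N1 + N2)%nat ltac:(lia))). cbv beta in K1. fold n in K1.
  assert (K2 := HN2 n ltac:(generalize (extraction_le phi Hphi (N1 + N2)); unfold n; lia)).
  rewrite Rabs_pos_eq in K2 by (left; apply Hp2).
  specialize (Hgrow n).
  assert (K3 : Rabs K + 1 <= 2 ^ n * e z).
  { apply (Rmult_ge_compat_r (e z)) in K2; [|lra].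
    unfold Rdiv in K2. rewrite Rmult_assoc, Rinv_l in K2 by lra. lra. }
  generalize (Rle_abs K). lra.
Qed.

Lemma mean_value_from_0 (f df : C -> C) (R0 M : R) (z : C) :
  (forall x, Cmod x < R0 -> cdiff f x (df x)) ->
  (forall x, Cmod x < R0 -> Cmod (df x) <= M) ->
  Cmod z < R0 -> Cmod (f z - f 0) <= M * Cmod z.
Proof.
  intros Hf HM Hz. assert (E : forall x : C, (x - 0)%C = x) by (intros; ring).
  rewrite <- (E z) at 2. apply (mean_value_disc f df 0 R0).
  - intros x. rewrite E. apply Hf.
  - intros x. rewrite E. apply HM.
  - rewrite E, Cmod_0. eapply Rle_lt_trans; [apply (Cmod_ge_0 z)|exact Hz].
  - rewrite E. exact Hz.
Qed.

Lemma Cexp_mod_le (w : C) (X : R) : Cmod w <= X -> Cmod (Cexp w) <= exp X.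
Proof.
  intros H. rewrite Cmod_Cexp. apply exp_mono. generalize (Re_le_Cmod_pos w). lra.
Qed.


Section Rescaled.

Variables (g : nat -> C -> C) (A B : R) (c : C).
Hypothesis Hc : c <> 0.
Hypothesis HB : 0 <= B.
Hypothesis HAc : Cmod c + 1 <= A.
Hypothesis HAB : 2 * B + 1 <= A.
Hypothesis Hg : forall n, entire (g n).
Hypothesis Hbound : forall n z, Cmod z < INR n ->
  Cmod (C_derive (g n) z) <= A + 4 * (Cmod (g n z) * Cmod (g n z)).
Hypothesis Hcentre : forall n,
  A + Cmod (g n 0) * Cmod (g n 0) <= Cmod (C_derive (g n) 0).
Hypothesis Hzero : forall n z, Cmod z < INR n -> g n z = 0 ->
  Cmod (C_derive (g n) z) <= B.
Hypothesis Homit : forall n z, Cmod z < INR n -> C_derive (g n) z <> c.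

Let Lam := A + 4.
Let M := 32 * Lam * (32 * Lam).
Let F n z := (C_derive (g n) z - c)%C.
Let K := Rabs (ln (Lam + Lam * M * M * exp 2 + A)) + 32 * Lam * M + 1.

Lemma rescaled_constants : 1 <= A /\ 5 <= Lam /\ 1 <= M /\ 1 <= K.
Proof.
  assert (H := Cmod_ge_0 c). assert (HA : 1 <= A) by lra.
  assert (HL : 5 <= Lam) by (unfold Lam; lra).
  assert (HM : 1 <= M) by (unfold M; nra).
  repeat split; try assumption. unfold K.
  generalize (Rabs_pos (ln (Lam + Lam * M * M * exp 2 + A))). nra.
Qed.

Lemma rescaled_spherical n : spherical_bound (g n) Lam (INR n).
Proof.
  intros z Hz. destruct rescaled_constants as [HA _].
  eapply Rle_trans; [apply Hbound; exact Hz|]. unfold Lam.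
  assert (0 <= Cmod (g n z) * Cmod (g n z)) by (apply Rmult_le_pos; apply Cmod_ge_0). nra.
Qed.

Lemma rescaled_centre n : (2 <= n)%nat -> Cmod (g n 0) <= M.
Proof.
  intros Hn. destruct rescaled_constants as [HA [HL _]].
  apply centre_not_huge; [apply Hg|lra| |].
  - intros z Hz. apply rescaled_spherical. eapply Rlt_le_trans; [exact Hz|].
    apply (le_INR 2). exact Hn.
  - specialize (Hcentre n). lra.
Qed.

Lemma shifted_derivative_entire n : entire (F n).
Proof.
  eapply entire_of_cdiff. intros z. apply cdiff_minus; [|apply cdiff_const].
  apply entire_is_cdiff, entire_derive, Hg.
Qed.

Lemma shifted_derivative_growth n z : (2 <= n)%nat -> Cmod z < (INR n - 1) / 2 ->
  Cmod (F n z) <= exp (K * (1 + Cmod z)).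
Proof.
  intros Hn Hz. destruct rescaled_constants as [HA [HL [HM HK]]].
  assert (Hz0 := Cmod_ge_0 z).
  assert (Hgz := spherical_growth (g n) Lam (INR n) M z (Hg n) ltac:(lra)
    (rescaled_spherical n) HM (rescaled_centre n Hn) ltac:(lra)).
  assert (Hd := rescaled_spherical n z ltac:(lra)).
  set (y := Cmod (g n z)) in *. assert (Hy : 0 <= y) by apply Cmod_ge_0.
  set (X := exp (1 + 16 * (Lam * M) * Cmod z)) in *.
  set (Y := exp (32 * Lam * M * Cmod z)).
  assert (HX2 : X * X = exp 2 * Y)
    by (unfold X, Y; rewrite <- !exp_plus; f_equal; ring).
  assert (HY : 1 <= Y).
  { rewrite <- exp_0. apply exp_mono. repeat apply Rmult_le_pos; lra. }
  assert (He2 := exp_pos 2).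
  assert (Hyy : y * y <= M * M * exp 2 * Y).
  { replace (M * M * exp 2 * Y) with ((M * X) * (M * X))
      by (transitivity (M * M * (X * X)); [ring|rewrite HX2; ring]).
    apply Rmult_le_compat; assumption. }
  set (D := Lam + Lam * M * M * exp 2 + A) in *.
  assert (HD : 0 < D).
  { assert (0 < Lam * M * M * exp 2) by (repeat apply Rmult_lt_0_compat; lra). unfold D; lra. }
  assert (HFD : Cmod (F n z) <= D * Y).
  { unfold F. eapply Rle_trans; [apply Cmod_triangle_sub|].
    assert (Lam * (1 + y * y) <= Lam * (1 + M * M * exp 2 * Y))
      by (apply Rmult_le_compat_l; lra).
    unfold D. assert (Cmod c <= A * Y) by (generalize (Cmod_ge_0 c); nra). nra. }
  eapply Rle_trans; [exact HFD|].
  rewrite <- (exp_ln D HD). unfold Y. rewrite <- exp_plus. apply exp_mono.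
  unfold K. fold D. generalize (Rle_abs (ln D)) (Rabs_pos (ln D)). intros H1 H2.
  assert (0 <= 32 * Lam * M) by (repeat apply Rmult_le_pos; lra). nra.
Qed.

Lemma shifted_derivative_centre n : 1 <= Cmod (F n 0).
Proof.
  unfold F. generalize (Cmod_sub_lower (C_derive (g n) 0) c) (Hcentre n).
  generalize (Cmod_ge_0 (g n 0)). intros. nra.
Qed.

Lemma shifted_derivative_nonzero n z : Cmod z < (INR n - 1) / 2 -> F n z <> 0.
Proof.
  intros Hz. assert (Hz0 := Cmod_ge_0 z). unfold F.
  apply Cminus_eq_contra. apply Homit. lra.
Qed.

Let a n := (C_derive (F n) 0 / F n 0)%C.

Lemma centre_log_derivative_bounded n : (4 <= n)%nat -> Cmod (a n) <= 11 * K.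
Proof.
  intros Hn. destruct rescaled_constants as [_ [_ [_ HK]]].
  assert (HnR : 4 <= INR n) by (apply (le_INR 4) in Hn; simpl in Hn; lra).
  apply (log_derivative_bounded (F n) K ((INR n - 1) / 2) (shifted_derivative_entire n) HK ltac:(lra)
    (shifted_derivative_nonzero n) (fun z => shifted_derivative_growth n z ltac:(lia)) (shifted_derivative_centre n) 0).
  rewrite Cmod_0. lra.
Qed.

(** F exp (- a z) has the derivative (F' / F - a) F exp (- a z), whose first factor is
    of order 1 / n by [log_derivative_nearly_constant]. *)
Lemma shifted_derivative_near_exponential (R0 : R) n z : 0 < R0 -> (4 <= n)%nat ->
  R0 < (INR n - 1) / 16 -> Cmod z < R0 ->
  Cmod (F n z - F n 0 * Cexp (a n * z)) <=
    352 * K / (INR n - 1) * (R0 * R0 * exp (K * (1 + R0)) * exp (11 * K * R0) * exp (11 * K * R0)).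
Proof.
  intros HR0 Hn HnR Hz. destruct rescaled_constants as [_ [_ [_ HK]]].
  assert (Hn4 : 4 <= INR n) by (apply (le_INR 4) in Hn; simpl in Hn; lra).
  set (N := (INR n - 1) / 2). assert (HN : R0 < N / 8) by (unfold N; lra).
  assert (HN1 : 1 <= N) by (unfold N; lra).
  assert (Hz0 := Cmod_ge_0 z).
  assert (Ha := centre_log_derivative_bounded n Hn).
  set (U := exp (K * (1 + R0))). set (S0 := exp (11 * K * R0)).
  assert (HU := exp_pos (K * (1 + R0))). fold U in HU.
  assert (HS := exp_pos (11 * K * R0)). fold S0 in HS.
  assert (Hexp : forall w, Cmod w < R0 ->
     Cmod (Cexp (a n * w)) <= S0 /\ Cmod (Cexp (- (a n * w))) <= S0).
  { intros w Hw. assert (Cmod (a n * w) <= 11 * K * R0).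
    { rewrite Cmod_mult. apply Rmult_le_compat; try apply Cmod_ge_0; lra. }
    split; apply Cexp_mod_le; rewrite ?Cmod_opp; assumption. }
  set (u := fun w => (F n w * Cexp (- (a n * w)))%C).
  set (du := fun w => ((C_derive (F n) w / F n w - a n) * F n w * Cexp (- (a n * w)))%C).
  assert (Hdu : forall w, Cmod w < R0 -> cdiff u w (du w)).
  { intros w Hw. eapply cdiff_eq; [|apply cdiff_mult; [apply entire_is_cdiff, shifted_derivative_entire|
      apply (cdiff_ext (fun w => Cexp ((- a n) * w))%C);
      [intros; f_equal; ring|apply cdiff_Cexp_linear]]].
    unfold du. cbv beta. replace (- a n * w)%C with (- (a n * w))%C by ring. field.
    apply shifted_derivative_nonzero. fold N. lra. }
  set (del := 176 * K / N * R0).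
  assert (Hdel : 0 <= del).
  { unfold del. apply Rmult_le_pos; [|lra]. apply Rmult_le_pos; [lra|].
    left; apply Rinv_0_lt_compat; lra. }
  assert (Hdub : forall w, Cmod w < R0 -> Cmod (du w) <= del * U * S0).
  { intros w Hw. unfold du. rewrite !Cmod_mult.
    repeat apply Rmult_le_compat; try apply Cmod_ge_0;
      try (apply Rmult_le_pos; apply Cmod_ge_0).
    - eapply Rle_trans; [apply (log_derivative_nearly_constant (F n) K N (shifted_derivative_entire n) HK
        HN1 (shifted_derivative_nonzero n) (fun z => shifted_derivative_growth n z ltac:(lia)) (shifted_derivative_centre n) w); lra|].
       unfold del. apply Rmult_le_compat_l; [|lra].
        apply Rmult_le_pos; [lra|]. left; apply Rinv_0_lt_compat; lra.
    - eapply Rle_trans; [apply shifted_derivative_growth; [lia|fold N; lra]|]. apply exp_mono.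
      apply Rmult_le_compat_l; lra.
    - apply Hexp. exact Hw. }
  assert (Hu := mean_value_from_0 u du R0 (del * U * S0) z Hdu Hdub Hz).
  replace (F n z - F n 0 * Cexp (a n * z))%C with (Cexp (a n * z) * (u z - u 0))%C.
  2:{ unfold u. replace (- (a n * 0))%C with (RtoC 0) by ring. rewrite Cexp_0, Cexp_opp.
      field. apply Cexp_neq_0. }
  rewrite Cmod_mult.
  apply Rle_trans with (S0 * (del * U * S0 * R0)).
  - apply Rmult_le_compat; try apply Cmod_ge_0; [apply Hexp; exact Hz|].
    eapply Rle_trans; [exact Hu|]. apply Rmult_le_compat_l; [|lra].
    apply Rmult_le_pos; [apply Rmult_le_pos; [exact Hdel|lra]|lra].
  - right. unfold del, N, U, S0. field. lra.
Qed.

(** Along a subsequence the three numbers a n, F n 0 and g n 0 converge, to a0, beta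
    and d, and then g n and its derivative converge on every disc to the function
    G with G 0 = d and G' = c + beta exp (a0 z). A zero z0 of G with |G' z0| > 2 B
    persists in g n with |(g n)'| > B. *)
Lemma no_rescaled_sequence : False.
Proof.
  destruct rescaled_constants as [HA [HL [HM HK]]].
  destruct (bolzano_weierstrass_C (fun n => a (n + 4)%nat) (11 * K)) as [a0 [p1 [Hp1 Ha1]]].
  { intros n. apply centre_log_derivative_bounded. lia. }
  destruct (bolzano_weierstrass_C (fun n => F (p1 n + 4)%nat 0) (exp (K * (1 + Cmod 0))))
    as [beta [p2 [Hp2 Hb2]]].
  { intros n. apply shifted_derivative_growth; [lia|]. rewrite Cmod_0.
    assert (K1 : INR 4 <= INR (p1 n + 4)) by (apply le_INR; lia). simpl in K1. lra. }
  destruct (bolzano_weierstrass_C (fun n => g (p1 (p2 n) + 4)%nat 0) M)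
    as [d [p3 [Hp3 Hd3]]].
  { intros n. apply rescaled_centre. lia. }
  set (j := fun n => (p1 (p2 (p3 n)) + 4)%nat).
  assert (Hj : forall n, (n <= j n)%nat).
  { intros n. unfold j. generalize (extraction_le _ Hp1 (p2 (p3 n)))
      (extraction_le _ Hp2 (p3 n)) (extraction_le _ Hp3 n). lia. }
  assert (Ha : cconv (fun n => a (j n)) a0).
  { exact (cconv_extraction _ _ _ (extraction_comp _ _ Hp2 Hp3) Ha1). }
  assert (Hb : cconv (fun n => F (j n) 0) beta).
  { exact (cconv_extraction _ _ _ Hp3 Hb2). }
  assert (Hd : cconv (fun n => g (j n) 0) d) by exact Hd3.
  clear Ha1 Hb2 Hd3.
  assert (Hbeta : 1 <= Cmod beta).
  { apply Rnot_lt_le. intros Hlt. destruct (Hb (1 - Cmod beta) ltac:(lra)) as [N HN].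
    specialize (HN N (Nat.le_refl N)). cbv beta in HN.
    generalize (shifted_derivative_centre (j N)) (Cmod_sub_lower (F (j N) 0) beta). lra. }
  assert (Hcb : A <= Cmod (c + beta)).
  { apply Rnot_lt_le. intros Hlt. destruct (Hb (A - Cmod (c + beta)) ltac:(lra)) as [N HN].
    specialize (HN N (Nat.le_refl N)). cbv beta in HN.
    generalize (Cmod_sub_lower (C_derive (g (j N)) 0) (c + beta)) (Hcentre (j N)).
    replace (C_derive (g (j N)) 0 - (c + beta))%C with (F (j N) 0 - beta)%C
      by (unfold F; ring).
    generalize (Cmod_ge_0 (g (j N) 0)). intros. nra. }
  assert (Hbeta0 : beta <> 0) by (apply Cmod_gt_0; lra).
  set (dG := fun z => (c + beta * Cexp (a0 * z))%C).
  assert (HG : exists (G : C -> C) (z0 : C), (forall z, cdiff G z (dG z)) /\ G 0 = d /\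
     G z0 = 0 /\ 2 * B < Cmod (dG z0)).
  { (* For a0 = 0 the slope of G is c + beta, at least A > 2 B in modulus. *)
    destruct (Ceq_dec a0 0) as [E|E].
    - assert (EdG : forall z, dG z = (c + beta)%C).
      { intros z. unfold dG. rewrite E, Cmult_0_l, Cexp_0. ring. }
      assert (Hn : (c + beta)%C <> 0) by (apply Cmod_gt_0; lra).
      exists (fun z => d + (c + beta) * z)%C, (- d / (c + beta))%C.
      split; [|split; [|split]].
      + intros z. rewrite EdG. apply cdiff_affine.
      + ring.
      + field. exact Hn.
      + rewrite EdG. lra.
    - assert (Hk : (beta / a0)%C <> 0).
      { apply Cmod_gt_0. rewrite Cmod_div by exact E. apply Rdiv_lt_0_compat; [lra|].
        apply Cmod_gt_0. exact E. }
      destruct (affine_exp_simple_zero c (d - beta / a0) (beta / a0) a0 (2 * B) Hc Hk E)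
        as [z0 [Hz0 Hz1]].
      exists (fun z => c * z + (d - beta / a0) + beta / a0 * Cexp (a0 * z))%C, z0.
      split; [|split; [|split]].
      + intros z. unfold dG. eapply cdiff_eq; [|apply cdiff_plus;
          [apply cdiff_plus; [apply (cdiff_scal c); apply cdiff_id|apply cdiff_const]|
           apply (cdiff_scal (beta / a0)); apply cdiff_Cexp_linear]].
        field. exact E.
      + rewrite !Cmult_0_r, Cexp_0. ring.
      + exact Hz0.
      + unfold dG. replace (c + beta * Cexp (a0 * z0))%C
          with (c + beta / a0 * (a0 * Cexp (a0 * z0)))%C by (field; exact E). exact Hz1. }
  destruct HG as [G [z0 [HG [HG0 [HGz HdGz]]]]].
  set (A0 := dG z0) in *. assert (HA0 : 0 < Cmod A0) by lra.
  assert (HdGc : ccont dG z0).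
  { eapply cdiff_ccont. apply cdiff_plus; [apply cdiff_const|].
    apply cdiff_scal. apply cdiff_Cexp_linear. }
  destruct (HdGc (Cmod A0 / 4) ltac:(lra)) as [r0 [Hr0 Hr0c]].
  set (r := Rmin r0 1). assert (Hr : 0 < r <= 1) by (split; [apply Rmin_pos; lra|apply Rmin_r]).
  set (R0 := Cmod z0 + 2). assert (Hz00 := Cmod_ge_0 z0).
  (* Closeness of g n to G that [newton_zero] requires at z0. *)
  set (eta := Rmin (Cmod A0 / 4) (Cmod A0 * r / (8 * (1 + R0)))).
  assert (Heta : 0 < eta).
  { apply Rmin_pos; [lra|]. apply Rdiv_lt_0_compat; [nra|unfold R0; lra]. }
  assert (Heta1 : eta <= Cmod A0 / 4) by apply Rmin_l.
  assert (Heta2 : eta * (8 * (1 + R0)) <= Cmod A0 * r).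
  { apply Rle_trans with (Cmod A0 * r / (8 * (1 + R0)) * (8 * (1 + R0))).
    - apply Rmult_le_compat_r; [unfold R0; lra|apply Rmin_r].
    - right. field. unfold R0; lra. }
  set (S0 := exp (11 * K * R0)). assert (HS0 := exp_pos (11 * K * R0)). fold S0 in HS0.
  set (V := R0 * R0 * exp (K * (1 + R0)) * S0 * S0).
  assert (HV : 0 < V).
  { unfold V, R0. repeat apply Rmult_lt_0_compat; try apply exp_pos; lra. }
  set (tau := eta / (3 * (S0 + 1))).
  assert (Htau : 0 < tau) by (apply Rdiv_lt_0_compat; lra).
  set (sig := Rmin (/ R0) (eta / (3 * (Cmod beta * S0 * R0 * exp 1)))).
  assert (HR0 : 0 < R0) by (unfold R0; lra).
  assert (He1 := exp_pos 1).
  assert (Hden : 0 < Cmod beta * S0 * R0 * exp 1) by (repeat apply Rmult_lt_0_compat; lra).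
  assert (Hsig : 0 < sig).
  { apply Rmin_pos; [apply Rinv_0_lt_compat; lra|]. apply Rdiv_lt_0_compat; lra. }
  destruct (Ha sig Hsig) as [N1 HN1]. destruct (Hb tau Htau) as [N2 HN2].
  destruct (Hd eta Heta) as [N3 HN3].
  destruct (INR_unbounded (16 * R0 + 1 + 3 * (352 * K) * V / eta)) as [N4 HN4].
  set (n := (N1 + N2 + N3 + N4)%nat). set (k := j n).
  specialize (HN1 n ltac:(unfold n; lia)). specialize (HN2 n ltac:(unfold n; lia)).
  specialize (HN3 n ltac:(unfold n; lia)). cbv beta in HN1, HN2, HN3.
  fold k in HN1, HN2, HN3.
  assert (Hk4 : (4 <= k)%nat) by (unfold k, j; lia).
  assert (HkN : INR N4 <= INR k).
  { apply le_INR. generalize (Hj n). unfold k, n. lia. }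
  assert (HVe : 0 <= 3 * (352 * K) * V / eta).
  { left. apply Rdiv_lt_0_compat; [|exact Heta]. apply Rmult_lt_0_compat; [lra|exact HV]. }
  assert (Hclose : forall x, Cmod x < R0 -> Cmod (C_derive (g k) x - dG x) <= eta).
  { intros x Hx. assert (Hx0 := Cmod_ge_0 x).
    assert (T1 := shifted_derivative_near_exponential R0 k x HR0 Hk4 ltac:(lra) Hx). fold S0 V in T1.
    assert (T1' : 352 * K / (INR k - 1) * V <= eta / 3).
    { apply (Rmult_le_reg_r (3 * (INR k - 1) / eta)).
      - apply Rdiv_lt_0_compat; lra.
      - replace (352 * K / (INR k - 1) * V * (3 * (INR k - 1) / eta))
          with (3 * (352 * K) * V / eta) by (field; lra).
        replace (eta / 3 * (3 * (INR k - 1) / eta)) with (INR k - 1) by (field; lra). lra. }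
    assert (Hak := centre_log_derivative_bounded k Hk4).
    assert (HS : Cmod (Cexp (a k * x)) <= S0).
    { apply Cexp_mod_le. rewrite Cmod_mult. apply Rmult_le_compat; try apply Cmod_ge_0; lra. }
    assert (T2 : Cmod ((F k 0 - beta) * Cexp (a k * x)) <= eta / 3).
    { rewrite Cmod_mult. apply Rle_trans with (tau * (S0 + 1)).
      - apply Rmult_le_compat; try apply Cmod_ge_0; lra.
      - right. unfold tau. field. lra. }
    assert (T3 : Cmod (beta * Cexp (a k * x) * (Cexp ((a0 - a k) * x) - 1)) <= eta / 3).
    { rewrite !Cmod_mult.
      assert (L1 : Cmod ((a0 - a k) * x) <= sig * R0).
      { rewrite Cmod_mult, Cmod_sub_comm. apply Rmult_le_compat; try apply Cmod_ge_0; lra. }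
      assert (L2 : sig * R0 <= 1).
      { apply Rle_trans with (/ R0 * R0); [apply Rmult_le_compat_r; [lra|apply Rmin_l]|].
        rewrite Rinv_l; lra. }
      assert (L3 : Cmod (Cexp ((a0 - a k) * x) - 1) <= sig * R0 * exp 1).
      { eapply Rle_trans; [apply Cexp_sub_1|].
        apply Rmult_le_compat; [apply Cmod_ge_0|left; apply exp_pos|exact L1|].
        apply exp_mono. lra. }
      apply Rle_trans with (Cmod beta * S0 * (sig * R0 * exp 1)).
      - apply Rmult_le_compat; try apply Cmod_ge_0; [|  |exact L3].
        + apply Rmult_le_pos; apply Cmod_ge_0.
        + apply Rmult_le_compat_l; [apply Cmod_ge_0|exact HS].
      - apply Rle_trans with (eta / (3 * (Cmod beta * S0 * R0 * exp 1))
                               * (Cmod beta * S0 * R0 * exp 1)).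
        + replace (Cmod beta * S0 * (sig * R0 * exp 1))
            with (sig * (Cmod beta * S0 * R0 * exp 1)) by ring.
          apply Rmult_le_compat_r; [lra|apply Rmin_r].
        + right. field. lra. }
    replace (C_derive (g k) x - dG x)%C with
      ((F k x - F k 0 * Cexp (a k * x)) + (F k 0 - beta) * Cexp (a k * x)
       - beta * Cexp (a k * x) * (Cexp ((a0 - a k) * x) - 1))%C.
    2:{ unfold dG. replace (Cexp (a0 * x)) with (Cexp (a k * x) * Cexp ((a0 - a k) * x))%C
          by (rewrite <- Cexp_plus; f_equal; ring). unfold F. ring. }
    eapply Rle_trans; [apply Cmod_triangle_sub|].
    eapply Rle_trans; [apply Rplus_le_compat_r, Cmod_triangle|]. lra. }
  assert (Hgz0 : Cmod (g k z0) <= eta * (1 + R0)).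
  { assert (T := mean_value_from_0 (fun x => g k x - G x)%C (fun x => C_derive (g k) x - dG x)%C
      R0 eta z0).
    cbv beta in T. rewrite HGz, HG0 in T.
    assert (T1 : Cmod (g k z0 - 0 - (g k 0 - d)) <= eta * Cmod z0).
    { apply T; [|exact Hclose|unfold R0; lra].
      intros x _. apply cdiff_minus; [apply entire_is_cdiff, Hg|apply HG]. }
    replace (g k z0) with ((g k z0 - 0 - (g k 0 - d)) + (g k 0 - d))%C by ring.
    eapply Rle_trans; [apply Cmod_triangle|].
    assert (eta * Cmod z0 <= eta * R0) by (apply Rmult_le_compat_l; unfold R0; lra). lra. }
  assert (Hin : forall x, Cmod (x - z0) < r -> Cmod x < R0).
  { intros x Hx. assert (Htri := Cmod_le_sub_add x z0). unfold R0; lra. }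
  assert (HdGx : forall x, Cmod (x - z0) < r -> Cmod (C_derive (g k) x - A0) <= Cmod A0 / 2).
  { intros x Hx. eapply Rle_trans; [apply (Cmod_sub_trans _ (dG x))|].
    assert (T1 := Hclose x (Hin x Hx)).
    assert (T2 := Hr0c x (Rlt_Rmin_l _ _ _ Hx)).
    fold A0 in T2. lra. }
  destruct (newton_zero (g k) (C_derive (g k)) z0 A0 r) as [x [Hx1 Hx2]].
  - apply Cmod_gt_0; exact HA0.
  - intros x _. apply entire_is_cdiff, Hg.
  - exact HdGx.
  - apply Rle_lt_trans with (4 * (eta * (1 + R0))); [lra|].
    assert (0 < eta * (1 + R0)) by (apply Rmult_lt_0_compat; lra). lra.
  - assert (T1 := Hzero k x ltac:(specialize (Hin x Hx1); lra) Hx2).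
    assert (T2 := HdGx x Hx1). rewrite Cmod_sub_comm in T2.
    assert (T3 := Cmod_sub_lower A0 (A0 - C_derive (g k) x)).
    replace (A0 - (A0 - C_derive (g k) x))%C with (C_derive (g k) x) in T3 by ring. lra.
Qed.

End Rescaled.

Section SphericalDerivative.

Variables (h : C -> C) (c : C) (B R0 : R).
Hypothesis Hh : entire h.
Hypothesis Hc : c <> 0.
Hypothesis Hzero : forall z, R0 < Cmod z -> h z = 0 -> Cmod (C_derive h z) <= B.
Hypothesis Homit : forall z, R0 < Cmod z -> C_derive h z <> c.

(** Either e = sqrt (max 0 (|h'| - A)) / |h| is bounded, which is the claim, or
    rescaling at points picked by [point_selection] gives the sequence excluded by
    [no_rescaled_sequence]. Since |h'| < A at the zeros of h, the numerator of e
    vanishes near them, and e is locally bounded. *)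
Lemma spherical_derivative_bounded :
  exists Lam, 1 <= Lam /\ forall z, Cmod (C_derive h z) <= Lam * (1 + Cmod (h z) * Cmod (h z)).
Proof.
  assert (Hh' := entire_derive h Hh).
  destruct (holo_bounded (C_derive h) 0 (R0 + 2) (R0 + 1) (entire_holo _ _ _ Hh') ltac:(lra))
    as [B0 [HB0 HB0b]].
  set (B1 := Rmax B 0).
  assert (HB1 : 0 <= B1) by apply Rmax_r. assert (HBB1 : B <= B1) by apply Rmax_l.
  assert (Hc0 := Cmod_ge_0 c).
  set (A := 2 * B1 + Cmod c + B0 + 1).
  assert (HA : 1 <= A) by (unfold A; lra).
  assert (Hzero' : forall z, h z = 0 -> Cmod (C_derive h z) < A).
  { intros z Hz. destruct (Rle_dec (Cmod z) R0) as [H|H].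
    - assert (K : Cmod (C_derive h z) <= B0)
        by (apply HB0b; replace (z - 0)%C with z by ring; lra). unfold A; lra.
    - assert (K := Hzero z ltac:(lra) Hz). unfold A; lra. }
  set (m := fun z => Rmax 0 (Cmod (C_derive h z) - A)).
  assert (Hm : forall z, 0 <= m z) by (intros; apply Rmax_l).
  assert (Hm2 : forall z, Cmod (C_derive h z) <= A + m z).
  { intros z. assert (Cmod (C_derive h z) - A <= m z) by apply Rmax_r. lra. }
  set (e := fun z => sqrt (m z) / Cmod (h z)).
  assert (Hez : forall z, h z = 0 -> m z = 0 /\ e z = 0).
  { intros z Hz. assert (E : m z = 0).
    { unfold m. apply Rmax_left. specialize (Hzero' z Hz). lra. }
    split; [exact E|]. unfold e. rewrite E, sqrt_0. unfold Rdiv. ring. }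
  assert (He0 : forall z, 0 <= e z).
  { intros z. destruct (Ceq_dec (h z) 0) as [E|E].
    - destruct (Hez z E) as [_ ->]. lra.
    - apply Rmult_le_pos; [apply sqrt_pos|]. left. apply Rinv_0_lt_compat.
      apply Cmod_gt_0. exact E. }
  assert (Hem : forall z, m z = (e z * Cmod (h z)) * (e z * Cmod (h z))).
  { intros z. destruct (Ceq_dec (h z) 0) as [E|E].
    - destruct (Hez z E) as [-> ->]. ring.
    - unfold e. apply Cmod_gt_0 in E.
      replace (sqrt (m z) / Cmod (h z) * Cmod (h z)) with (sqrt (m z)) by (field; lra).
      symmetry. apply sqrt_sqrt. apply Hm. }
  assert (Hloc : forall z, exists r K, 0 < r /\ forall w, Cmod (w - z) < r -> e w <= K).
  { intros z. assert (Hcd := cdiff_ccont _ _ _ (entire_is_cdiff _ z Hh')).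
    destruct (Ceq_dec (h z) 0) as [E|E].
    - destruct (Hcd (A - Cmod (C_derive h z))) as [r [Hr Hr2]];
        [specialize (Hzero' z E); lra|].
      exists r, 0. split; [exact Hr|]. intros w Hw. specialize (Hr2 w Hw).
      assert (Em : m w = 0).
      { unfold m. apply Rmax_left. generalize (Cmod_sub_lower (C_derive h w) (C_derive h z)). lra. }
      unfold e. rewrite Em, sqrt_0. unfold Rdiv. lra.
    - apply Cmod_gt_0 in E.
      destruct (ccont_locally_bounded _ z Hcd) as [r1 [K [Hr1 HK]]].
      destruct (cdiff_ccont _ _ _ (entire_is_cdiff _ z Hh) (Cmod (h z) / 2) ltac:(lra))
        as [r2 [Hr2 Hr2b]].
      exists (Rmin r1 r2), (sqrt (Rmax 0 K) * / (Cmod (h z) / 2)).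
      split; [apply Rmin_pos; assumption|]. intros w Hw.
      assert (H1 := HK w (Rlt_Rmin_l _ _ _ Hw)).
      assert (H2 := Hr2b w (Rlt_Rmin_r _ _ _ Hw)).
      rewrite Cmod_sub_comm in H2. assert (H3 := Cmod_sub_lower (h z) (h w)).
      unfold e, Rdiv at 1. apply Rmult_le_compat.
      + apply sqrt_pos.
      + left. apply Rinv_0_lt_compat. lra.
      + apply sqrt_le_1_alt. unfold m. apply Rle_max_compat_l. lra.
      + apply Rinv_le_contravar; lra. }
  destruct (classic (exists Ke, forall z, e z <= Ke)) as [[Ke HKe]|Hunb].
  { exists (A + Ke * Ke). split; [nra|]. intros z.
    assert (HKe0 : 0 <= Ke) by (eapply Rle_trans; [apply (He0 z)|apply HKe]).
    assert (Hhz := Cmod_ge_0 (h z)). set (y := Cmod (h z)) in *.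
    assert (K : m z <= Ke * Ke * (y * y)).
    { rewrite Hem. fold y. specialize (HKe z). specialize (He0 z).
      replace (Ke * Ke * (y * y)) with ((Ke * y) * (Ke * y)) by ring.
      assert (e z * y <= Ke * y) by (apply Rmult_le_compat_r; assumption).
      assert (0 <= e z * y) by (apply Rmult_le_pos; assumption).
      apply Rmult_le_compat; assumption. }
    specialize (Hm2 z). assert (0 <= y * y) by nra. assert (0 <= Ke * Ke) by nra. nra. }
  exfalso.
  destruct (locally_bounded_on_disc e Hloc (Rabs R0 + 1)) as [K1 HK1].
  assert (Hseq : forall n : nat, {g : C -> C | entire g /\
     (forall z, Cmod z < INR n ->
        Cmod (C_derive g z) <= A + 4 * (Cmod (g z) * Cmod (g z))) /\
     A + Cmod (g 0) * Cmod (g 0) <= Cmod (C_derive g 0) /\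
     (forall z, Cmod z < INR n -> g z = 0 -> Cmod (C_derive g z) <= B1) /\
     (forall z, Cmod z < INR n -> C_derive g z <> c)}).
  { intros n. apply constructive_indefinite_description.
    assert (Hn := pos_INR n).
    (* Where e exceeds K2, the point lies outside the disc of radius |R0| + 1, and
       the rescaled disc of radius n has radius at most 1. *)
    set (K2 := Rabs K1 + INR n + 1).
    assert (HK2 : 0 < K2) by (unfold K2; generalize (Rabs_pos K1); lra).
    assert (Hz : exists z, K2 < e z).
    { apply NNPP. intros Hcn. apply Hunb. exists K2. intros z. apply Rnot_lt_le.
      intros Hlt. apply Hcn. exists z. exact Hlt. }
    destruct Hz as [z Hz].
    destruct (point_selection e (INR n + 1) z Hloc ltac:(lra) ltac:(lra)) as [p [Hp1 Hp2]].
    set (E := e p) in *. assert (HE : K2 < E) by lra.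
    assert (HEc : RtoC E <> 0) by (apply RtoC_neq_0; lra).
    assert (Hpfar : Rabs R0 + 1 < Cmod p).
    { apply Rnot_le_lt. intros Hle. specialize (HK1 p Hle). fold E in HK1.
      unfold K2 in HE. generalize (Rle_abs K1). lra. }
    set (q := fun x => (p + / E * x)%C).
    assert (Hq : forall x, Cmod (q x - p) * E = Cmod x).
    { intros x. unfold q. replace (p + / E * x - p)%C with (/ E * x)%C by ring.
      rewrite Cmod_mult, Cmod_inv, Cmod_R, Rabs_pos_eq by (exact HEc || lra). field. lra. }
    assert (Hqfar : forall x, Cmod x < INR n -> R0 < Cmod (q x)).
    { intros x Hx. assert (L := Hq x).
      assert (L2 : Cmod (q x - p) <= 1).
      { apply (Rmult_le_reg_r E); [lra|]. rewrite L.
        unfold K2 in HE. generalize (Rabs_pos K1). lra. }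
      assert (L3 := Cmod_sub_lower p (p - q x)).
      replace (p - (p - q x))%C with (q x) in L3 by ring.
      rewrite Cmod_sub_comm in L2. generalize (Rle_abs R0). lra. }
    set (g := fun x => (E * h (q x))%C).
    assert (Hg : forall x, cdiff g x (C_derive h (q x))).
    { intros x. eapply cdiff_eq; [|apply (cdiff_scal E); apply (cdiff_comp h q);
        [apply entire_is_cdiff; exact Hh|apply cdiff_affine]].
      field. exact HEc. }
    assert (Hg' : forall x, C_derive g x = C_derive h (q x))
      by (intros; apply cdiff_C_derive; apply Hg).
    assert (Hgm : forall x, Cmod (g x) = E * Cmod (h (q x))).
    { intros x. unfold g. rewrite Cmod_mult, Cmod_R, Rabs_pos_eq by lra. reflexivity. }
    exists g. split; [eapply entire_of_cdiff; exact Hg|]. split; [|split; [|split]].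
    - intros x Hx. rewrite Hg', Hgm. eapply Rle_trans; [apply Hm2|].
      apply Rplus_le_compat_l. rewrite Hem.
      assert (L := Hp2 (q x) ltac:(rewrite Hq; lra)). specialize (He0 (q x)).
      assert (Hhq := Cmod_ge_0 (h (q x))).
      replace (4 * (E * Cmod (h (q x)) * (E * Cmod (h (q x)))))
        with ((2 * E * Cmod (h (q x))) * (2 * E * Cmod (h (q x)))) by ring.
      assert (e (q x) * Cmod (h (q x)) <= 2 * E * Cmod (h (q x)))
        by (apply Rmult_le_compat_r; assumption).
      assert (0 <= e (q x) * Cmod (h (q x))) by (apply Rmult_le_pos; assumption).
      apply Rmult_le_compat; assumption.
    - assert (Eq0 : q 0 = p) by (unfold q; ring).
      rewrite Hg', Hgm, Eq0. unfold E at 1 2. rewrite <- Hem.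
      assert (Hmp : m p <> 0).
      { intros E0. assert (L : e p = 0) by (unfold e; rewrite E0, sqrt_0; unfold Rdiv; ring).
        fold E in L. lra. }
      unfold m in *. destruct (Rle_dec (Cmod (C_derive h p) - A) 0) as [L|L].
      + exfalso. apply Hmp. apply Rmax_left. exact L.
      + rewrite Rmax_right by lra. lra.
    - intros x Hx Hgx. rewrite Hg'. eapply Rle_trans; [apply Hzero|exact HBB1].
      + apply Hqfar; exact Hx.
      + apply Cmod_eq_0. assert (L : Cmod (g x) = 0) by (rewrite Hgx; apply Cmod_0).
        rewrite Hgm in L. destruct (Rmult_integral _ _ L) as [L1|L1]; [lra|exact L1].
    - intros x Hx. rewrite Hg'. apply Homit. apply Hqfar. exact Hx. }
  apply (no_rescaled_sequence (fun n => proj1_sig (Hseq n)) A B1 c Hc HB1);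
    try (unfold A; lra).
  - intros n. apply (proj2_sig (Hseq n)).
  - intros n. apply (proj2_sig (Hseq n)).
  - intros n. apply (proj2_sig (Hseq n)).
  - intros n. apply (proj2_sig (Hseq n)).
  - intros n. apply (proj2_sig (Hseq n)).
Qed.

End SphericalDerivative.

(** * Functions of exponential type *)

Definition exponential_type (h : C -> C) : Prop :=
  exists K, 0 <= K /\ forall z, Cmod (h z) <= exp (K * (1 + Cmod z)).

Lemma exponential_type_of_bound (h : C -> C) (D K : R) :
  0 < D -> 0 <= K -> (forall z, Cmod (h z) <= D * exp (K * (1 + Cmod z))) ->
  exponential_type h.
Proof.
  intros HD HK H. exists (Rabs (ln D) + K). assert (H0 := Rabs_pos (ln D)).
  split; [lra|]. intros z. assert (Hz := Cmod_ge_0 z).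
  eapply Rle_trans; [apply H|]. rewrite <- (exp_ln D HD) at 1. rewrite <- exp_plus.
  apply exp_mono. generalize (Rle_abs (ln D)). intros. nra.
Qed.

Lemma spherical_exponential_type (h : C -> C) (Lam : R) :
  entire h -> 1 <= Lam ->
  (forall z, Cmod (C_derive h z) <= Lam * (1 + Cmod (h z) * Cmod (h z))) ->
  exponential_type h.
Proof.
  intros Hh HL Hb. set (M := Rmax 1 (Cmod (h 0))).
  assert (HM : 1 <= M) by apply Rmax_l.
  apply (exponential_type_of_bound h M (1 + 16 * (Lam * M))); [lra|nra|].
  intros z. assert (Hz := Cmod_ge_0 z).
  eapply Rle_trans; [apply (spherical_growth h Lam (2 * Cmod z + 1) M z); try assumption|].
  - intros w _. apply Hb.
  - apply Rmax_r.
  - lra.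
  - apply Rmult_le_compat_l; [lra|]. apply exp_mono. assert (0 <= Lam * M) by nra. nra.
Qed.

Lemma derive_exponential_type (h : C -> C) (c : C) :
  entire h -> exponential_type h -> exponential_type (fun z => C_derive h z - c)%C.
Proof.
  intros Hh [K [HK HKb]]. assert (Hc := Cmod_ge_0 c).
  assert (HE := exp_pos K).
  apply (exponential_type_of_bound _ (2 * exp K + Cmod c) K); [lra|exact HK|].
  intros z. assert (Hz := Cmod_ge_0 z).
  assert (K1 : Cmod (C_derive h z) * 1 <= 2 * exp (K * (1 + Cmod z) + K)).
  { apply cauchy_estimate; [lra|apply entire_holo; exact Hh|]. intros w Hw.
    eapply Rle_trans; [apply HKb|]. apply exp_mono.
    assert (Cmod w <= Cmod z + 1).
    { assert (Htri := Cmod_le_sub_add w z). lra. }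
    nra. }
  rewrite exp_plus in K1.
  assert (K2 : 1 <= exp (K * (1 + Cmod z))).
  { assert (K3 := exp_ineq1_le (K * (1 + Cmod z))).
    assert (0 <= K * (1 + Cmod z)) by (apply Rmult_le_pos; lra). lra. }
  assert (K3 : Cmod c * 1 <= Cmod c * exp (K * (1 + Cmod z)))
    by (apply Rmult_le_compat_l; assumption).
  eapply Rle_trans; [apply Cmod_triangle_sub|]. lra.
Qed.

Lemma equal_of_equal_derivative (f g df : C -> C) :
  (forall z, cdiff f z (df z)) -> (forall z, cdiff g z (df z)) -> f 0 = g 0 ->
  forall z, f z = g z.
Proof.
  intros Hf Hg H0 z. apply Ceq_minus.
  rewrite (zero_derive_const (fun z => f z - g z)%C 0 (Cmod (z - 0) + 1)); [|intros w _|lra].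
  - rewrite H0. ring.
  - eapply cdiff_eq; [|apply cdiff_minus; [apply Hf|apply Hg]]. ring.
Qed.

(** If h' omits c, then h' = c + beta exp (a z). For a <> 0 the function h has a zero
    with |h'| > |b|. For a = 0 it is affine with a zero, so its slope is b, and
    then h' = b everywhere makes h vanish everywhere. *)
Lemma derivative_surjective_off_0 (h : C -> C) (b c : C) :
  entire h -> (forall z, h z = 0 -> C_derive h z = b \/ C_derive h z = 0) ->
  (forall z, C_derive h z = b -> h z = 0) -> (exists z, h z <> h 0) -> c <> 0 ->
  exists z, C_derive h z = c.
Proof.
  intros Hh Hzero Hb [z1 Hz1] Hc. apply NNPP. intros Hn.
  assert (Homit : forall z, C_derive h z <> c) by (intros z E; apply Hn; exists z; exact E).
  assert (HzB : forall z, h z = 0 -> Cmod (C_derive h z) <= Cmod b).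
  { intros z Hz. destruct (Hzero z Hz) as [->| ->]; [lra|]. rewrite Cmod_0. apply Cmod_ge_0. }
  destruct (spherical_derivative_bounded h c (Cmod b) 0 Hh Hc) as [Lam [HL HLb]];
    [intros z _; apply HzB|intros z _; apply Homit|].
  destruct (derive_exponential_type h c Hh (spherical_exponential_type h Lam Hh HL HLb))
    as [K [_ HK]].
  destruct (zero_free_exponential_type (fun z => C_derive h z - c)%C K) as [a Ha].
  - eapply entire_of_cdiff. intros z. apply cdiff_minus; [|apply cdiff_const].
    apply entire_is_cdiff, entire_derive, Hh.
  - intros z. apply Cminus_eq_contra. apply Homit.
  - exact HK.
  - cbv beta in Ha. set (beta := (C_derive h 0 - c)%C) in *.
    assert (Hbeta : beta <> 0) by (apply Cminus_eq_contra; apply Homit).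
    assert (Hd : forall z, C_derive h z = (c + beta * Cexp (a * z))%C).
    { intros z. rewrite <- Ha. ring. }
    assert (Hcd : forall z, cdiff h z (c + beta * Cexp (a * z))%C).
    { intros z. rewrite <- Hd. apply entire_is_cdiff. exact Hh. }
    destruct (Ceq_dec a 0) as [E|E].
    + set (k := (c + beta)%C).
      assert (Hk : forall z, C_derive h z = k).
      { intros z. rewrite Hd, E, Cmult_0_l, Cexp_0. unfold k. ring. }
      assert (Hlin : forall z, h z = (h 0 + k * z)%C).
      { apply (equal_of_equal_derivative h (fun z => h 0 + k * z)%C (fun _ => k)).
        - intros z. rewrite <- (Hk z). apply entire_is_cdiff. exact Hh.
        - intros z. apply cdiff_affine.
        - ring. }
      assert (Hk0 : k <> 0).
      { intros Ek. apply Hz1. rewrite (Hlin z1), Ek. ring. }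
      assert (Hroot : h (- h 0 / k)%C = 0) by (rewrite Hlin; field; exact Hk0).
      destruct (Hzero _ Hroot) as [E1|E1]; rewrite Hk in E1; [|contradiction].
      assert (Hall : forall z, h z = 0) by (intros z; apply Hb; rewrite Hk; exact E1).
      apply Hz1. rewrite !Hall. reflexivity.
    + assert (Hkap : (beta / a)%C <> 0).
      { intros Ek. apply Hbeta. replace beta with (beta / a * a)%C by (field; exact E).
        rewrite Ek. ring. }
      destruct (affine_exp_simple_zero c (h 0 - beta / a) (beta / a) a (Cmod b) Hc Hkap E)
        as [z [Hz Hz2]].
      assert (Hexp : forall z, h z = (c * z + (h 0 - beta / a) + beta / a * Cexp (a * z))%C).
      { apply (equal_of_equal_derivative h _ (fun z => c + beta * Cexp (a * z))%C Hcd).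
        - intros w. eapply cdiff_eq; [|apply cdiff_plus;
            [apply cdiff_plus; [apply (cdiff_scal c); apply cdiff_id|apply cdiff_const]|
             apply (cdiff_scal (beta / a)); apply cdiff_Cexp_linear]].
          field. exact E.
        - rewrite !Cmult_0_r, Cexp_0. ring. }
      rewrite <- Hexp in Hz. specialize (HzB z Hz). rewrite Hd in HzB.
      replace (c + beta / a * (a * Cexp (a * z)))%C with (c + beta * Cexp (a * z))%C in Hz2
        by (field; exact E). lra.
Qed.

(** * Factoring out finitely many zeros *)

(** The quotient is differentiable at z0 because h has a second-order expansion
    there, h' being differentiable. *)
Lemma entire_divide (h : C -> C) (z0 : C) : entire h -> h z0 = 0 ->
  exists k, entire k /\ forall z, h z = ((z - z0) * k z)%C.
Proof.
  intros Hh H0. assert (Hh' := entire_derive h Hh).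
  set (k := fun z => if Ceq_dec z z0 then C_derive h z0 else (h z / (z - z0))%C).
  assert (Hk : forall z, z <> z0 -> k z = (h z / (z - z0))%C).
  { intros z Hz. unfold k. destruct (Ceq_dec z z0); [contradiction|reflexivity]. }
  assert (Hk0 : k z0 = C_derive h z0).
  { unfold k. destruct (Ceq_dec z0 z0); [reflexivity|contradiction]. }
  exists k. split.
  - apply entire_cdiff. intros z. destruct (Ceq_dec z z0) as [->|Hz].
    + set (c2 := (C_derive (C_derive h) z0 / 2)%C).
      apply (cdiff_derive _ _ c2). intros eps Heps.
      destruct (entire_is_cdiff _ z0 Hh' eps Heps) as [del [Hdel Hd]].
      exists del. split; [exact Hdel|]. intros w Hw.
      destruct (Ceq_dec w z0) as [->|Hwz].
      { replace (k z0 - k z0 - c2 * (z0 - z0))%C with (RtoC 0) by ring.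
        rewrite Cmod_0, Cmod_zero_sub. lra. }
      assert (Hn : (w - z0)%C <> 0) by (apply Cminus_eq_contra; exact Hwz).
      assert (Hp := proj1 (Cmod_gt_0 _) Hn).
      set (G := fun x => (h x - C_derive h z0 * x - c2 * ((x - z0) * (x - z0)))%C).
      assert (K : Cmod (G w - G z0) <= eps * Cmod (w - z0) * Cmod (w - z0)).
      { apply (mean_value_ineq G
          (fun x => C_derive h x - C_derive h z0 - C_derive (C_derive h) z0 * (x - z0))%C).
        - intros t _. set (x := (z0 + t * (w - z0))%C).
          eapply cdiff_eq; [|apply cdiff_minus; [apply cdiff_minus;
            [apply entire_is_cdiff; exact Hh|apply (cdiff_scal (C_derive h z0)); apply cdiff_id]|
            apply (cdiff_scal c2); apply cdiff_mult; apply cdiff_minus;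
            (apply cdiff_id || apply cdiff_const)]].
          unfold c2. field.
        - intros t Ht.
          assert (E : Cmod (z0 + t * (w - z0) - z0) <= Cmod (w - z0)).
          { replace (z0 + t * (w - z0) - z0)%C with (t * (w - z0))%C by ring.
            rewrite Cmod_mult, Cmod_R, Rabs_pos_eq by lra. nra. }
          eapply Rle_trans; [apply Hd; lra|]. apply Rmult_le_compat_l; lra. }
      rewrite Hk, Hk0 by exact Hwz.
      apply (Rmult_le_reg_r (Cmod (w - z0))); [exact Hp|].
      rewrite <- Cmod_mult. eapply Rle_trans; [|exact K]. right. f_equal.
      unfold G. rewrite H0. field. exact Hn.
    + assert (Hn : (z - z0)%C <> 0) by (apply Cminus_eq_contra; exact Hz).
      eapply cdiff_derive.
      apply (cdiff_ext_loc (fun x => h x / (x - z0))%C _ _ _ (Cmod (z - z0))).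
      * apply Cmod_gt_0. exact Hn.
      * intros w Hw. symmetry. apply Hk. intros ->. rewrite Cmod_sub_comm in Hw. lra.
      * apply cdiff_div; [exact Hn|apply entire_is_cdiff; exact Hh|].
        apply cdiff_minus; [apply cdiff_id|apply cdiff_const].
  - intros z. destruct (Ceq_dec z z0) as [->|Hz].
    + rewrite H0. ring.
    + rewrite Hk by exact Hz. field. apply Cminus_eq_contra. exact Hz.
Qed.

(** Otherwise h = (z - z0)^m k for every m, with k depending on m. Points of the
    circle of radius 3 d + 1 about z1, where d = |z1 - z0|, are at distance at
    least 2 d + 1 from z0, so |k z1| <= Mx / (2 d + 1)^m and
    |h z1| <= Mx (d / (2 d + 1))^m, which tends to 0. *)
Lemma entire_multiplicity (h : C -> C) (z0 z1 : C) : entire h -> h z1 <> 0 ->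
  exists m k, entire k /\ k z0 <> 0 /\ forall z, h z = ((z - z0) ^ m * k z)%C.
Proof.
  intros Hh Hz1. apply NNPP. intros Hn.
  assert (Hall : forall m : nat, exists k, entire k /\ forall z, h z = ((z - z0) ^ m * k z)%C).
  { induction m as [|m [k [Hk1 Hk2]]].
    - exists h. split; [exact Hh|]. intros z. simpl. ring.
    - destruct (Ceq_dec (k z0) 0) as [E|E].
      + destruct (entire_divide k z0 Hk1 E) as [k' [Hk'1 Hk'2]].
        exists k'. split; [exact Hk'1|]. intros z. rewrite Hk2, Hk'2. simpl. ring.
      + exfalso. apply Hn. exists m, k. auto. }
  set (d := Cmod (z1 - z0)). assert (Hd : 0 <= d) by apply Cmod_ge_0.
  destruct (holo_bounded h z0 (4 * d + 2) (4 * d + 1) (entire_holo _ _ _ Hh) ltac:(lra))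
    as [Mx [HMx HMb]].
  set (h1 := Cmod (h z1)). assert (Hh1 : 0 < h1) by (apply Cmod_gt_0; exact Hz1).
  destruct (Pow_x_infinity 2 ltac:(rewrite Rabs_pos_eq; lra) ((Mx + 1) / h1)) as [m Hm].
  specialize (Hm m (Nat.le_refl m)).
  assert (H2m : 0 < 2 ^ m) by (apply pow_lt; lra).
  rewrite Rabs_pos_eq in Hm by lra.
  destruct (Hall m) as [k [Hk1 Hk2]].
  set (s := 2 * d + 1). assert (Hsm : 0 < s ^ m) by (apply pow_lt; unfold s; lra).
  assert (Hkz : Cmod (k z1) <= Mx / s ^ m).
  { apply (centre_le_circle k z1 (3 * d + 2) (3 * d + 1)); [lra|apply entire_holo; exact Hk1|].
    intros w Hw.
    assert (K1 : s <= Cmod (w - z0)).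
    { assert (K := Cmod_sub_lower (w - z1) (z0 - z1)).
      replace (w - z1 - (z0 - z1))%C with (w - z0)%C in K by ring.
      rewrite Hw, (Cmod_sub_comm z0) in K. fold d in K. unfold s; lra. }
    assert (K2 : Cmod (w - z0) <= 4 * d + 1).
    { eapply Rle_trans; [apply (Cmod_sub_trans w z1 z0)|]. fold d. lra. }
    assert (K3 := HMb w K2). rewrite Hk2, Cmod_mult, Cmod_pow in K3.
    apply Rle_div_r; [exact Hsm|].
    eapply Rle_trans; [|exact K3]. rewrite Rmult_comm.
    apply Rmult_le_compat_r; [apply Cmod_ge_0|]. apply pow_incr. unfold s in *; lra. }
  assert (Hh1b : h1 * 2 ^ m <= Mx).
  { unfold h1. rewrite Hk2, Cmod_mult, Cmod_pow. fold d.
    apply Rle_trans with (d ^ m * (Mx / s ^ m) * 2 ^ m).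
    - apply Rmult_le_compat_r; [lra|]. apply Rmult_le_compat_l; [apply pow_le; exact Hd|].
      exact Hkz.
    - replace (d ^ m * (Mx / s ^ m) * 2 ^ m) with (Mx * (d ^ m * 2 ^ m / s ^ m))
        by (field; lra).
      rewrite <- (Rmult_1_r Mx) at 2. apply Rmult_le_compat_l; [exact HMx|].
      rewrite <- Rpow_mult_distr. apply (Rmult_le_reg_r (s ^ m)); [exact Hsm|].
      unfold Rdiv. rewrite Rmult_assoc, Rinv_l, Rmult_1_r, Rmult_1_l by lra.
      apply pow_incr. unfold s; lra. }
  apply (Rmult_ge_compat_r h1) in Hm; [|lra].
  unfold Rdiv in Hm. rewrite Rmult_assoc, Rinv_l in Hm by lra. lra.
Qed.


Lemma polynomial_pad (P : C -> C) : is_polynomial P ->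
  exists (n : nat) (a : nat -> C), forall m, (n <= m)%nat ->
    forall z, P z = sum_n (fun k => a k * Cpow z k)%C m.
Proof.
  intros [n [a Ha]].
  exists n, (fun k => if Nat.leb k n then a k else 0%C). intros m Hm z.
  induction Hm as [|m Hm IH].
  - rewrite Ha. apply sum_n_ext_loc. intros k Hk.
    rewrite (proj2 (Nat.leb_le k n)) by exact Hk. reflexivity.
  - rewrite sum_Sn, <- IH. rewrite (proj2 (Nat.leb_gt (S m) n)) by lia.
    rewrite Cmult_0_l. symmetry. apply Cplus_0_r.
Qed.

Lemma polynomial_const (c : C) : is_polynomial (fun _ => c).
Proof.
  exists O, (fun _ => c). intros z. rewrite sum_O. simpl. ring.
Qed.

Lemma polynomial_plus (P Q : C -> C) :
  is_polynomial P -> is_polynomial Q -> is_polynomial (fun z => P z + Q z)%C.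
Proof.
  intros HP HQ. destruct (polynomial_pad P HP) as [n [a Ha]].
  destruct (polynomial_pad Q HQ) as [m [b Hb]].
  exists (n + m)%nat, (fun k => a k + b k)%C. intros z.
  rewrite (Ha (n + m)%nat) by lia. rewrite (Hb (n + m)%nat) by lia.
  symmetry. rewrite (sum_n_ext _ (fun k => plus (a k * Cpow z k) (b k * Cpow z k))%C).
  - apply (sum_n_plus (G:=C_AbelianMonoid)).
  - intros k. apply Cmult_plus_distr_r.
Qed.

Lemma polynomial_scal (c : C) (P : C -> C) :
  is_polynomial P -> is_polynomial (fun z => c * P z)%C.
Proof.
  intros [n [a Ha]]. exists n, (fun k => c * a k)%C. intros z. rewrite Ha.
  induction n as [|n IH] in |- *.
  - rewrite !sum_O. ring.
  - rewrite !sum_Sn. rewrite <- IH. unfold plus; simpl. ring.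
Qed.

Lemma polynomial_mul_id (P : C -> C) :
  is_polynomial P -> is_polynomial (fun z => z * P z)%C.
Proof.
  intros [n [a Ha]].
  exists (S n), (fun k => match k return C with O => 0%C | S j => a j end). intros z. rewrite Ha.
  induction n as [|n IH] in |- *.
  - rewrite sum_Sn, !sum_O. unfold plus; simpl. ring.
  - rewrite sum_Sn. rewrite (sum_Sn _ (S n)), <- IH. unfold plus; simpl. ring.
Qed.

Lemma polynomial_ext (P Q : C -> C) :
  (forall z, P z = Q z) -> is_polynomial P -> is_polynomial Q.
Proof. intros E [n [a Ha]]. exists n, a. intros z. rewrite <- E. apply Ha. Qed.

Lemma polynomial_linear_factor (P : C -> C) (z0 : C) :
  is_polynomial P -> is_polynomial (fun z => (z - z0) * P z)%C.
Proof.
  intros HP. apply (polynomial_ext (fun z => z * P z + (- z0) * P z)%C).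
  - intros z. ring.
  - apply polynomial_plus; [apply polynomial_mul_id|apply polynomial_scal]; exact HP.
Qed.

Lemma factor_finite_zeros (l : list C) : forall h z1,
  entire h -> h z1 <> 0 -> (forall z, h z = 0 -> In z l) ->
  exists P k, entire P /\ tame P /\ is_polynomial P /\ entire k /\
    (forall z, k z <> 0) /\ forall z, h z = (P z * k z)%C.
Proof.
  induction l as [|z0 l IH]; intros h z1 Hh Hz1 Hl.
  - exists (fun _ => 1%C), h. repeat split.
    + apply (entire_of_cdiff _ (fun _ => 0%C)). intros z. apply cdiff_const.
    + apply tame_1.
    + apply tame_1.
    + apply polynomial_const.
    + exact Hh.
    + intros z Hz. exact (Hl z Hz).
    + intros z. ring.
  - destruct (entire_multiplicity h z0 z1 Hh Hz1) as [m [k1 [Hk1 [Hk10 Hk1h]]]].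
    destruct (IH k1 z0 Hk1 Hk10) as [P [k [HP [HPt [HPp [Hk [Hknz Hkh]]]]]]].
    + intros z Hz. destruct (Hl z) as [E|E]; [|subst z; contradiction|exact E].
      rewrite Hk1h, Hz. ring.
    + assert (Hpow : forall j : nat, let Pj := fun z => ((z - z0) ^ j * P z)%C in
                entire Pj /\ tame Pj /\ is_polynomial Pj).
      { induction j as [|j [IHe [IHt IHp]]]; intros Pj.
        - assert (E : forall z, P z = Pj z) by (intros z; unfold Pj; simpl; ring).
          assert (EF : P = Pj) by (apply functional_extensionality; exact E).
          rewrite <- EF. auto.
        - assert (EF : (fun z => (z - z0) * ((z - z0) ^ j * P z))%C = Pj).
          { apply functional_extensionality. intros z.
            unfold Pj. simpl. ring. }
          rewrite <- EF. split; [|split].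
          + apply entire_cdiff. intros z. eapply cdiff_derive. apply cdiff_mult.
            * apply cdiff_minus; [apply cdiff_id|apply cdiff_const].
            * apply entire_is_cdiff. exact IHe.
          + apply tame_linear_factor. exact IHt.
          + apply polynomial_linear_factor. exact IHp. }
      destruct (Hpow m) as [H1 [H2 H3]].
      exists (fun z => (z - z0) ^ m * P z)%C, k. repeat (split; [assumption|]).
      intros z. rewrite Hk1h, Hkh. ring.
Qed.

Lemma list_bounded (l : list C) : exists R0, 0 <= R0 /\ forall z, In z l -> Cmod z <= R0.
Proof.
  induction l as [|x l [R0 [H0 IH]]].
  - exists 0. split; [lra|]. intros z [].
  - exists (R0 + Cmod x). assert (Hx := Cmod_ge_0 x). split; [lra|].
    intros z [->|Hz]; [lra|]. specialize (IH z Hz). lra.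
Qed.

(** Far out |P| >= 1 and k is smaller than h; inside, k is bounded by its values on a
    circle that stays far out. *)
Lemma quotient_exponential_type (h P k : C -> C) :
  exponential_type h -> tame P -> entire k -> (forall z, h z = (P z * k z)%C) ->
  exponential_type k.
Proof.
  intros [K [HK HKb]] [[m [R1 [HR1 Hm]]] _] Hk Hhk.
  assert (Hfar : forall w, R1 <= Cmod w -> Cmod (k w) <= exp (K * (1 + Cmod w))).
  { intros w Hw. eapply Rle_trans; [|apply HKb]. rewrite Hhk, Cmod_mult.
    destruct (Hm w Hw) as [H1 _]. generalize (Cmod_ge_0 (k w)). nra. }
  exists (K * (1 + 3 * R1)). split; [apply Rmult_le_pos; lra|]. intros z.
  assert (Hz := Cmod_ge_0 z).
  destruct (Rle_dec R1 (Cmod z)) as [Hle|Hgt].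
  - eapply Rle_trans; [apply Hfar; exact Hle|]. apply exp_mono.
    rewrite Rmult_assoc. apply Rmult_le_compat_l; [exact HK|]. nra.
  - apply Rle_trans with (exp (K * (1 + 3 * R1))).
    + apply (centre_le_circle k z (2 * R1 + 1) (2 * R1)); [lra|apply entire_holo; exact Hk|].
      intros w Hw.
      assert (H1 := Cmod_sub_lower (w - z) (- z)). rewrite Cmod_opp in H1.
      replace (w - z - - z)%C with w in H1 by ring.
      assert (H2 : Cmod w <= 3 * R1).
      { assert (Htri := Cmod_le_sub_add w z). lra. }
      eapply Rle_trans; [apply Hfar; lra|]. apply exp_mono. apply Rmult_le_compat_l; lra.
    + apply exp_mono. assert (0 <= K * (1 + 3 * R1)) by (apply Rmult_le_pos; lra). nra.
Qed.

(** Since h' = b only at zeros of h, [spherical_derivative_bounded] applies with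
    c = b outside a disc, so h = k 0 P exp (a z) with a polynomial P. If a <> 0,
    then h' = b at points outside that disc. *)
Lemma finitely_many_zeros_polynomial (h : C -> C) (b : C) (l : list C) :
  entire h -> b <> 0 -> (forall z, C_derive h z = b -> h z = 0) ->
  (forall z, h z = 0 -> In z l) -> is_polynomial h.
Proof.
  intros Hh Hb Hsh Hl.
  destruct (list_bounded l) as [R0 [HR0 HR0l]].
  assert (Hfar : forall z, R0 < Cmod z -> h z <> 0).
  { intros z Hz E. specialize (HR0l z (Hl z E)). lra. }
  assert (Hfar' : forall z, R0 < Cmod z -> C_derive h z <> b).
  { intros z Hz E. exact (Hfar z Hz (Hsh z E)). }
  destruct (spherical_derivative_bounded h b 0 R0 Hh Hb) as [Lam [HL HLb]].
  { intros z Hz E. destruct (Hfar z Hz E). }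
  { exact Hfar'. }
  assert (Het := spherical_exponential_type h Lam Hh HL HLb).
  assert (Hz1 : h (R0 + 1)%R <> 0).
  { apply Hfar. rewrite Cmod_R, Rabs_pos_eq; lra. }
  destruct (factor_finite_zeros l h _ Hh Hz1 Hl) as [P [k [HP [HPt [HPp [Hk [Hknz Hhk]]]]]]].
  destruct (quotient_exponential_type h P k Het HPt Hk Hhk) as [K [_ HK]].
  destruct (zero_free_exponential_type k K Hk Hknz HK) as [a Ha].
  set (kap := k 0) in *.
  destruct (Ceq_dec a 0) as [E|E].
  - apply (polynomial_ext (fun z => kap * P z)%C); [|apply polynomial_scal; exact HPp].
    intros z. rewrite Hhk, Ha, E, Cmult_0_l, Cexp_0. ring.
  - exfalso.
    destruct (polynomial_exp_derivative_value P kap a b R0 HP HPt (Hknz 0) E Hb) as [z [Hz1' Hz2]].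
    apply (Hfar' z Hz1'). rewrite <- Hz2. symmetry. apply cdiff_C_derive.
    apply (cdiff_ext h); [|apply entire_is_cdiff; exact Hh].
    intros w. rewrite Hhk, Ha. ring.
Qed.

Local Open Scope C_scope.

Theorem theorem2p6 (f : C -> C) (b : C)
    (hf : entire f) (hnc : nonconstant f) (hb : b <> 0)
    (hshare : share_allowing_ramification f b) :
  (forall c : C, c <> 0 -> ~ Picard_value (C_derive f) c) /\
  (forall c : C, c <> 0 -> exists z : C, C_derive f z = c) /\
  ~ Picard_value (C_derive f) b /\
  ~ totally_ramified_value f b /\
  ~ Picard_value f b /\
  (transcendental f -> takes_infinitely_often f b).
Proof.
  set (h := fun z => f z - b).
  assert (Hd : forall z, cdiff h z (C_derive f z)).
  { intros z. eapply cdiff_eq; [|apply cdiff_minus;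
      [apply entire_is_cdiff; exact hf|apply cdiff_const]]. ring. }
  assert (Hh : entire h) by (eapply entire_of_cdiff; exact Hd).
  assert (Hh' : forall z, C_derive h z = C_derive f z)
    by (intros z; apply cdiff_C_derive; apply Hd).
  assert (Hhz : forall z, h z = 0 <-> f z = b).
  { intros z. unfold h. symmetry. apply Ceq_minus. }
  assert (Hsurj : forall c : C, c <> 0 -> exists z, C_derive f z = c).
  { intros c Hc. destruct (derivative_surjective_off_0 h b c Hh) as [z Hz].
    - intros z Hz. rewrite Hh'. apply hshare. apply Hhz. exact Hz.
    - intros z Hz. apply Hhz. apply hshare. rewrite <- Hh'. exact Hz.
    - apply NNPP. intros Hn. apply hnc. exists (f 0). intros z.
      apply NNPP. intros Hz. apply Hn. exists z. unfold h. intros E. apply Hz.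
      replace (f z) with (f z - b + b) by ring. rewrite E. ring.
    - exact Hc.
    - exists z. rewrite <- Hh'. exact Hz. }
  assert (Hnp : forall c : C, c <> 0 -> ~ Picard_value (C_derive f) c).
  { intros c Hc HP. destruct (Hsurj c Hc) as [z Hz]. exact (HP z Hz). }
  destruct (Hsurj b hb) as [z0 Hz0]. assert (Hf0 := proj2 (hshare z0) Hz0).
  split; [exact Hnp|]. split; [exact Hsurj|]. split; [exact (Hnp b hb)|]. split; [|split].
  - intros Hr. apply hb. rewrite <- Hz0. apply Hr. exact Hf0.
  - intros HP. exact (HP z0 Hf0).
  - intros Ht l. apply NNPP. intros Hn. apply Ht.
    apply (polynomial_ext (fun z => h z + b)); [intros z; unfold h; ring|].
    apply polynomial_plus; [|apply polynomial_const].
    apply (finitely_many_zeros_polynomial h b l Hh hb).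
    + intros z Hz. apply Hhz. apply hshare. rewrite <- Hh'. exact Hz.
    + intros z Hz. apply NNPP. intros Hi. apply Hn. exists z. split; [|exact Hi].
      apply Hhz. exact Hz.
Qed.
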